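(* Let $D$ be a positive squarefree integer with $N(\varepsilon)=-1$. For all $s\in\mathbb{C}$ away from the poles of the summands, \[ Z_D^{\mathrm{odd}}(s)=\frac{q^{s/2}}{8\,\Gamma(s)\log\varepsilon}\sum_{m\in\mathbb{Z}}(-1)^m\,\Gamma\Big(\frac s2+\frac{\pi i m}{2\log\varepsilon}\Big)\Gamma\Big(\frac s2-\frac{\pi i m}{2\log\varepsilon}\Big), \] where the series converges and agrees with the defining Dirichlet series for $\operatorname{Re}s>0$. Consequently $Z_D^{\mathrm{odd}}$ has meromorphic continuation to $\mathbb{C}$, with simple poles at $s=-2k+\frac{\pi i m}{\log\varepsilon}$ for $m\in\mathbb{Z}$ and integers $k\ge0$.
   Context: $D$ positive squarefree, $\mathcal{O}_D$ the ring of integers of $\mathbb{Q}(\sqrt D)\subset\mathbb{R}$, $\varepsilon>1$ its fundamental unit, $\overline{\varepsilon}$ its conjugate, $N$ the norm. $q=D$ if $D\equiv1\bmod4$, else $q=4D$. $F_D(n)=(\varepsilon^n-\overline{\varepsilon}^{\,n})/\sqrt q$, and $Z_D^{\mathrm{odd}}(s)=\sum_{n\ge1}F_D(2n-1)^{-s}$ for $\operatorname{Re}s>0$. *)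

(* Defs.v *)
From Stdlib Require Import Reals ZArith.
From Coquelicot Require Import Coquelicot.

Open Scope R_scope.

Definition squarefree (D : Z) : Prop :=
  forall k : Z, (k * k | D)%Z -> k = 1%Z \/ k = (-1)%Z.

(** Elements of O_D are written (a + b sqrt D)/2 with a, b integers satisfying:
    a = b mod 2 if D = 1 mod 4, and a, b both even otherwise (classical description). *)
Definition OD_rep (D a b : Z) : Prop :=
  if Z.eqb (D mod 4) 1 then Z.even (a - b) = true
  else (Z.even a = true /\ Z.even b = true).

Definition OD_val (D a b : Z) : R := (IZR a + IZR b * sqrt (IZR D)) / 2.
Definition OD_conj (D a b : Z) : R := (IZR a - IZR b * sqrt (IZR D)) / 2.
Definition OD_norm (D a b : Z) : R := OD_val D a b * OD_conj D a b.

Definition in_OD (D : Z) (x : R) : Prop :=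
  exists a b : Z, OD_rep D a b /\ x = OD_val D a b.

Definition is_unit_OD (D : Z) (x : R) : Prop :=
  x <> 0 /\ in_OD D x /\ in_OD D (/ x).

Definition fundamental_unit (D : Z) (eps : R) : Prop :=
  is_unit_OD D eps /\ 1 < eps /\
  forall u : R, is_unit_OD D u -> 1 < u -> eps <= u.

Definition qD (D : Z) : Z := if Z.eqb (D mod 4) 1 then D else (4 * D)%Z.

Definition FD (D : Z) (eps epsbar : R) (n : nat) : R :=
  (eps ^ n - epsbar ^ n) / sqrt (IZR (qD D)).

Definition Cexp (z : C) : C := (exp (Re z) * cos (Im z), exp (Re z) * sin (Im z)).

Definition cpow_pos (x : R) (z : C) : C := Cexp (z * RtoC (ln x))%C.

Definition CLim (u : nat -> C) : C :=
  (real (Lim_seq (fun n => Re (u n))), real (Lim_seq (fun n => Im (u n)))).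

Definition CSeries (u : nat -> C) : C :=
  (Series (fun n => Re (u n)), Series (fun n => Im (u n))).

Fixpoint poch (z : C) (n : nat) : C :=
  match n with
  | O => z
  | S k => (poch z k * (z + RtoC (INR (S k))))%C
  end.

(** Reciprocal Gamma function (entire), via Gauss' product formula
    1/Gamma(z) = lim_N z(z+1)...(z+N) / (N! N^z). *)
Definition rGamma (z : C) : C :=
  CLim (fun n => (poch z (S n) / (RtoC (INR (fact (S n))) * cpow_pos (INR (S n)) z))%C).

(** Gamma function (meaningful off the poles 0,-1,-2,...). *)
Definition CGamma (z : C) : C := Cinv (rGamma z).

Definition is_zsum (g : Z -> C) (l : C) : Prop :=
  exists l1 l2 : C,
    is_series (K := C_AbsRing) (V := C_NormedModule) (fun m : nat => g (Z.of_nat m)) l1 /\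
    is_series (K := C_AbsRing) (V := C_NormedModule) (fun m : nat => g (- Z.of_nat (S m))%Z) l2 /\
    l = (l1 + l2)%C.

Definition zsum (g : Z -> C) : C :=
  (CSeries (fun m : nat => g (Z.of_nat m)) + CSeries (fun m : nat => g (- Z.of_nat (S m))%Z))%C.

Definition sgnZ (m : Z) : C := if Z.even m then RtoC 1 else RtoC (-1).

Definition Zterm (eps : R) (s : C) (m : Z) : C :=
  (sgnZ m
   * CGamma (s / 2 + Ci * RtoC (PI * IZR m / (2 * ln eps)))
   * CGamma (s / 2 - Ci * RtoC (PI * IZR m / (2 * ln eps))))%C.

Definition Zodd_RHS (D : Z) (eps : R) (s : C) : C :=
  (cpow_pos (IZR (qD D)) (s / 2) / RtoC (8 * ln eps) * rGamma s * zsum (Zterm eps s))%C.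

Definition in_pole_set (eps : R) (s : C) : Prop :=
  exists (k : nat) (m : Z), s = (- 2 * INR k, PI * IZR m / ln eps).

(* Main.v *)
Require Import Defs.
From Stdlib Require Import Reals ZArith Lra Lia.
From Coquelicot Require Import Coquelicot.

(** Write L = log eps. As N(eps) = -1, one has F_D(2n+1) = 2 cosh((2n+1)L) / sqrt q, so that the
    Dirichlet series is q^(s/2) sum_n f_s((2n+1)L) with f_s(x) = (2 cosh x)^(-s), and the formula is
    Poisson summation for f_s, proved with Fejer kernels. The Fourier transform
      B(s,w) = int_0^oo f_s(x) cos(w x) dx = Gamma((s+iw)/2) Gamma((s-iw)/2) / (4 Gamma(s))
    comes from the recurrence (s^2 + w^2) B(s,w) = 4 s (s+1) B(s+2,w) (integration by parts): iterated
    N times it produces the Gauss products of the three Gamma functions, and the remaining factor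
    B(s+2N,w) is asymptotic to 2^(2-s) B(2+2N,0), which is explicit.

    The same recurrence gives the continuation: for Re s > -2N the m-th term divided by Gamma(s) is
    4 (s)_{2N} B(s+2N,w) / (((s+iw)/2)_N ((s-iw)/2)_N) with w = pi m / L, where B(s+2N,w) is
    holomorphic in s uniformly in w and the denominator grows like m^(2N). At a pole p = -2k + i w
    one takes N = k + 1 and isolates the quadratic factor that vanishes. *)

(** Nonnegativity of the Fejer kernel reduces the comparison with the sampled values to a Korovkin
    estimate, which needs only a bound on f_s' in each cell and no theorem on pointwise convergence
    of Fourier series. Convergence of the frequency series is obtained separately, from one step of
    the recurrence, and the Cesaro means then have the same limit. As f_s is even, all integrals
    live on the half-line, cut into cells [2nL, (2n+2)L] centred at the sample points (2n+1)L;
    centring the kernel at L instead of 0 produces the sign (-1)^m. The recurrence determines B only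
    up to a factor of period 2 in s; the asymptotics for large N removes this freedom. Holomorphy is
    proved without contour integrals: each family of functions carries a second-order expansion
    whose constants are uniform in m, so that series can be differentiated termwise. The primitive
    notion is 1/Gamma, and [/ 0 = 0]; thus the identity between Gamma products and continued terms
    holds even at the poles, and nonvanishing matters only for convergence and for the residues. *)

(** * Arithmetic of complex numbers *)

Lemma C_ext (x y : C) : Re x = Re y -> Im x = Im y -> x = y.
Proof. destruct x, y; simpl; intros; subst; reflexivity. Qed.

Lemma RtoC_neq0 (x : R) : x <> 0 -> RtoC x <> 0.
Proof. intros H E; apply H; injection E; auto. Qed.

Lemma Re_mult (x y : C) : Re (x * y)%C = Re x * Re y - Im x * Im y.
Proof. destruct x, y; reflexivity. Qed.

Lemma Im_mult (x y : C) : Im (x * y)%C = Re x * Im y + Im x * Re y.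
Proof. destruct x, y; reflexivity. Qed.

Lemma im_le_Cmod (c : C) : Rabs (Im c) <= Cmod c.
Proof. eapply Rle_trans; [apply Rmax_r | apply (Rmax_Cmod c)]. Qed.

Lemma Cmod_le_Re_Im (c : C) : Cmod c <= Rabs (Re c) + Rabs (Im c).
Proof.
  replace c with (RtoC (Re c) + Ci * RtoC (Im c))%C at 1.
  - eapply Rle_trans; [apply Cmod_triangle|].
    rewrite Cmod_mult, Cmod_Ci, !Cmod_R; lra.
  - apply C_ext; destruct c; simpl; ring.
Qed.

Lemma Cmod_minus_sym (x y : C) : Cmod (x - y)%C = Cmod (y - x)%C.
Proof. rewrite <- Cmod_opp; f_equal; ring. Qed.

Lemma Cmod_triangle_inv (x y : C) : Cmod x - Cmod y <= Cmod (x - y)%C.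
Proof.
  assert (H := Cmod_triangle (x - y) y).
  replace (x - y + y)%C with x in H by ring; lra.
Qed.

Lemma Cinv_0 : (/ RtoC 0)%C = RtoC 0.
Proof. apply C_ext; simpl; unfold Rdiv; ring. Qed.

(* Also at 0, since [/ 0 = 0]. *)
Lemma Cinv_mult_total (x y : C) : (/ (x * y) = / x * / y)%C.
Proof.
  destruct (Ceq_dec x 0) as [->|Hx]; [rewrite Cmult_0_l, Cinv_0; ring|].
  destruct (Ceq_dec y 0) as [->|Hy]; [rewrite Cmult_0_r, Cinv_0; ring|].
  field; auto.
Qed.

Lemma Cmult_eq_reg_r (z x y : C) : (x * z = y * z)%C -> z <> 0 -> x = y.
Proof.
  intros H Hz; replace x with (x * z * / z)%C by (field; auto).
  rewrite H; field; auto.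
Qed.

(** * Limits of complex sequences and series *)

Definition Clim (u : nat -> C) (l : C) : Prop :=
  is_lim_seq (fun n => Re (u n)) (Re l) /\ is_lim_seq (fun n => Im (u n)) (Im l).

Lemma Clim_unique (u : nat -> C) (l l' : C) : Clim u l -> Clim u l' -> l = l'.
Proof.
  intros [A B] [A' B']; apply is_lim_seq_unique in A, B, A', B'.
  apply C_ext; congruence.
Qed.

Lemma Clim_CLim (u : nat -> C) (l : C) : Clim u l -> CLim u = l.
Proof.
  intros [A B]; apply is_lim_seq_unique in A, B.
  apply C_ext; unfold CLim; simpl; [rewrite A|rewrite B]; reflexivity.
Qed.

Lemma Clim_ext_loc (u v : nat -> C) (l : C) (N : nat) :
  (forall n, (N <= n)%nat -> u n = v n) -> Clim u l -> Clim v l.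
Proof.
  intros H [A B]; split; eapply is_lim_seq_ext_loc; eauto;
    exists N; intros n Hn; now rewrite H.
Qed.

Lemma Clim_const (c : C) : Clim (fun _ => c) c.
Proof. split; apply is_lim_seq_const. Qed.

Lemma Clim_plus (u v : nat -> C) (l m : C) :
  Clim u l -> Clim v m -> Clim (fun n => u n + v n)%C (l + m)%C.
Proof. intros [A B] [A' B']; split; simpl; now apply is_lim_seq_plus'. Qed.

Lemma Clim_mult (u v : nat -> C) (l m : C) :
  Clim u l -> Clim v m -> Clim (fun n => u n * v n)%C (l * m)%C.
Proof.
  intros [A B] [A' B']; split; simpl.
  - apply is_lim_seq_minus'; now apply is_lim_seq_mult'.
  - apply is_lim_seq_plus'; now apply is_lim_seq_mult'.
Qed.

Lemma Clim_RtoC (u : nat -> R) (l : R) : is_lim_seq u l -> Clim (fun n => RtoC (u n)) l.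
Proof. intros H; split; simpl; auto; apply is_lim_seq_const. Qed.

Lemma is_lim_seq_pow2 (u : nat -> R) (l : R) :
  is_lim_seq u l -> is_lim_seq (fun n => u n ^ 2) (l ^ 2).
Proof.
  intros H; simpl; apply is_lim_seq_mult'; [|apply is_lim_seq_mult']; auto.
  apply is_lim_seq_const.
Qed.

Lemma Clim_inv (u : nat -> C) (l : C) : l <> 0 -> Clim u l -> Clim (fun n => / u n)%C (/ l)%C.
Proof.
  intros Hl [A B].
  assert (N : Re l ^ 2 + Im l ^ 2 <> 0).
  { intros E; apply Hl, Cmod_eq_0. rewrite <- Cmod2_alt in E.
    assert (H := Cmod_ge_0 l); nra. }
  split; simpl Re; simpl Im; apply is_lim_seq_div'; auto.
  2: exact (proj1 (is_lim_seq_opp _ (Finite _)) B).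
  all: apply is_lim_seq_plus'; now apply is_lim_seq_pow2.
Qed.

Lemma Clim_subseq (u : nat -> C) (l : C) (phi : nat -> nat) :
  filterlim phi eventually eventually -> Clim u l -> Clim (fun n => u (phi n)) l.
Proof.
  intros H [A B]; split; [apply (is_lim_seq_subseq (fun n => Re (u n)))|
    apply (is_lim_seq_subseq (fun n => Im (u n)))]; auto.
Qed.

Lemma is_lim_seq_abs_le (u v : nat -> R) (l : R) (N : nat) :
  (forall n, (N <= n)%nat -> Rabs (u n - l) <= v n) -> is_lim_seq v 0 -> is_lim_seq u l.
Proof.
  intros H Hv.
  apply is_lim_seq_le_le_loc with (fun n => l - v n) (fun n => l + v n).
  - exists N; intros n Hn; specialize (H n Hn); apply Rabs_le_between in H; lra.
  - evar_last; [apply is_lim_seq_minus'; [apply is_lim_seq_const|apply Hv]|]; simpl; f_equal; ring.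
  - evar_last; [apply is_lim_seq_plus'; [apply is_lim_seq_const|apply Hv]|]; simpl; f_equal; ring.
Qed.

Lemma Clim_le (u : nat -> C) (v : nat -> R) (l : C) (N : nat) :
  (forall n, (N <= n)%nat -> Cmod (u n - l)%C <= v n) -> is_lim_seq v 0 -> Clim u l.
Proof.
  intros H Hv; split; eapply is_lim_seq_abs_le; eauto; intros n Hn; simpl;
    (eapply Rle_trans; [|apply (H n Hn)]).
  - apply (re_le_Cmod (u n - l)%C).
  - apply (im_le_Cmod (u n - l)%C).
Qed.

Lemma Clim_Cmod0 (u : nat -> C) (l : C) :
  Clim u l -> is_lim_seq (fun n => Cmod (u n - l)%C) 0.
Proof.
  intros [A B].
  apply is_lim_seq_le_le with (fun _ => 0)
    (fun n => Rabs (Re (u n) - Re l) + Rabs (Im (u n) - Im l)).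
  - intros n; split; [apply Cmod_ge_0|apply (Cmod_le_Re_Im (u n - l)%C)].
  - apply is_lim_seq_const.
  - replace (Finite 0) with (Finite (Rabs (Re l - Re l) + Rabs (Im l - Im l)))
      by (f_equal; unfold Rminus; rewrite !Rplus_opp_r, Rabs_R0; ring).
    apply is_lim_seq_plus'; apply (is_lim_seq_abs _ (Finite _)); apply is_lim_seq_minus'; auto;
      apply is_lim_seq_const.
Qed.

Lemma Clim_Cmod (u : nat -> C) (l : C) :
  Clim u l -> is_lim_seq (fun n => Cmod (u n)) (Cmod l).
Proof.
  intros H; apply is_lim_seq_abs_le with (fun n => Cmod (u n - l)%C) O.
  - intros n _; apply Rabs_le; split.
    + rewrite Cmod_minus_sym; assert (H' := Cmod_triangle_inv l (u n)); lra.
    + apply Cmod_triangle_inv.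
  - now apply Clim_Cmod0.
Qed.

Definition CIs (u : nat -> C) (l : C) : Prop :=
  is_series (K := C_AbsRing) (V := C_NormedModule) u l.

Lemma Re_sum_n (u : nat -> C) (n : nat) :
  Re (sum_n (G := C_AbelianMonoid) u n) = sum_n (fun k => Re (u k)) n.
Proof. induction n; [now rewrite !sum_O|]. rewrite !sum_Sn, <- IHn; reflexivity. Qed.

Lemma Im_sum_n (u : nat -> C) (n : nat) :
  Im (sum_n (G := C_AbelianMonoid) u n) = sum_n (fun k => Im (u k)) n.
Proof. induction n; [now rewrite !sum_O|]. rewrite !sum_Sn, <- IHn; reflexivity. Qed.

Lemma Clim_filterlim (u : nat -> C) (l : C) :
  Clim u l <-> filterlim u eventually (locally (T := C_UniformSpace) l).
Proof.
  split.
  - intros [A B].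
    apply filterlim_locally; intros eps.
    apply is_lim_seq_spec in A, B.
    destruct (A eps) as [N1 H1], (B eps) as [N2 H2].
    exists (N1 + N2)%nat; intros n Hn; split; [apply H1|apply H2]; lia.
  - intros H; rewrite filterlim_locally in H.
    split; apply is_lim_seq_spec; intros eps; destruct (H eps) as [N HN];
      exists N; intros n Hn; apply (HN n Hn).
Qed.

Lemma CIs_Clim (u : nat -> C) (l : C) :
  CIs u l <-> Clim (fun n => sum_n (G := C_AbelianMonoid) u n) l.
Proof. symmetry; apply Clim_filterlim. Qed.

Lemma CIs_Re_Im (u : nat -> C) (l : C) :
  CIs u l <-> is_series (fun n => Re (u n)) (Re l) /\ is_series (fun n => Im (u n)) (Im l).
Proof.
  rewrite CIs_Clim; unfold Clim.
  split; intros [A B]; split.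
  - exact (is_lim_seq_ext _ _ (Finite (Re l)) (Re_sum_n u) A).
  - exact (is_lim_seq_ext _ _ (Finite (Im l)) (Im_sum_n u) B).
  - exact (is_lim_seq_ext _ _ (Finite (Re l)) (fun n => eq_sym (Re_sum_n u n)) A).
  - exact (is_lim_seq_ext _ _ (Finite (Im l)) (fun n => eq_sym (Im_sum_n u n)) B).
Qed.

Lemma CIs_CSeries (u : nat -> C) (l : C) : CIs u l -> CSeries u = l.
Proof.
  rewrite CIs_Re_Im; intros [A B]; apply C_ext; simpl; now apply is_series_unique.
Qed.

Lemma CIs_ext (u v : nat -> C) (l : C) : (forall n, u n = v n) -> CIs u l -> CIs v l.
Proof. intros H; now apply is_series_ext. Qed.

Lemma CIs_plus (u v : nat -> C) (l m : C) :
  CIs u l -> CIs v m -> CIs (fun n => u n + v n)%C (l + m)%C.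
Proof. apply (is_series_plus (V := C_NormedModule)). Qed.

Lemma CIs_scal (c : C) (u : nat -> C) (l : C) :
  CIs u l -> CIs (fun n => c * u n)%C (c * l)%C.
Proof. apply (is_series_scal (V := C_NormedModule)). Qed.

Lemma CIs_minus (u v : nat -> C) (l m : C) :
  CIs u l -> CIs v m -> CIs (fun n => u n - v n)%C (l - m)%C.
Proof. apply (is_series_minus (V := C_NormedModule)). Qed.

Lemma CIs_dominated (u : nat -> C) (b : nat -> R) :
  (forall n, Cmod (u n) <= b n) -> ex_series b -> CIs u (CSeries u).
Proof.
  intros H Hb.
  destruct (ex_series_le (V := C_CompleteNormedModule) u b) as [l Hl]; auto.
  now rewrite (CIs_CSeries u l Hl).
Qed.

Lemma Cmod_sum_n_le (u : nat -> C) (b : nat -> R) (n : nat) :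
  (forall n, Cmod (u n) <= b n) -> Cmod (sum_n (G := C_AbelianMonoid) u n) <= sum_n b n.
Proof.
  intros H; induction n; [now rewrite !sum_O|]. rewrite !sum_Sn.
  eapply Rle_trans; [apply Cmod_triangle|].
  apply Rplus_le_compat; auto.
Qed.

Lemma CIs_Cmod_le (u : nat -> C) (b : nat -> R) (l : C) (S : R) :
  (forall n, Cmod (u n) <= b n) -> is_series b S -> CIs u l -> Cmod l <= S.
Proof.
  intros H Hb Hl; apply CIs_Clim, Clim_Cmod in Hl.
  assert (Hb' : is_lim_seq (sum_n b) S) by exact Hb.
  refine (is_lim_seq_le _ _ _ _ _ Hl Hb').
  intros n; now apply Cmod_sum_n_le.
Qed.

Lemma CIs_incr_1 (u : nat -> C) (l : C) :
  CIs u l -> CIs (fun n => u (S n)) (l - u O)%C.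
Proof.
  intros H; apply (is_series_incr_1 (V := C_NormedModule)).
  match goal with |- is_series _ ?x => replace x with l end; auto.
  change (l = l - u O + u O)%C; ring.
Qed.

(** * Calculus of complex-valued functions of a real variable *)

Definition Ccont (f : R -> C) (x : R) : Prop :=
  continuous (fun t => Re (f t)) x /\ continuous (fun t => Im (f t)) x.

Definition Cder (f : R -> C) (x : R) (d : C) : Prop :=
  is_derive (fun t => Re (f t)) x (Re d) /\ is_derive (fun t => Im (f t)) x (Im d).

Definition CInt (f : R -> C) (a b : R) : C :=
  (RInt (fun t => Re (f t)) a b, RInt (fun t => Im (f t)) a b).

Lemma Ccont_ext (f g : R -> C) (x : R) : (forall t, f t = g t) -> Ccont f x -> Ccont g x.
Proof.
  intros H [A B]; split.
  - refine (continuous_ext _ _ x _ A); intros t; f_equal; apply H.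
  - refine (continuous_ext _ _ x _ B); intros t; f_equal; apply H.
Qed.

Lemma Ccont_const (c : C) (x : R) : Ccont (fun _ => c) x.
Proof. split; apply continuous_const. Qed.

Lemma Ccont_RtoC (g : R -> R) (x : R) : continuous g x -> Ccont (fun t => RtoC (g t)) x.
Proof. intros H; split; simpl; auto; apply continuous_const. Qed.

Lemma Ccont_plus (f g : R -> C) (x : R) :
  Ccont f x -> Ccont g x -> Ccont (fun t => f t + g t)%C x.
Proof. intros [A B] [A' B']; split; now apply (continuous_plus (V := R_NormedModule)). Qed.

Lemma Ccont_minus (f g : R -> C) (x : R) :
  Ccont f x -> Ccont g x -> Ccont (fun t => f t - g t)%C x.
Proof. intros [A B] [A' B']; split; now apply (continuous_minus (V := R_NormedModule)). Qed.

Lemma Ccont_mult (f g : R -> C) (x : R) :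
  Ccont f x -> Ccont g x -> Ccont (fun t => f t * g t)%C x.
Proof.
  intros [A B] [A' B']; split; simpl.
  - apply (continuous_minus (V := R_NormedModule));
      now apply (continuous_mult (K := R_AbsRing)).
  - apply (continuous_plus (V := R_NormedModule));
      now apply (continuous_mult (K := R_AbsRing)).
Qed.

Lemma Cder_cont (f : R -> C) (x : R) (d : C) : Cder f x d -> Ccont f x.
Proof.
  intros [A B]; split.
  - apply (ex_derive_continuous (V := R_NormedModule)); eexists; apply A.
  - apply (ex_derive_continuous (V := R_NormedModule)); eexists; apply B.
Qed.

Lemma Cder_const (c : C) (x : R) : Cder (fun _ => c) x 0%C.
Proof. split; apply (is_derive_const (V := R_NormedModule)). Qed.

Lemma Cder_RtoC (g : R -> R) (x d : R) : is_derive g x d -> Cder (fun t => RtoC (g t)) x d.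
Proof. intros H; split; simpl; auto; apply (is_derive_const (V := R_NormedModule)). Qed.

Lemma Cder_plus (f g : R -> C) (x : R) (d e : C) :
  Cder f x d -> Cder g x e -> Cder (fun t => f t + g t)%C x (d + e)%C.
Proof. intros [A B] [A' B']; split; now apply (is_derive_plus (V := R_NormedModule)). Qed.

Lemma Cder_minus (f g : R -> C) (x : R) (d e : C) :
  Cder f x d -> Cder g x e -> Cder (fun t => f t - g t)%C x (d - e)%C.
Proof. intros [A B] [A' B']; split; now apply (is_derive_minus (V := R_NormedModule)). Qed.

Lemma Cder_mult (f g : R -> C) (x : R) (d e : C) :
  Cder f x d -> Cder g x e -> Cder (fun t => f t * g t)%C x (d * g x + f x * e)%C.
Proof.
  intros [A B] [A' B'].
  assert (M : forall (h k : R -> R) (p q : R), is_derive h x p -> is_derive k x q ->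
    is_derive (fun t => h t * k t) x (p * k x + h x * q)).
  { intros h k p q Hh Hk; apply (is_derive_mult (K := R_AbsRing) h k x p q Hh Hk).
    exact Rmult_comm. }
  split.
  - evar_last.
    + apply (is_derive_minus (V := R_NormedModule) (fun t => Re (f t) * Re (g t))
        (fun t => Im (f t) * Im (g t)) x); apply M; eassumption.
    + unfold minus, plus, opp; simpl; unfold Re, Im; ring.
  - evar_last.
    + apply (is_derive_plus (V := R_NormedModule) (fun t => Re (f t) * Im (g t))
        (fun t => Im (f t) * Re (g t)) x); apply M; eassumption.
    + unfold plus; simpl; unfold Re, Im; ring.
Qed.

Lemma Cder_exp (g : R -> C) (x : R) (d : C) :
  Cder g x d -> Cder (fun t => Cexp (g t)) x (d * Cexp (g x))%C.
Proof.
  intros [A B]; split; simpl.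
  - evar_last.
    + apply (is_derive_mult (K := R_AbsRing)); [| |exact Rmult_comm].
      * apply (is_derive_comp (V := R_NormedModule) exp); [apply is_derive_exp|apply A].
      * apply (is_derive_comp (V := R_NormedModule) cos); [apply is_derive_cos|apply B].
    + cbv [plus scal mult]; simpl; unfold mult, Re, Im; simpl; ring.
  - evar_last.
    + apply (is_derive_mult (K := R_AbsRing)); [| |exact Rmult_comm].
      * apply (is_derive_comp (V := R_NormedModule) exp); [apply is_derive_exp|apply A].
      * apply (is_derive_comp (V := R_NormedModule) sin); [apply is_derive_sin|apply B].
    + cbv [plus scal mult]; simpl; unfold mult, Re, Im; simpl; ring.
Qed.

Lemma Ccont_ex_RInt (f : R -> C) (a b : R) :
  (forall x, Ccont f x) ->
  ex_RInt (fun t => Re (f t)) a b /\ ex_RInt (fun t => Im (f t)) a b.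
Proof.
  intros H; split; apply (ex_RInt_continuous (V := R_CompleteNormedModule));
    intros; apply (H z).
Qed.

Lemma CInt_ext (f g : R -> C) (a b : R) : (forall x, f x = g x) -> CInt f a b = CInt g a b.
Proof.
  intros H; apply C_ext; apply RInt_ext; intros; now rewrite H.
Qed.

Lemma CInt_plus (f g : R -> C) (a b : R) :
  (forall x, Ccont f x) -> (forall x, Ccont g x) ->
  CInt (fun x => f x + g x)%C a b = (CInt f a b + CInt g a b)%C.
Proof.
  intros Hf Hg.
  destruct (Ccont_ex_RInt f a b Hf), (Ccont_ex_RInt g a b Hg).
  apply C_ext; now apply (RInt_plus (V := R_CompleteNormedModule)).
Qed.

Lemma CInt_minus (f g : R -> C) (a b : R) :
  (forall x, Ccont f x) -> (forall x, Ccont g x) ->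
  CInt (fun x => f x - g x)%C a b = (CInt f a b - CInt g a b)%C.
Proof.
  intros Hf Hg.
  destruct (Ccont_ex_RInt f a b Hf), (Ccont_ex_RInt g a b Hg).
  apply C_ext; now apply (RInt_minus (V := R_CompleteNormedModule)).
Qed.

Lemma CInt_scal (c : C) (f : R -> C) (a b : R) :
  (forall x, Ccont f x) -> CInt (fun x => c * f x)%C a b = (c * CInt f a b)%C.
Proof.
  intros Hf; destruct (Ccont_ex_RInt f a b Hf) as [A B].
  assert (M : forall k g, ex_RInt g a b -> k * RInt g a b = RInt (fun t => k * g t) a b).
  { intros k g Hg; symmetry; apply (RInt_scal (V := R_CompleteNormedModule)), Hg. }
  assert (X : forall k g, ex_RInt g a b -> ex_RInt (fun t => k * g t) a b).
  { intros k g Hg; apply (ex_RInt_scal (V := R_NormedModule)), Hg. }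
  apply C_ext; simpl; rewrite !M by assumption.
  - apply (RInt_minus (V := R_CompleteNormedModule)); now apply X.
  - apply (RInt_plus (V := R_CompleteNormedModule)); now apply X.
Qed.

Lemma CInt_RtoC (g : R -> R) (a b : R) : CInt (fun x => RtoC (g x)) a b = RtoC (RInt g a b).
Proof.
  apply C_ext; simpl; [reflexivity|].
  rewrite RInt_const; unfold scal; simpl; unfold mult; simpl; ring.
Qed.

Lemma CInt_derive (f df : R -> C) (a b : R) :
  (forall x, Cder f x (df x)) -> (forall x, Ccont df x) ->
  CInt df a b = (f b - f a)%C.
Proof.
  intros H Hc; apply C_ext; simpl; apply (is_RInt_unique (V := R_CompleteNormedModule)).
  - apply (is_RInt_derive (V := R_CompleteNormedModule) (fun t => Re (f t)));
      intros; [apply (H x)|apply (Hc x)].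
  - apply (is_RInt_derive (V := R_CompleteNormedModule) (fun t => Im (f t)));
      intros; [apply (H x)|apply (Hc x)].
Qed.

(** Separate estimates of the two components would cost a constant factor; in C as a real normed
    module the norm inequality for integrals has constant 1. *)
Lemma CInt_Cmod_le (f : R -> C) (g : R -> R) (a b : R) :
  a <= b -> (forall x, Ccont f x) -> ex_RInt g a b ->
  (forall x, a <= x <= b -> Cmod (f x) <= g x) -> Cmod (CInt f a b) <= RInt g a b.
Proof.
  intros Hab Hf Hg H; destruct (Ccont_ex_RInt f a b Hf) as [A B].
  assert (E : forall z : C, norm (V := C_R_NormedModule) z = Cmod z).
  { intros z; unfold norm; simpl; unfold prod_norm, Cmod; f_equal.
    unfold norm; simpl; unfold abs; simpl. rewrite !Rmult_1_r.
    rewrite <- !Rabs_mult, !(Rabs_pos_eq (_ * _)); auto; apply Rle_0_sqr. }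
  rewrite <- E.
  apply (norm_RInt_le (V := C_R_NormedModule)) with f g a b; auto.
  - intros; rewrite E; auto.
  - apply (is_RInt_fct_extend_pair (U := R_NormedModule) (V := R_NormedModule) f);
      now apply (RInt_correct (V := R_CompleteNormedModule)).
  - now apply (RInt_correct (V := R_CompleteNormedModule)).
Qed.

Lemma RInt_const_R (a b c : R) : RInt (fun _ => c) a b = (b - a) * c.
Proof. rewrite RInt_const; reflexivity. Qed.

(** The mean value theorem fails for complex values, so the increment is written as the integral of
    the derivative. The order of [a] and [b] is left free because the Fejer estimate compares a cell
    centre with points on both sides. *)
Lemma Cder_lipschitz (f df : R -> C) (a b M : R) :
  (forall x, Cder f x (df x)) -> (forall x, Ccont df x) ->
  (forall x, Rmin a b <= x <= Rmax a b -> Cmod (df x) <= M) ->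
  Cmod (f b - f a)%C <= M * Rabs (b - a).
Proof.
  assert (H : forall a b, a <= b -> (forall x, Cder f x (df x)) -> (forall x, Ccont df x) ->
    (forall x, a <= x <= b -> Cmod (df x) <= M) -> Cmod (f b - f a)%C <= M * Rabs (b - a)).
  { clear a b; intros a b Hab Hd Hc HM.
    rewrite <- (CInt_derive f df a b Hd Hc), (Rabs_pos_eq (b - a)), Rmult_comm by lra.
    rewrite <- RInt_const_R; apply CInt_Cmod_le; auto; apply ex_RInt_const. }
  intros Hd Hc HM; destruct (Rle_lt_dec a b) as [Hab|Hab].
  - apply H; auto. intros x Hx; apply HM; rewrite Rmin_left, Rmax_right; auto.
  - rewrite Cmod_minus_sym, Rabs_minus_sym; apply H; auto; try lra.
    intros x Hx; apply HM; rewrite Rmin_right, Rmax_left; lra.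
Qed.

(** * The complex exponential *)

Lemma Cexp_plus (x y : C) : Cexp (x + y)%C = (Cexp x * Cexp y)%C.
Proof.
  apply C_ext; simpl; rewrite exp_plus; [rewrite cos_plus|rewrite sin_plus];
    unfold Re, Im; ring.
Qed.

Lemma Cexp_RtoC (x : R) : Cexp (RtoC x) = RtoC (exp x).
Proof. apply C_ext; simpl; [rewrite cos_0|rewrite sin_0]; ring. Qed.

Lemma Cexp_0 : Cexp (RtoC 0) = RtoC 1.
Proof. rewrite Cexp_RtoC, exp_0; reflexivity. Qed.

Lemma Cmod_Cexp (z : C) : Cmod (Cexp z) = exp (Re z).
Proof.
  unfold Cmod, Cexp; simpl fst; simpl snd.
  replace ((exp (Re z) * cos (Im z)) ^ 2 + (exp (Re z) * sin (Im z)) ^ 2)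
    with (exp (Re z) ^ 2).
  - apply sqrt_pow2, Rlt_le, exp_pos.
  - assert (H := sin2_cos2 (Im z)); unfold Rsqr in H.
    transitivity (exp (Re z) ^ 2 * (sin (Im z) * sin (Im z) + cos (Im z) * cos (Im z)));
      [rewrite H; ring|ring].
Qed.

Lemma Cexp_neq0 (z : C) : Cexp z <> 0.
Proof. apply Cmod_gt_0; rewrite Cmod_Cexp; apply exp_pos. Qed.

Lemma exp_le (x y : R) : x <= y -> exp x <= exp y.
Proof. intros [H| ->]; [left; now apply exp_increasing|right; reflexivity]. Qed.

Lemma Cder_scal_t (z : C) (x : R) : Cder (fun t => RtoC t * z)%C x z.
Proof.
  assert (H := Cder_mult (fun t => RtoC t) (fun _ => z) x 1 0
    (Cder_RtoC (fun t => t) x 1 (is_derive_id _)) (Cder_const z x)).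
  cbv beta in H; replace (1 * z + x * 0)%C with z in H by ring; exact H.
Qed.

Lemma Cder_Cexp_t (z : C) (x : R) :
  Cder (fun t => Cexp (RtoC t * z))%C x (z * Cexp (RtoC x * z))%C.
Proof. apply (Cder_exp (fun t => RtoC t * z)%C), Cder_scal_t. Qed.

Lemma Cexp_minus_1_le (z : C) : Cmod (Cexp z - 1)%C <= Cmod z * exp (Cmod z).
Proof.
  assert (H := Cder_lipschitz (fun t => Cexp (RtoC t * z))%C
    (fun t => z * Cexp (RtoC t * z))%C 0 1 (Cmod z * exp (Cmod z))).
  rewrite Rminus_0_r, Rabs_R1, Rmult_1_r, Cmult_0_l, Cmult_1_l, Cexp_0 in H.
  apply H.
  - intros x; apply Cder_Cexp_t.
  - intros x; apply Ccont_mult; [apply Ccont_const|eapply Cder_cont, Cder_Cexp_t].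
  - intros x; rewrite Rmin_left, Rmax_right by lra; intros Hx.
    rewrite Cmod_mult, Cmod_Cexp; apply Rmult_le_compat_l; [apply Cmod_ge_0|].
    apply exp_le. simpl.
    assert (Q := re_le_Cmod z); apply Rabs_le_between in Q.
    assert (P := Cmod_ge_0 z); unfold Re in Q; nra.
Qed.

(** The mean value inequality applied to exp(tz) - tz on [0, 1]: its derivative z (exp(tz) - 1) is
    controlled by the first-order bound. *)
Lemma Cexp_minus_1_minus_le (z : C) :
  Cmod (Cexp z - 1 - z)%C <= Cmod z ^ 2 * exp (Cmod z).
Proof.
  assert (D : forall x, Cder (fun t => Cexp (RtoC t * z) - RtoC t * z)%C x
    (z * Cexp (RtoC x * z) - z)%C).
  { intros x; apply Cder_minus; [apply Cder_Cexp_t|apply Cder_scal_t]. }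
  assert (H := Cder_lipschitz _ _ 0 1 (Cmod z ^ 2 * exp (Cmod z)) D).
  rewrite Rminus_0_r, Rabs_R1, Rmult_1_r, Cmult_0_l, Cmult_1_l, Cexp_0 in H.
  replace (Cexp z - 1 - z)%C with (Cexp z - z - (1 - 0))%C by ring.
  apply H.
  - intros x; apply Ccont_minus; [apply Ccont_mult|]; try apply Ccont_const.
    eapply Cder_cont, Cder_Cexp_t.
  - intros x; rewrite Rmin_left, Rmax_right by lra; intros Hx.
    replace (z * Cexp (x * z) - z)%C with (z * (Cexp (x * z) - 1))%C by ring.
    rewrite Cmod_mult; simpl (_ ^ 2); rewrite Rmult_1_r, Rmult_assoc.
    apply Rmult_le_compat_l; [apply Cmod_ge_0|].
    eapply Rle_trans; [apply Cexp_minus_1_le|].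
    assert (P := Cmod_ge_0 z).
    rewrite Cmod_mult, Cmod_R, Rabs_pos_eq by lra.
    apply Rmult_le_compat; try nra.
    + left; apply exp_pos.
    + apply exp_le; nra.
Qed.

(** * Infinite products and the reciprocal Gamma function *)

Lemma is_lim_seq_inv_S : is_lim_seq (fun n => / (INR n + 1)) 0.
Proof.
  replace (Finite 0) with (Rbar_inv p_infty) by reflexivity.
  apply is_lim_seq_inv; [|discriminate].
  apply is_lim_seq_le_p_loc with INR; [exists O; intros; lra|apply is_lim_seq_INR].
Qed.

Lemma ex_series_inv_sqr : ex_series (fun n => / (INR n + 1) ^ 2).
Proof.
  apply (ex_series_le (V := R_CompleteNormedModule)) with
    (fun n => scal 2 (/ ((INR n + 1) * (INR n + 2)))).
  - intros n; assert (H := pos_INR n).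
    unfold norm; simpl; unfold abs, scal; simpl; unfold mult; simpl.
    rewrite Rabs_pos_eq by (left; apply Rinv_0_lt_compat; nra).
    replace (2 * / ((INR n + 1) * (INR n + 2))) with (/ ((INR n + 1) * (INR n + 2) / 2))
      by (field; lra).
    apply Rinv_le_contravar; nra.
  - apply (ex_series_scal (V := R_NormedModule)); exists 1.
    assert (E : forall n, 1 - / (INR n + 2) = sum_n (fun n => / ((INR n + 1) * (INR n + 2))) n).
    { induction n; [rewrite sum_O; simpl; field|].
      rewrite sum_Sn, <- IHn, S_INR; unfold plus; simpl.
      assert (H := pos_INR n); field; lra. }
    change (is_lim_seq (sum_n (fun n => / ((INR n + 1) * (INR n + 2)))) 1).
    eapply is_lim_seq_ext; [apply E|].
    replace (Finite 1) with (Finite (1 - 0)) by (f_equal; ring).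
    apply is_lim_seq_minus'; [apply is_lim_seq_const|].
    apply is_lim_seq_ext with (fun n => / (INR (S n) + 1)).
    { intros n; rewrite S_INR; f_equal; ring. }
    apply (is_lim_seq_incr_1 (fun n => / (INR n + 1))), is_lim_seq_inv_S.
Qed.

Lemma is_series_nonneg_sum_le (v : nat -> R) (S : R) (n : nat) :
  (forall k, 0 <= v k) -> is_series v S -> sum_n v n <= S.
Proof.
  intros Hv HS.
  apply (is_lim_seq_incr_compare (sum_n v) S HS).
  intros k; rewrite sum_Sn; unfold plus; simpl; specialize (Hv (Datatypes.S k)); lra.
Qed.

(** From |1 + e| <= 1 + v <= exp v, multiplied over all factors. *)
Lemma product_bound (u e : nat -> C) (v : nat -> R) (S : R) :
  (forall n, u (Datatypes.S n) = u n * (1 + e n))%C ->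
  (forall n, Cmod (e n) <= v n) -> is_series v S ->
  forall n, Cmod (u n) <= Cmod (u O) * exp S.
Proof.
  intros Hu He HS.
  assert (Hv : forall k, 0 <= v k) by (intros k; eapply Rle_trans; [apply Cmod_ge_0|apply He]).
  assert (B : forall n, Cmod (u (Datatypes.S n)) <= Cmod (u O) * exp (sum_n v n)).
  { assert (st : forall n, Cmod (u (Datatypes.S n)) <= Cmod (u n) * exp (v n)).
    { intros n; rewrite Hu, Cmod_mult; apply Rmult_le_compat_l; [apply Cmod_ge_0|].
      eapply Rle_trans; [apply Cmod_triangle|]; rewrite Cmod_1.
      eapply Rle_trans; [apply Rplus_le_compat_l, He|].
      destruct (Req_dec (v n) 0) as [->|N]; [rewrite exp_0; lra|left; now apply exp_ineq1]. }
    induction n; [rewrite sum_O; apply st|].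
    rewrite sum_Sn; unfold plus; simpl; rewrite exp_plus, <- Rmult_assoc.
    eapply Rle_trans; [apply st|]; apply Rmult_le_compat_r; [left; apply exp_pos|apply IHn]. }
  assert (S0 : 0 <= S).
  { eapply Rle_trans; [apply (Hv O)|]. rewrite <- (sum_O v).
    now apply is_series_nonneg_sum_le. }
  intros [|n].
  - rewrite <- (Rmult_1_r (Cmod (u O))) at 1; apply Rmult_le_compat_l; [apply Cmod_ge_0|].
    rewrite <- exp_0; now apply exp_le.
  - eapply Rle_trans; [apply B|]; apply Rmult_le_compat_l; [apply Cmod_ge_0|].
    now apply exp_le, is_series_nonneg_sum_le.
Qed.

(** The products being bounded, their increments [u n * e n] are summable. The explicit distance
    from the limit to the first term is what later proves that the limit is not zero. *)
Lemma product_converges (u e : nat -> C) (v : nat -> R) (S : R) :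
  (forall n, u (Datatypes.S n) = u n * (1 + e n))%C ->
  (forall n, Cmod (e n) <= v n) -> is_series v S ->
  exists l, Clim u l /\ Cmod (l - u O)%C <= Cmod (u O) * exp S * S.
Proof.
  intros Hu He HS.
  set (M := Cmod (u O) * exp S).
  set (d := fun n => (u n * e n)%C).
  assert (Hd : forall n, Cmod (d n) <= M * v n).
  { intros n; unfold d; rewrite Cmod_mult; apply Rmult_le_compat; try apply Cmod_ge_0; auto.
    eapply product_bound; eauto. }
  assert (HM : is_series (fun n => M * v n) (M * S))
    by apply (is_series_scal (V := R_NormedModule) M v S HS).
  assert (Hs := CIs_dominated d _ Hd (ex_intro _ _ HM)).
  assert (Hb := CIs_Cmod_le d _ _ _ Hd HM Hs).
  exists (u O + CSeries d)%C; split.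
  - assert (E : forall n, u (Datatypes.S n) = (u O + sum_n (G := C_AbelianMonoid) d n)%C).
    { induction n; [rewrite sum_O, Hu; unfold d; ring|].
      rewrite sum_Sn, Hu; unfold plus; simpl; rewrite Cplus_assoc, <- IHn; unfold d; ring. }
    apply CIs_Clim in Hs.
    assert (H := Clim_plus _ _ _ _ (Clim_const (u O)) Hs).
    apply Clim_ext_loc with (v := fun n => u (Datatypes.S n)) (N := O) in H; [|now intros].
    destruct H as [A B]; split; now apply is_lim_seq_incr_1.
  - replace (u O + CSeries d - u O)%C with (CSeries d) by ring; exact Hb.
Qed.

(** Restarting the product where the remaining sum r of [v] is below 1/4 puts the limit within 3/4
    of the modulus of the restarting value, so a zero limit would force that value to vanish. *)
Lemma product_limit_neq0 (u e : nat -> C) (v : nat -> R) :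
  (forall n, u (Datatypes.S n) = u n * (1 + e n))%C ->
  (forall n, Cmod (e n) <= v n) -> ex_series v ->
  exists l, Clim u l /\ ((forall n, u n <> 0) -> l <> 0).
Proof.
  intros Hu He [S HS].
  destruct (product_converges u e v S Hu He HS) as [l [Hl _]].
  exists l; split; auto; intros Hn.
  assert (T : is_lim_seq (fun n => S - sum_n v n) 0).
  { replace (Finite 0) with (Finite (S - S)) by (f_equal; ring).
    apply is_lim_seq_minus'; [apply is_lim_seq_const|exact HS]. }
  apply is_lim_seq_spec in T; assert (q : 0 < / 4) by lra.
  destruct (T (mkposreal _ q)) as [N HN]; specialize (HN N (Nat.le_refl _)); simpl in HN.
  destruct (product_converges (fun n => u (Datatypes.S N + n)%nat)
    (fun n => e (Datatypes.S N + n)%nat) (fun n => v (Datatypes.S N + n)%nat) (S - sum_n v N))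
    as [l' [Hl' Hd]].
  - intros n; rewrite Nat.add_succ_r; apply Hu.
  - intros n; apply He.
  - apply (is_series_incr_n (V := R_NormedModule) v (Datatypes.S N)); [lia|].
    simpl Nat.pred. match goal with |- is_series _ ?x => replace x with S end; auto.
    exact ((fun p q : R => ltac:(ring) : p = p - q + q) S (sum_n v N)).
  - assert (l' = l) as ->.
    { refine (Clim_unique _ _ _ Hl' _).
      apply (Clim_subseq u l (fun n => Datatypes.S N + n)%nat); auto.
      intros P [K HK]; exists K; intros n H; apply HK; lia. }
    intros ->; rewrite Nat.add_0_r in Hd.
    replace (0 - u (Datatypes.S N))%C with (- u (Datatypes.S N))%C in Hd by ring.
    rewrite Cmod_opp in Hd.
    assert (P := proj1 (Cmod_gt_0 _) (Hn (Datatypes.S N))).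
    rewrite Rminus_0_r in HN; set (r := S - sum_n v N) in *; clearbody r.
    (* For 0 < r < 1/4, exp r <= exp 1 <= 3; for r <= 0 the product is not positive. *)
    assert (Q : exp r * r <= 3 / 4).
    { apply Rabs_def2 in HN; destruct (Rle_dec r 0) as [H|H].
      - assert (Q := exp_pos r); nra.
      - assert (exp r <= 3) by (eapply Rle_trans; [apply exp_le with (y := 1); lra|apply exp_le_3]).
        assert (Q := exp_pos r); nra. }
    rewrite Rmult_assoc in Hd.
    assert (Cmod (u (Datatypes.S N)) * (exp r * r) <= Cmod (u (Datatypes.S N)) * (3 / 4))
      by (apply Rmult_le_compat_l; lra).
    lra.
Qed.

(** The rising factorial with exactly n factors, whereas [poch z n] has n + 1 of them. *)
Fixpoint rf (z : C) (n : nat) : C :=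
  match n with
  | O => 1
  | S k => rf z k * (z + RtoC (INR k))
  end%C.

Lemma rf_shift (z : C) (n : nat) : rf z (S n) = (z * rf (z + 1) n)%C.
Proof.
  induction n; [simpl; ring|].
  change (rf z (S (S n))) with (rf z (S n) * (z + RtoC (INR (S n))))%C.
  rewrite IHn, S_INR, RtoC_plus; simpl; ring.
Qed.

Lemma rf_neq0 (z : C) (n : nat) :
  (forall k, (k < n)%nat -> z + RtoC (INR k) <> 0)%C -> rf z n <> 0.
Proof.
  induction n; intros H; simpl; [apply RtoC_neq0, R1_neq_R0|].
  apply Cmult_neq_0; [apply IHn; intros; apply H; lia|apply H; lia].
Qed.

Lemma poch_rf (z : C) (n : nat) : poch z n = rf z (S n).
Proof. induction n; [simpl; ring|]. simpl poch; now rewrite IHn. Qed.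

(* Gauss' approximants of 1/Gamma. *)
Definition gauss (z : C) (n : nat) : C :=
  (poch z n / (RtoC (INR (fact n)) * cpow_pos (INR n) z))%C.

Definition nonpole (z : C) : Prop := forall k : nat, (z + RtoC (INR k))%C <> 0.

Lemma nonpole_pos (z : C) : 0 < Re z -> nonpole z.
Proof.
  intros H k E; apply (f_equal Re) in E; simpl in E.
  assert (P := pos_INR k); unfold Re in *; lra.
Qed.

Lemma cpow_pos_neq0 (x : R) (z : C) : cpow_pos x z <> 0.
Proof. apply Cexp_neq0. Qed.

Lemma fact_neq0 (n : nat) : RtoC (INR (fact n)) <> 0.
Proof. apply RtoC_neq0, INR_fact_neq_0. Qed.

Lemma gauss_neq0 (z : C) (n : nat) : nonpole z -> gauss z n <> 0.
Proof.
  intros H; apply Cmult_neq_0.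
  - rewrite poch_rf; apply rf_neq0; intros; apply H.
  - assert (N : (RtoC (INR (fact n)) * cpow_pos (INR n) z)%C <> 0)
      by (apply Cmult_neq_0; [apply fact_neq0|apply cpow_pos_neq0]).
    apply Cmod_gt_0; rewrite Cmod_inv by auto.
    apply Rinv_0_lt_compat, Cmod_gt_0, N.
Qed.

(** The ratio of consecutive approximants is (1 + z/(n+1)) (n/(n+1))^z. At n = 0 the identity is
    purely formal, with whatever value [ln 0] has, so limits are taken along [S n]. *)
Lemma gauss_S (z : C) (n : nat) :
  (gauss z (S n) = gauss z n * ((1 + z * RtoC (/ INR (S n)))
     * Cexp (z * RtoC (ln (INR n) - ln (INR (S n))))))%C.
Proof.
  unfold gauss; change (poch z (S n)) with (poch z n * (z + RtoC (INR (S n))))%C.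
  assert (E : cpow_pos (INR n) z
    = (cpow_pos (INR (S n)) z * Cexp (z * RtoC (ln (INR n) - ln (INR (S n)))))%C).
  { unfold cpow_pos; rewrite <- Cexp_plus; f_equal; rewrite RtoC_minus; ring. }
  rewrite E; clear E.
  change (fact (S n)) with ((S n) * fact n)%nat.
  rewrite mult_INR, RtoC_mult, RtoC_inv by (apply not_0_INR; lia).
  field; repeat split; try apply fact_neq0; try apply cpow_pos_neq0; try apply Cexp_neq0.
  apply RtoC_neq0, not_0_INR; lia.
Qed.

Lemma ln_le_minus_1 (x : R) : 0 < x -> ln x <= x - 1.
Proof.
  intros H; destruct (Req_dec x 1) as [->|N]; [rewrite ln_1; lra|].
  assert (Hl : ln x <> 0) by (intros E; apply N; rewrite <- (exp_ln x), E, exp_0; auto).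
  assert (Q := exp_ineq1 (ln x) Hl); rewrite exp_ln in Q; lra.
Qed.

Lemma ln_ratio_bounds (x : R) : 1 <= x ->
  - / x <= ln x - ln (x + 1) <= - / (x + 1).
Proof.
  intros H.
  assert (E : ln x - ln (x + 1) = ln (x / (x + 1))).
  { unfold Rdiv; rewrite ln_mult, ln_Rinv; try lra; apply Rinv_0_lt_compat; lra. }
  assert (E' : ln x - ln (x + 1) = - ln ((x + 1) / x)).
  { unfold Rdiv; rewrite ln_mult, ln_Rinv; try lra; apply Rinv_0_lt_compat; lra. }
  split.
  - rewrite E'; assert (P : 0 < (x + 1) / x) by (apply Rdiv_lt_0_compat; lra).
    apply ln_le_minus_1 in P.
    replace ((x + 1) / x - 1) with (/ x) in P by (field; lra); lra.
  - rewrite E; assert (P : 0 < x / (x + 1)) by (apply Rdiv_lt_0_compat; lra).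
    apply ln_le_minus_1 in P.
    replace (x / (x + 1) - 1) with (- / (x + 1)) in P by (field; lra); lra.
Qed.

(** With w = 1/(n+2), l = ln((n+1)/(n+2)) and r the second-order remainder of exp(zl), the
    difference is z(w + l) + z^2 w l + (1 + zw) r. The first-order terms cancel because l = -w up to
    O(1/n^2), and every remaining term is O(1/n^2), hence summable. *)
Lemma gauss_ratio_bound (z : C) (n : nat) :
  Cmod ((1 + z * RtoC (/ INR (S (S n))))
     * Cexp (z * RtoC (ln (INR (S n)) - ln (INR (S (S n))))) - 1)%C
  <= (2 * Cmod z + 2 * Cmod z ^ 2 + (1 + Cmod z) * (4 * Cmod z ^ 2 * exp (Cmod z)))
     * / (INR n + 1) ^ 2.
Proof.
  assert (Hn := pos_INR n).
  assert (L := ln_ratio_bounds (INR (S n))).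
  rewrite !S_INR in *; specialize (L ltac:(lra)).
  set (l := ln (INR n + 1) - ln (INR n + 1 + 1)) in *; clearbody l.
  set (y := INR n + 1) in *; assert (Hy : 1 <= y) by (unfold y; lra); clearbody y; clear Hn.
  set (w := / (y + 1)) in *.
  assert (W : w = / (y + 1)) by reflexivity.
  assert (Y : 0 < / y <= 1).
  { split; [apply Rinv_0_lt_compat; lra|]. rewrite <- Rinv_1; apply Rinv_le_contravar; lra. }
  assert (W1 : 0 < w <= / y).
  { split; [apply Rinv_0_lt_compat; lra|apply Rinv_le_contravar; lra]. }
  assert (W2 : / y <= 2 * w).
  { unfold w; apply Rmult_le_reg_l with (y * (y + 1)); [nra|]. field_simplify; lra. }
  assert (W3 : / y - w <= (/ y) ^ 2).
  { replace (/ y - w) with (/ y * w); [simpl; nra|unfold w; field; lra]. }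
  assert (Z : / y ^ 2 = (/ y) ^ 2) by (field; lra).
  rewrite Z; clear Z; set (q := / y) in *; clearbody q w.
  assert (W4 : Rabs (w + l) <= q ^ 2) by (apply Rabs_le; lra).
  assert (W5 : Rabs l <= q) by (apply Rabs_le; lra).
  set (m := Cmod z); assert (Hm : 0 <= m) by apply Cmod_ge_0.
  set (r := (Cexp (z * RtoC l) - 1 - z * RtoC l)%C).
  assert (Hr : Cmod r <= m ^ 2 * q ^ 2 * exp m).
  { unfold r; eapply Rle_trans; [apply Cexp_minus_1_minus_le|].
    rewrite Cmod_mult, Cmod_R; fold m. rewrite <- Rpow_mult_distr.
    assert (B : 0 <= m * Rabs l <= m * q).
    { assert (0 <= Rabs l) by apply Rabs_pos. nra. }
    apply Rmult_le_compat; [apply pow2_ge_0|left; apply exp_pos| |].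
    - apply pow_incr; lra.
    - apply exp_le; nra. }
  replace ((1 + z * RtoC w) * Cexp (z * RtoC l) - 1)%C
    with (z * RtoC (w + l) + z * z * RtoC (w * l) + (1 + z * RtoC w) * r)%C
    by (unfold r; rewrite RtoC_plus, RtoC_mult; ring).
  eapply Rle_trans; [apply Cmod_triangle|].
  eapply Rle_trans; [apply Rplus_le_compat_r, Cmod_triangle|].
  rewrite !Cmod_mult, !Cmod_R; fold m.
  assert (N1 : Cmod (1 + z * RtoC w)%C <= 1 + m).
  { eapply Rle_trans; [apply Cmod_triangle|].
    rewrite Cmod_1, Cmod_mult, Cmod_R, (Rabs_pos_eq w) by lra; fold m; nra. }
  assert (N2 : Rabs (w * l) <= q ^ 2).
  { rewrite Rabs_mult, (Rabs_pos_eq w) by lra.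
    assert (0 <= Rabs l) by apply Rabs_pos. simpl; nra. }
  assert (N3 : Cmod (1 + z * RtoC w)%C * Cmod r <= (1 + m) * (m ^ 2 * q ^ 2 * exp m))
    by (apply Rmult_le_compat; auto; apply Cmod_ge_0).
  assert (N4 : m * m * Rabs (w * l) <= m * m * q ^ 2) by (apply Rmult_le_compat_l; nra).
  assert (N5 : m * Rabs (w + l) <= m * q ^ 2) by (apply Rmult_le_compat_l; nra).
  assert (0 <= m * q ^ 2) by (apply Rmult_le_pos; [lra|apply pow2_ge_0]).
  assert (0 <= m * m * q ^ 2) by (apply Rmult_le_pos; [nra|apply pow2_ge_0]).
  assert (0 <= (1 + m) * (m ^ 2 * q ^ 2 * exp m)).
  { assert (0 < exp m) by apply exp_pos.
    apply Rmult_le_pos; [lra|]; apply Rmult_le_pos; [|lra].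
    apply Rmult_le_pos; apply pow2_ge_0. }
  lra.
Qed.

Lemma gauss_limit (z : C) :
  Clim (fun n => gauss z (S n)) (rGamma z) /\ (nonpole z -> rGamma z <> 0).
Proof.
  edestruct (product_limit_neq0 (fun n => gauss z (S n))
    (fun n => (1 + z * RtoC (/ INR (S (S n))))
       * Cexp (z * RtoC (ln (INR (S n)) - ln (INR (S (S n))))) - 1)%C) as [l [Hl Hn]].
  - intros n; rewrite gauss_S; f_equal; ring.
  - intros n; apply gauss_ratio_bound.
  - apply (ex_series_scal (V := R_NormedModule)), ex_series_inv_sqr.
  - assert (E : rGamma z = l) by (apply Clim_CLim, Hl).
    rewrite E; split; auto; intros Hz; apply Hn; intros; now apply gauss_neq0.
Qed.

Lemma gauss_shift (z : C) (n : nat) : (z + 1 + RtoC (INR (S n)))%C <> 0 ->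
  gauss z (S n) = (z * gauss (z + 1) (S n) * / (1 + (z + 1) * RtoC (/ INR (S n))))%C.
Proof.
  intros P; unfold gauss; rewrite !poch_rf, rf_shift.
  change (rf (z + 1) (S (S n))) with (rf (z + 1) (S n) * (z + 1 + RtoC (INR (S n))))%C.
  assert (E : cpow_pos (INR (S n)) (z + 1)%C = (cpow_pos (INR (S n)) z * RtoC (INR (S n)))%C).
  { unfold cpow_pos; rewrite Cmult_plus_distr_r, Cexp_plus, Cmult_1_l, Cexp_RtoC, exp_ln; auto.
    apply lt_0_INR; lia. }
  assert (N : RtoC (INR (S n)) <> 0) by (apply RtoC_neq0, not_0_INR; lia).
  rewrite E, RtoC_inv by (apply not_0_INR; lia).
  field; repeat split; auto using fact_neq0, cpow_pos_neq0.
  intros H; apply P; rewrite <- H; ring.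
Qed.

Lemma is_lim_seq_inv_INR_S : is_lim_seq (fun n => / INR (S n)) 0.
Proof.
  eapply is_lim_seq_ext; [|apply is_lim_seq_inv_S]; intros n; rewrite S_INR; reflexivity.
Qed.

(** Comes from the approximants: those at z and z + 1 differ by the factor z and by a correction
    that tends to 1. It holds at every z, poles of Gamma included; the rank N only ensures that the
    correction has no zero denominator. *)
Lemma rGamma_shift (z : C) : rGamma z = (z * rGamma (z + 1))%C.
Proof.
  destruct (nfloor_ex (Rabs (Re z)) (Rabs_pos _)) as [N [_ HN]].
  eapply Clim_unique; [apply gauss_limit|].
  eapply Clim_ext_loc with (N := N).
  { intros n Hn; symmetry; apply gauss_shift; rewrite S_INR; intros E; apply (f_equal Re) in E; simpl in E.
    apply le_INR in Hn; apply Rabs_def2 in HN; unfold Re in HN; lra. }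
  replace (z * rGamma (z + 1))%C with
    (z * rGamma (z + 1) * / (1 + (z + 1) * RtoC 0))%C by (field; apply RtoC_neq0; lra).
  apply Clim_mult; [apply Clim_mult; [apply Clim_const|apply gauss_limit]|].
  apply Clim_inv.
  - replace (1 + (z + 1) * 0)%C with (RtoC 1) by ring; apply RtoC_neq0; lra.
  - apply Clim_plus; [apply Clim_const|apply Clim_mult; [apply Clim_const|]].
    apply Clim_RtoC, is_lim_seq_inv_INR_S.
Qed.

Lemma rGamma_rf (z : C) (N : nat) : rGamma z = (rf z N * rGamma (z + RtoC (INR N)))%C.
Proof.
  revert z; induction N as [|N IH]; intros z; [simpl; rewrite Cplus_0_r; ring|].
  rewrite rf_shift, rGamma_shift, (IH (z + 1)%C), S_INR, RtoC_plus.
  replace (z + 1 + INR N)%C with (z + (INR N + 1))%C by ring; ring.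
Qed.

(** * Improper integrals over the half-line *)

(** The length is a parameter so that Poisson summation can take T = 2L, for which the cell centres
    are the odd multiples of L. *)
Definition cell (T : R) (phi : R -> C) (n : nat) : C := CInt phi (INR n * T) (INR (S n) * T).

(* The integral over [0, oo), as the series of the integrals over consecutive cells of length T. *)
Definition half_line_int (T : R) (phi : R -> C) : C := CSeries (cell T phi).

Lemma cell_le (T : R) (n : nat) : 0 < T -> 0 <= INR n * T <= INR (S n) * T.
Proof. intros H; assert (P := pos_INR n); rewrite S_INR; nra. Qed.

Lemma is_series_telescope (u : nat -> R) (l : R) :
  is_lim_seq u l -> is_series (fun n => u (S n) - u n) (l - u O).
Proof.
  intros H; change (is_lim_seq (sum_n (fun n => u (S n) - u n)) (l - u O)).
  apply is_lim_seq_ext with (fun n => u (S n) - u O).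
  - induction n; [now rewrite sum_O|].
    rewrite sum_Sn, <- IHn; unfold plus; simpl; ring.
  - apply is_lim_seq_minus'; [|apply is_lim_seq_const]; now apply is_lim_seq_incr_1 in H.
Qed.

(** A majorant with an explicit primitive [Gp] vanishing at infinity makes the cell bounds
    telescope, so that convergence and the final bound - Gp(0) come together. *)
Lemma half_line_int_majorant (T : R) (phi : R -> C) (g Gp : R -> R) :
  0 < T -> (forall x, Ccont phi x) -> (forall x, 0 <= x -> Cmod (phi x) <= g x) ->
  (forall x, is_derive Gp x (g x)) -> (forall x, continuous g x) ->
  is_lim_seq (fun n => Gp (INR n * T)) 0 ->
  CIs (cell T phi) (half_line_int T phi) /\ Cmod (half_line_int T phi) <= - Gp 0.
Proof.
  intros HT Hphi Hg Hd Hc Hl.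
  assert (Hb : forall n, Cmod (cell T phi n) <= Gp (INR (S n) * T) - Gp (INR n * T)).
  { intros n; destruct (cell_le T n HT) as [H1 H2].
    assert (E : is_RInt g (INR n * T) (INR (S n) * T) (Gp (INR (S n) * T) - Gp (INR n * T)))
      by (apply (is_RInt_derive (V := R_CompleteNormedModule)); auto).
    rewrite <- (is_RInt_unique (V := R_CompleteNormedModule) _ _ _ _ E).
    apply CInt_Cmod_le; auto; [now eexists; apply E|].
    intros x Hx; apply Hg; lra. }
  assert (Hs := is_series_telescope _ _ Hl).
  assert (H := CIs_dominated _ _ Hb (ex_intro _ _ Hs)).
  split; [exact H|].
  eapply Rle_trans; [apply (CIs_Cmod_le _ _ _ _ Hb Hs H)|].
  simpl; rewrite Rmult_0_l; lra.
Qed.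

Lemma is_lim_seq_exp_decay (c : R) : 0 < c -> is_lim_seq (fun n => exp (- c * INR n)) 0.
Proof.
  intros Hc; apply is_lim_seq_ext with (fun n => (exp (- c)) ^ n).
  - induction n; [simpl; rewrite Rmult_0_r, exp_0; auto|].
    simpl pow; rewrite IHn, <- exp_plus, S_INR; f_equal; ring.
  - apply is_lim_seq_geom; rewrite Rabs_pos_eq by (left; apply exp_pos).
    rewrite <- exp_0; apply exp_increasing; lra.
Qed.

(** Continuity is asked on all of R, where every integrand in use is smooth, but decay only on the
    half-line. *)
Definition exp_decay (K c : R) (phi : R -> C) : Prop :=
  0 < c /\ (forall x, Ccont phi x) /\ forall x, 0 <= x -> Cmod (phi x) <= K * exp (- c * x).

Lemma half_line_int_spec (T K c : R) (phi : R -> C) : 0 < T -> exp_decay K c phi ->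
  CIs (cell T phi) (half_line_int T phi) /\ Cmod (half_line_int T phi) <= K / c.
Proof.
  intros HT (Hc & Hphi & Hb).
  replace (K / c) with (- (- K / c * exp (- c * 0)))
    by (rewrite Rmult_0_r, exp_0; field; lra).
  apply (half_line_int_majorant T phi (fun x => K * exp (- c * x))
    (fun x => - K / c * exp (- c * x))); auto.
  - intros x; auto_derive; [auto|field; lra].
  - intros x; apply (ex_derive_continuous (V := R_NormedModule)); auto_derive; auto.
  - replace (Finite 0) with (Finite (- K / c * 0)) by (f_equal; ring).
    apply is_lim_seq_mult'; [apply is_lim_seq_const|].
    apply is_lim_seq_ext with (fun n => exp (- (c * T) * INR n)).
    + intros n; f_equal; ring.
    + apply is_lim_seq_exp_decay; nra.
Qed.

Lemma half_line_int_unique (T : R) (phi : R -> C) (l : C) :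
  CIs (cell T phi) l -> half_line_int T phi = l.
Proof. apply CIs_CSeries. Qed.

Lemma half_line_int_minus (T K c K' c' : R) (phi psi : R -> C) : 0 < T ->
  exp_decay K c phi -> exp_decay K' c' psi ->
  half_line_int T (fun x => phi x - psi x)%C
  = (half_line_int T phi - half_line_int T psi)%C.
Proof.
  intros HT H1 H2; apply half_line_int_unique.
  eapply CIs_ext; [|apply CIs_minus; [apply (half_line_int_spec T K c phi HT H1)
    |apply (half_line_int_spec T K' c' psi HT H2)]].
  intros n; symmetry; apply CInt_minus; [apply H1|apply H2].
Qed.

Lemma half_line_int_scal (T K c : R) (z : C) (phi : R -> C) : 0 < T -> exp_decay K c phi ->
  half_line_int T (fun x => z * phi x)%C = (z * half_line_int T phi)%C.
Proof.
  intros HT H1; apply half_line_int_unique.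
  eapply CIs_ext; [|apply CIs_scal, (half_line_int_spec T K c phi HT H1)].
  intros n; symmetry; apply CInt_scal, H1.
Qed.

Lemma half_line_int_derive (T : R) (F phi : R -> C) : 0 < T ->
  (forall x, Cder F x (phi x)) -> (forall x, Ccont phi x) ->
  Clim (fun n => F (INR n * T)) 0 -> half_line_int T phi = (- F 0)%C.
Proof.
  intros HT Hd Hc [A B]; apply half_line_int_unique.
  assert (E : forall n, (F (INR (S n) * T)%R - F (INR n * T)%R)%C = cell T phi n).
  { intros n; symmetry; now apply CInt_derive. }
  eapply CIs_ext; [apply E|]; apply CIs_Re_Im; split.
  - assert (Q := is_series_telescope _ _ A); cbv beta in Q; replace (INR 0 * T) with 0 in Q by (simpl; ring).
    replace (Re (- F 0)%C) with (0 - Re (F 0)) by (simpl; unfold Re; ring); exact Q.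
  - assert (Q := is_series_telescope _ _ B); cbv beta in Q; replace (INR 0 * T) with 0 in Q by (simpl; ring).
    replace (Im (- F 0)%C) with (0 - Im (F 0)) by (simpl; unfold Im; ring); exact Q.
Qed.

Lemma Clim_exp_decay (T K c : R) (phi : R -> C) : 0 < T -> exp_decay K c phi ->
  Clim (fun n => phi (INR n * T)) 0.
Proof.
  intros HT (Hc & _ & H).
  apply Clim_le with (fun n => K * exp (- (c * T) * INR n)) O.
  - intros n _; replace (phi (INR n * T)%R - 0)%C with (phi (INR n * T)) by ring.
    eapply Rle_trans; [apply H; apply (cell_le T n HT)|].
    right; f_equal; f_equal; ring.
  - replace (Finite 0) with (Finite (K * 0)) by (f_equal; ring).
    apply is_lim_seq_mult'; [apply is_lim_seq_const|apply is_lim_seq_exp_decay; nra].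
Qed.

(** * Powers of the hyperbolic cosine *)

(** This is log(2 cosh x), and its derivative [th] is the hyperbolic tangent; complex powers of 2
    cosh x are exponentials of multiples of [lch x]. *)
Definition lch (x : R) : R := ln (exp x + exp (- x)).
Definition th (x : R) : R := (exp x - exp (- x)) / (exp x + exp (- x)).

(* (2 cosh x)^(-s) *)
Definition chpow (s : C) (x : R) : C := Cexp (- s * RtoC (lch x))%C.

Lemma ch2_pos (x : R) : 0 < exp x + exp (- x).
Proof. assert (H := exp_pos x); assert (H' := exp_pos (- x)); lra. Qed.

Lemma is_derive_lch (x : R) : is_derive lch x (th x).
Proof.
  assert (H := ch2_pos x); unfold lch, th; auto_derive; [lra|field; lra].
Qed.

Lemma is_derive_th (x : R) : is_derive th x (1 - th x ^ 2).
Proof.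
  assert (H := ch2_pos x); unfold th; auto_derive; [lra|field; lra].
Qed.

Lemma continuous_th (x : R) : continuous th x.
Proof. apply (ex_derive_continuous (V := R_NormedModule)); eexists; apply is_derive_th. Qed.

Lemma th_0 : th 0 = 0.
Proof. unfold th; rewrite Ropp_0; unfold Rdiv; ring. Qed.

Lemma lch_0 : lch 0 = ln 2.
Proof. unfold lch; rewrite Ropp_0, exp_0; f_equal; ring. Qed.

Lemma th_bound (x : R) : Rabs (th x) <= 1.
Proof.
  assert (H := exp_pos x); assert (H' := exp_pos (- x)).
  unfold th, Rdiv; rewrite Rabs_mult, Rabs_inv, (Rabs_pos_eq (_ + _)) by lra.
  apply Rmult_le_reg_r with (exp x + exp (- x)); [lra|].
  rewrite Rmult_assoc, Rinv_l by lra.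
  rewrite Rmult_1_r, Rmult_1_l; apply Rabs_le; lra.
Qed.

Lemma lch_ge (x : R) : x <= lch x.
Proof.
  unfold lch; rewrite <- (ln_exp x) at 1; apply ln_le; [apply exp_pos|].
  assert (H := exp_pos (- x)); lra.
Qed.

Lemma lch_nonneg (x : R) : 0 <= lch x.
Proof.
  destruct (Rle_dec 0 x) as [H|H]; [eapply Rle_trans; [exact H|apply lch_ge]|].
  eapply Rle_trans with (- x); [lra|].
  replace (lch x) with (lch (- x)) by (unfold lch; rewrite Ropp_involutive; f_equal; ring).
  apply lch_ge.
Qed.

(** Since 1 - tanh^2 is the derivative of tanh, this makes (2 cosh x)^(-2) an exact derivative. The
    recurrence, the value of the integral at s = 2 and the Lipschitz estimate in [th] all rest on
    it. *)
Lemma exp_m2_lch (x : R) : exp (- 2 * lch x) = (1 - th x ^ 2) / 4.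
Proof.
  assert (H := ch2_pos x).
  replace (- 2 * lch x) with (- (lch x + lch x)) by ring.
  rewrite exp_Ropp, exp_plus; unfold lch, th; rewrite exp_ln by auto.
  assert (E : exp x * exp (- x) = 1) by (rewrite <- exp_plus, Rplus_opp_r; apply exp_0).
  apply Rmult_eq_reg_r with (4 * (exp x + exp (- x)) ^ 2); [|nra].
  field_simplify; try lra.
Qed.

Lemma Cmod_chpow (s : C) (x : R) : Cmod (chpow s x) = exp (- Re s * lch x).
Proof. unfold chpow; rewrite Cmod_Cexp; f_equal; simpl; unfold Re; ring. Qed.

Lemma chpow_plus (s t : C) (x : R) : chpow (s + t) x = (chpow s x * chpow t x)%C.
Proof. unfold chpow; rewrite <- Cexp_plus; f_equal; ring. Qed.

Lemma chpow_2 (x : R) : chpow 2 x = RtoC ((1 - th x ^ 2) / 4).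
Proof.
  rewrite <- exp_m2_lch, <- Cexp_RtoC; unfold chpow; f_equal.
  apply C_ext; simpl; ring.
Qed.

Lemma Cmod_chpow_le (s : C) (x : R) : 0 <= Re s -> 0 <= x ->
  Cmod (chpow s x) <= exp (- Re s * x).
Proof.
  intros Hs Hx; rewrite Cmod_chpow; apply exp_le; assert (H := lch_ge x); nra.
Qed.

Lemma Cder_chpow (s : C) (x : R) : Cder (chpow s) x (- s * RtoC (th x) * chpow s x)%C.
Proof.
  apply (Cder_exp (fun t => - s * RtoC (lch t))%C).
  assert (H := Cder_mult _ _ x _ _ (Cder_const (- s)%C x) (Cder_RtoC _ _ _ (is_derive_lch x))).
  cbv beta in H.
  replace (0 * RtoC (lch x) + - s * RtoC (th x))%C with (- s * RtoC (th x))%C in H by ring.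
  exact H.
Qed.

Lemma Ccont_chpow (s : C) (x : R) : Ccont (chpow s) x.
Proof. eapply Cder_cont, Cder_chpow. Qed.

Lemma is_derive_cos_lin (w x : R) : is_derive (fun t => cos (w * t)) x (- w * sin (w * x)).
Proof. auto_derive; auto; ring. Qed.

Lemma is_derive_sin_lin (w x : R) : is_derive (fun t => sin (w * t)) x (w * cos (w * x)).
Proof. auto_derive; auto; ring. Qed.

Lemma Ccont_cos_lin (w x : R) : Ccont (fun t => RtoC (cos (w * t))) x.
Proof. eapply Cder_cont, Cder_RtoC, is_derive_cos_lin. Qed.

Lemma Ccont_sin_lin (w x : R) : Ccont (fun t => RtoC (sin (w * t))) x.
Proof. eapply Cder_cont, Cder_RtoC, is_derive_sin_lin. Qed.

Lemma Rabs_cos_le (x : R) : Rabs (cos x) <= 1.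
Proof. apply Rabs_le, COS_bound. Qed.

Lemma Rabs_sin_le (x : R) : Rabs (sin x) <= 1.
Proof. apply Rabs_le, SIN_bound. Qed.

Lemma Cmod_mult_le_l (z : C) (r : R) : Rabs r <= 1 -> Cmod (z * RtoC r)%C <= Cmod z.
Proof.
  intros H; rewrite Cmod_mult, Cmod_R; assert (P := Cmod_ge_0 z).
  assert (0 <= Rabs r) by apply Rabs_pos; nra.
Qed.

Definition chcos (s : C) (w x : R) : C := (chpow s x * RtoC (cos (w * x)))%C.

Lemma Ccont_chcos (s : C) (w x : R) : Ccont (chcos s w) x.
Proof. apply Ccont_mult; [apply Ccont_chpow|apply Ccont_cos_lin]. Qed.

Lemma Cder_chcos (s : C) (w x : R) : Cder (chcos s w) x
  (- s * RtoC (th x) * chpow s x * RtoC (cos (w * x))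
   - RtoC w * (chpow s x * RtoC (sin (w * x))))%C.
Proof.
  assert (H := Cder_mult _ _ x _ _ (Cder_chpow s x) (Cder_RtoC _ _ _ (is_derive_cos_lin w x))).
  cbv beta in H.
  match goal with |- Cder _ _ ?d => match type of H with Cder _ _ ?e =>
    replace d with e end end; [exact H|].
  rewrite RtoC_mult, RtoC_opp; ring.
Qed.

Lemma chcos_decay (s : C) (w : R) : 0 < Re s -> exp_decay 1 (Re s) (chcos s w).
Proof.
  intros Hs; split; [auto|split; [apply Ccont_chcos|]].
  intros x Hx; rewrite Rmult_1_l.
  eapply Rle_trans; [apply Cmod_mult_le_l, Rabs_cos_le|].
  apply Cmod_chpow_le; lra.
Qed.

(* int_0^oo (2 cosh x)^(-s) cos (w x) dx; it does not depend on the cell length T. *)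
Definition chcos_int (T : R) (s : C) (w : R) : C := half_line_int T (chcos s w).

Lemma chcos_int_bound (T : R) (s : C) (w : R) : 0 < T -> 0 < Re s ->
  Cmod (chcos_int T s w) <= / Re s.
Proof.
  intros HT Hs; eapply Rle_trans; [apply (half_line_int_spec T _ _ _ HT (chcos_decay s w Hs))|].
  right; unfold Rdiv; ring.
Qed.

Lemma exp_decay_scal (z : C) (K c : R) (phi : R -> C) :
  exp_decay K c phi -> exp_decay (Cmod z * K) c (fun x => z * phi x)%C.
Proof.
  intros (H1 & H2 & H3); split; [auto|split].
  - intros x; apply Ccont_mult; auto; apply Ccont_const.
  - intros x Hx; rewrite Cmod_mult, Rmult_assoc.
    apply Rmult_le_compat_l; [apply Cmod_ge_0|auto].
Qed.

(* Two integrations by parts. *)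
Lemma chcos_int_rec (T : R) (s : C) (w : R) : 0 < T -> 0 < Re s ->
  ((s * s + RtoC w * RtoC w) * chcos_int T s w = 4 * s * (s + 1) * chcos_int T (s + 2) w)%C.
Proof.
  intros HT Hs.
  assert (Hs2 : 0 < Re (s + 2)%C) by (simpl; unfold Re in Hs; lra).
  (* With f = [chpow s], F is f' cos(wx) - f (cos(wx))'. Its derivative is (f'' + w^2 f) cos(wx),
     where f'' = s^2 f - 4 s (s+1) [chpow (s + 2)]. F vanishes at 0 and at infinity. *)
  set (F := fun x => (- s * (RtoC (th x) * chpow s x) * RtoC (cos (w * x))
                      + RtoC w * (chpow s x * RtoC (sin (w * x))))%C).
  set (phi := fun x => ((s * s + RtoC w * RtoC w) * chcos s w x
                        - 4 * s * (s + 1) * chcos (s + 2) w x)%C).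
  assert (D1 := exp_decay_scal (s * s + RtoC w * RtoC w) _ _ _ (chcos_decay s w Hs)).
  assert (D2 := exp_decay_scal (4 * s * (s + 1)) _ _ _ (chcos_decay (s + 2) w Hs2)).
  assert (Hphi : forall x, Ccont phi x)
    by (intros x; apply Ccont_minus; [apply D1|apply D2]).
  assert (HF : forall x, Cder F x (phi x)).
  { intros x; unfold F.
    assert (E := Cder_plus _ _ x _ _
      (Cder_mult _ _ x _ _
        (Cder_mult _ _ x _ _ (Cder_const (- s)%C x)
          (Cder_mult _ _ x _ _ (Cder_RtoC _ _ _ (is_derive_th x)) (Cder_chpow s x)))
        (Cder_RtoC _ _ _ (is_derive_cos_lin w x)))
      (Cder_mult _ _ x _ _ (Cder_const (RtoC w) x)
        (Cder_mult _ _ x _ _ (Cder_chpow s x) (Cder_RtoC _ _ _ (is_derive_sin_lin w x))))).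
    cbv beta in E.
    match type of E with Cder _ _ ?e => replace (phi x) with e end; [exact E|].
    unfold phi, chcos; rewrite chpow_plus, chpow_2; unfold Rdiv.
    rewrite !RtoC_mult, !RtoC_opp, RtoC_minus, RtoC_pow, RtoC_inv by lra.
    field; apply RtoC_neq0; lra. }
  assert (DF : exp_decay (Cmod s + Rabs w) (Re s) F).
  { split; [auto|split; [intros x; eapply Cder_cont, HF|]].
    intros x Hx; unfold F; eapply Rle_trans; [apply Cmod_triangle|].
    rewrite Rmult_plus_distr_r; apply Rplus_le_compat.
    - eapply Rle_trans; [apply Cmod_mult_le_l, Rabs_cos_le|].
      rewrite Cmod_mult, Cmod_opp; apply Rmult_le_compat_l; [apply Cmod_ge_0|].
      rewrite Cmult_comm; eapply Rle_trans; [apply Cmod_mult_le_l, th_bound|].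
      apply Cmod_chpow_le; lra.
    - rewrite Cmod_mult, Cmod_R; apply Rmult_le_compat_l; [apply Rabs_pos|].
      eapply Rle_trans; [apply Cmod_mult_le_l, Rabs_sin_le|].
      apply Cmod_chpow_le; lra. }
  assert (Q := half_line_int_derive T F phi HT HF Hphi (Clim_exp_decay T _ _ F HT DF)).
  unfold phi in Q; rewrite (half_line_int_minus T _ _ _ _ _ _ HT D1 D2) in Q.
  rewrite (half_line_int_scal T _ _ _ _ HT (chcos_decay s w Hs)) in Q.
  rewrite (half_line_int_scal T _ _ _ _ HT (chcos_decay (s + 2) w Hs2)) in Q.
  unfold F in Q; rewrite th_0, Rmult_0_r, sin_0 in Q.
  unfold chcos_int.
  match type of Q with (?u - ?v = _)%C => replace u with (u - v + v)%C by ring; rewrite Q end.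
  ring.
Qed.

(** * Evaluation of the integral by Gamma functions *)

Ltac ccont :=
  lazymatch goal with
  | |- Ccont (fun t => Cmult (@?f t) (@?g t)) _ => apply (Ccont_mult f g); ccont
  | |- Ccont (fun t => Cminus (@?f t) (@?g t)) _ => apply (Ccont_minus f g); ccont
  | |- Ccont (fun t => Cplus (@?f t) (@?g t)) _ => apply (Ccont_plus f g); ccont
  | |- Ccont (fun _ => ?c) _ => apply (Ccont_const c)
  | |- Ccont (fun t => chpow _ t) _ => apply Ccont_chpow
  | |- Ccont (fun t => RtoC (cos (_ * t))) _ => apply Ccont_cos_lin
  | |- Ccont (fun t => RtoC (sin (_ * t))) _ => apply Ccont_sin_lin
  | |- Ccont (fun t => RtoC (th t)) _ => apply Ccont_RtoC, continuous_th
  end.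

Lemma chcos_int_2_0 (T : R) : 0 < T -> chcos_int T 2 0 = RtoC (/ 4).
Proof.
  intros HT; unfold chcos_int.
  (* The constant - 1 in the primitive makes it vanish at infinity, as [half_line_int_derive]
     requires. *)
  assert (D : forall x, Cder (fun x => RtoC ((th x - 1) / 4)) x (chcos 2 0 x)).
  { intros x; unfold chcos; rewrite Rmult_0_l, cos_0, Cmult_1_r, chpow_2.
    apply Cder_RtoC. evar_last.
    - apply (is_derive_ext (fun t => / 4 * (th t - 1))); [intros t; simpl; field|].
      apply (is_derive_scal), (is_derive_minus (V := R_NormedModule));
        [apply is_derive_th|apply (is_derive_const (V := R_NormedModule))].
    - unfold minus, plus, opp, zero; simpl; field. }
  rewrite (half_line_int_derive T _ _ HT D).
  - rewrite th_0, <- RtoC_opp; f_equal; field.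
  - intros x; apply Ccont_chcos.
  - apply Clim_RtoC.
    apply is_lim_seq_abs_le with (fun n => exp (- (2 * T) * INR n)) O.
    + intros n _; set (x := INR n * T).
      assert (H := exp_pos x); assert (H' := exp_pos (- x)).
      assert (E : exp x * exp (- x) = 1) by (rewrite <- exp_plus, Rplus_opp_r; apply exp_0).
      replace (- (2 * T) * INR n) with (- x + - x) by (unfold x; ring); rewrite exp_plus.
      replace ((th x - 1) / 4 - 0) with (- (exp (- x) / (2 * (exp x + exp (- x)))))
        by (unfold th; field; lra).
      rewrite Rabs_Ropp, Rabs_pos_eq by (apply Rdiv_le_0_compat; lra).
      apply Rmult_le_reg_r with (2 * (exp x + exp (- x))); [lra|].
      unfold Rdiv; rewrite Rmult_assoc, Rinv_l, Rmult_1_r by lra.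
      replace (exp (- x) * exp (- x) * (2 * (exp x + exp (- x))))
        with (2 * exp (- x) * (exp x * exp (- x)) + 2 * exp (- x) * exp (- x) * exp (- x)) by ring.
      rewrite E; assert (0 < exp (- x) * exp (- x) * exp (- x))
        by (repeat apply Rmult_lt_0_compat; auto); lra.
    + apply is_lim_seq_exp_decay; lra.
Qed.

(* The value of the integral at s = 2N + 2, w = 0. *)
Definition bcoef (N : nat) : R := INR (fact N) ^ 2 / (4 * INR (fact (2 * N + 1))).

Lemma bcoef_pos (N : nat) : 0 < bcoef N.
Proof.
  assert (H := INR_fact_lt_0 N); assert (H' := INR_fact_lt_0 (2 * N + 1)).
  apply Rdiv_lt_0_compat; [apply pow_lt; auto|lra].
Qed.

Lemma bcoef_S (N : nat) : bcoef (S N) = bcoef N * ((INR N + 1) / (2 * (2 * INR N + 3))).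
Proof.
  unfold bcoef; replace (2 * S N + 1)%nat with (S (S (2 * N + 1))) by lia.
  rewrite !fact_simpl, !mult_INR, !S_INR, plus_INR, mult_INR; simpl (INR 2); simpl (INR 1).
  assert (H := INR_fact_neq_0 N); assert (H' := INR_fact_neq_0 (2 * N + 1)).
  assert (P := pos_INR N); field; repeat split; auto; lra.
Qed.

Lemma Re_plus_INR (s : C) (r : R) : Re (s + RtoC r)%C = Re s + r.
Proof. reflexivity. Qed.

Lemma chcos_int_even_0 (T : R) (N : nat) : 0 < T ->
  chcos_int T (RtoC (2 * INR N + 2)) 0 = RtoC (bcoef N).
Proof.
  intros HT; induction N as [|N IH].
  - simpl (INR 0); replace (2 * 0 + 2) with 2 by ring; rewrite chcos_int_2_0 by auto.
    f_equal; unfold bcoef; simpl; field.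
  - assert (P := pos_INR N).
    set (s := RtoC (2 * INR N + 2)) in *.
    assert (Hs : 0 < Re s) by (unfold s; simpl; lra).
    assert (R := chcos_int_rec T s 0 HT Hs).
    replace (RtoC (2 * INR (S N) + 2)) with (s + 2)%C
      by (unfold s; rewrite S_INR, <- RtoC_plus; f_equal; ring).
    rewrite IH in R; rewrite bcoef_S.
    assert (N1 : (4 * s * (s + 1))%C <> 0).
    { unfold s; rewrite <- !RtoC_plus, <- !RtoC_mult; apply RtoC_neq0; nra. }
    apply (f_equal (fun z => / (4 * s * (s + 1)) * z)%C) in R.
    rewrite Cmult_assoc in R; rewrite Cmult_assoc, Cinv_l, Cmult_1_l in R by auto.
    rewrite <- R; unfold s.
    rewrite <- !RtoC_plus, <- !RtoC_mult, <- !RtoC_plus, <- RtoC_inv, <- !RtoC_mult by nra.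
    f_equal; field; lra.
Qed.

Lemma Cmod_chpow_minus_2_le (s : C) (x : R) : 4 <= Re s ->
  Cmod (chpow (s - 2) x) <= (1 - th x ^ 2) / 4.
Proof.
  intros Hs; rewrite Cmod_chpow, <- exp_m2_lch; apply exp_le.
  assert (H := lch_nonneg x); simpl; unfold Re in *; nra.
Qed.

(** For Re s >= 4, |[chpow (s - 2)]| is at most th'/4, so the derivative of the integrand is bounded
    by a multiple of th' and its increment by the same multiple of [th]. Measuring the increment by
    [th x] rather than x gives the Laplace majorant an elementary primitive. *)
Lemma chcos_lipschitz_th (s : C) (w x : R) : 4 <= Re s -> 0 <= x ->
  Cmod (chcos (s - 2) w x - chcos (s - 2) w 0)%C <= (Cmod (s - 2) + Rabs w) / 4 * th x.
Proof.
  intros Hs Hx.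
  set (K := (Cmod (s - 2)%C + Rabs w) / 4).
  rewrite <- (CInt_derive (chcos (s - 2) w) _ 0 x (Cder_chcos (s - 2) w)).
  2:{ intros t; ccont. }
  assert (E : is_RInt (fun t => K * (1 - th t ^ 2)) 0 x (K * th x)).
  { replace (K * th x) with (minus (K * th x) (K * th 0))
      by (rewrite th_0; unfold minus, plus, opp; simpl; ring).
    apply (is_RInt_derive (V := R_CompleteNormedModule) (fun t => K * th t)).
    - intros t _; apply (is_derive_scal), is_derive_th.
    - intros t _; apply (ex_derive_continuous (V := R_NormedModule)).
      auto_derive; eexists; apply is_derive_th. }
  rewrite <- (is_RInt_unique (V := R_CompleteNormedModule) _ _ _ _ E).
  apply CInt_Cmod_le; auto.
  - intros t; ccont.
  - eexists; apply E.
  - intros t _; unfold Cminus at 1; eapply Rle_trans; [apply Cmod_triangle|].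
    assert (H := Cmod_chpow_minus_2_le s t Hs).
    replace (K * (1 - th t ^ 2)) with
      (Cmod (s - 2)%C * ((1 - th t ^ 2) / 4) + Rabs w * ((1 - th t ^ 2) / 4))
      by (unfold K; field).
    apply Rplus_le_compat.
    + eapply Rle_trans; [apply Cmod_mult_le_l, Rabs_cos_le|].
      rewrite (Cmult_comm (- (s - 2)) (RtoC (th t))), <- Cmult_assoc, Cmult_comm.
      eapply Rle_trans; [apply Cmod_mult_le_l, th_bound|].
      rewrite Cmod_mult, Cmod_opp; apply Rmult_le_compat_l; [apply Cmod_ge_0|exact H].
    + rewrite Cmod_opp, Cmod_mult, Cmod_R; apply Rmult_le_compat_l; [apply Rabs_pos|].
      eapply Rle_trans; [apply Cmod_mult_le_l, Rabs_sin_le|exact H].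
Qed.

(* Laplace's method: [chpow (2N+2)] concentrates at 0. *)
Lemma chcos_int_asymptotic (T : R) (s : C) (w : R) (N : nat) : 0 < T -> 4 <= Re s ->
  Cmod (chcos_int T (s + RtoC (2 * INR N)) w
        - Cexp ((2 - s) * RtoC (ln 2)) * RtoC (bcoef N))%C
  <= (Cmod (s - 2) + Rabs w) / 4 * (exp (- (2 * INR N + 2) * ln 2) / (2 * INR N + 2)).
Proof.
  intros HT Hs; assert (P := pos_INR N).
  set (k := 2 * INR N + 2).
  assert (Hk : 0 < k) by (unfold k; lra).
  set (K := (Cmod (s - 2)%C + Rabs w) / 4).
  (* [chpow (s + 2N)] splits as [chpow (2N + 2)] times [chpow (s - 2)]; the second factor, with the
     cosine, is frozen at x = 0, where it equals 2^(2-s). *)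
  assert (H0 : chcos (s - 2) w 0 = Cexp ((2 - s) * RtoC (ln 2))%C).
  { unfold chcos, chpow; rewrite Rmult_0_r, cos_0, lch_0, Cmult_1_r; f_equal; ring. }
  rewrite <- H0, <- (chcos_int_even_0 T N HT); fold k.
  assert (Hk' : 0 < Re (RtoC k)) by exact Hk.
  assert (Hs' : 0 < Re (s + RtoC (2 * INR N))%C) by (rewrite Re_plus_INR; lra).
  unfold chcos_int.
  rewrite <- (half_line_int_scal T _ _ _ _ HT (chcos_decay (RtoC k) 0 Hk')).
  rewrite <- (half_line_int_minus T _ _ _ _ _ _ HT (chcos_decay _ w Hs')
    (exp_decay_scal _ _ _ _ (chcos_decay (RtoC k) 0 Hk'))).
  rewrite <- lch_0.
  replace (K * (exp (- k * lch 0) / k)) with (- (- K / k * exp (- k * lch 0))) by (field; lra).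
  (* The derivative of exp(-k lch x) is -k th(x) exp(-k lch x), so this majorant is integrated
     exactly. *)
  apply (half_line_int_majorant T _ (fun x => K * th x * exp (- k * lch x))
    (fun x => - K / k * exp (- k * lch x))); auto.
  - intros x; apply Ccont_minus; [apply Ccont_chcos|].
    apply Ccont_mult; [apply Ccont_const|apply Ccont_chcos].
  - intros x Hx.
    replace (chcos (s + RtoC (2 * INR N)) w x - chcos (s - 2) w 0 * chcos (RtoC k) 0 x)%C
      with (chpow (RtoC k) x * (chcos (s - 2) w x - chcos (s - 2) w 0))%C.
    + rewrite Cmod_mult, Cmod_chpow, Rmult_comm; simpl Re.
      apply Rmult_le_compat_r; [left; apply exp_pos|].
      now apply chcos_lipschitz_th.
    + assert (E1 : chcos (RtoC k) 0 x = chpow (RtoC k) x)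
        by (unfold chcos; rewrite Rmult_0_l, cos_0; ring).
      assert (E2 : chcos (s + RtoC (2 * INR N)) w x = (chpow (RtoC k) x * chcos (s - 2) w x)%C).
      { unfold chcos; replace (s + RtoC (2 * INR N))%C with (RtoC k + (s - 2))%C
          by (unfold k; rewrite RtoC_plus; ring).
        rewrite chpow_plus; ring. }
      rewrite E1, E2; ring.
  - intros x; evar_last.
    + apply (is_derive_scal).
      apply (is_derive_comp (V := R_NormedModule) exp); [apply is_derive_exp|].
      apply (is_derive_scal), is_derive_lch.
    + unfold scal; simpl; unfold mult; simpl; field; lra.
  - intros x; apply (ex_derive_continuous (V := R_NormedModule)).
    auto_derive; repeat split; eexists; [apply is_derive_th|apply is_derive_lch].
  - replace (Finite 0) with (Finite (- K / k * 0)) by (f_equal; ring).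
    apply is_lim_seq_mult'; [apply is_lim_seq_const|].
    apply is_lim_seq_le_le with (fun _ => 0) (fun n => exp (- (k * T) * INR n)).
    + intros n; split; [left; apply exp_pos|apply exp_le].
      assert (H := lch_ge (INR n * T)); nra.
    + apply is_lim_seq_const.
    + apply is_lim_seq_exp_decay; nra.
Qed.

(* The bound of [chcos_int_asymptotic] relative to [bcoef N]. *)
Definition wallis_err (N : nat) : R := exp (- (2 * INR N + 2) * ln 2) / ((2 * INR N + 2) * bcoef N).

Lemma wallis_err_pos (N : nat) : 0 < wallis_err N.
Proof.
  assert (H := bcoef_pos N); assert (P := pos_INR N).
  apply Rdiv_lt_0_compat; [apply exp_pos|nra].
Qed.

Lemma wallis_err_S (N : nat) :
  wallis_err (S N) = wallis_err N * ((2 * INR N + 3) / (2 * INR N + 4)).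
Proof.
  unfold wallis_err; rewrite bcoef_S, S_INR.
  replace (- (2 * (INR N + 1) + 2) * ln 2) with (- (2 * INR N + 2) * ln 2 + (- ln 2 + - ln 2)) by ring.
  rewrite !exp_plus, !exp_Ropp, exp_ln by lra.
  assert (H := bcoef_pos N); assert (P := pos_INR N); field; repeat split; lra.
Qed.

(** The left side does not increase with N, because (2N+3)(2N+5) <= (2N+4)^2. Hence the relative
    error decays like N^(-1/2), the rate in Wallis' product; the constant 3 is not sharp. *)
Lemma wallis_err_sqr (N : nat) : wallis_err N ^ 2 * (2 * INR N + 3) <= 3.
Proof.
  induction N as [|N IH].
  - unfold wallis_err, bcoef; simpl.
    replace (- (2 * 0 + 2) * ln 2) with (- ln 2 + - ln 2) by ring.
    rewrite exp_plus, exp_Ropp, exp_ln by lra; lra.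
  - rewrite wallis_err_S, S_INR; assert (P := pos_INR N).
    eapply Rle_trans; [|exact IH].
    set (x := wallis_err N); set (y := INR N) in *.
    replace ((x * ((2 * y + 3) / (2 * y + 4))) ^ 2 * (2 * (y + 1) + 3))
      with (x ^ 2 * ((2 * y + 3) * ((2 * y + 3) * (2 * y + 5) / (2 * y + 4) ^ 2))) by (field; lra).
    apply Rmult_le_compat_l; [apply pow2_ge_0|].
    rewrite <- (Rmult_1_r (2 * y + 3)) at 3; apply Rmult_le_compat_l; [lra|].
    apply Rmult_le_reg_r with ((2 * y + 4) ^ 2); [nra|].
    unfold Rdiv; rewrite Rmult_assoc, Rinv_l by nra; nra.
Qed.

Lemma is_lim_seq_sqr_0 (u : nat -> R) :
  (forall n, 0 <= u n) -> is_lim_seq (fun n => u n ^ 2) 0 -> is_lim_seq u 0.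
Proof.
  intros Hu H; rewrite <- sqrt_0.
  apply is_lim_seq_ext with (fun n => sqrt (u n ^ 2)); [intros n; now apply sqrt_pow2|].
  apply (is_lim_seq_continuous sqrt); [apply continuity_pt_sqrt; lra|exact H].
Qed.

Lemma wallis_err_lim : is_lim_seq wallis_err 0.
Proof.
  apply is_lim_seq_sqr_0; [intros n; left; apply wallis_err_pos|].
  apply is_lim_seq_le_le with (fun _ => 0) (fun n => 3 * / (INR n + 1)).
  - intros n; split; [apply pow2_ge_0|].
    assert (H := wallis_err_sqr n); assert (P := pos_INR n).
    apply Rmult_le_reg_r with (INR n + 1); [lra|].
    rewrite Rmult_assoc, Rinv_l by lra.
    assert (Q := pow2_ge_0 (wallis_err n)); nra.
  - apply is_lim_seq_const.
  - replace (Finite 0) with (Finite (3 * 0)) by (f_equal; ring).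
    apply is_lim_seq_mult'; [apply is_lim_seq_const|apply is_lim_seq_inv_S].
Qed.

(* The arguments of the two Gamma factors, for w = pi m / log eps. *)
Definition apar (s : C) (w : R) : C := (s / 2 + Ci * RtoC (w / 2))%C.
Definition bpar (s : C) (w : R) : C := (s / 2 - Ci * RtoC (w / 2))%C.

(** The bridge between the two sides: the factor s^2 + w^2 of the recurrence, taken at s + 2z, is
    four times one factor of each rising factorial of the Gamma arguments. *)
Lemma apar_bpar_mult (s z : C) (w : R) :
  ((apar s w + z) * (bpar s w + z) = ((s + 2 * z) * (s + 2 * z) + RtoC w * RtoC w) / 4)%C.
Proof.
  unfold apar, bpar; replace (RtoC (w / 2)) with (RtoC w / 2)%C
    by (unfold Rdiv, Cdiv; rewrite RtoC_mult, RtoC_inv by lra; reflexivity).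
  assert (E : (Ci * Ci = - (1))%C) by (apply C_ext; simpl; ring).
  assert (N : RtoC 2 <> 0) by (apply RtoC_neq0; lra).
  assert (N4 : RtoC 4 <> 0) by (apply RtoC_neq0; lra).
  transitivity ((s / 2 + z) * (s / 2 + z) - Ci * Ci * (RtoC w * RtoC w / (2 * 2)))%C;
    [field; auto|].
  rewrite E; replace (RtoC 4) with (2 * 2)%C by (rewrite <- RtoC_mult; f_equal; ring).
  field; auto.
Qed.

(** The recurrence iterated N times; each step raises s by 2 and adds two factors to (s)_{2N}, its
    constant 4 being absorbed by [apar_bpar_mult]. The form without division avoids any nonvanishing
    condition. *)
Lemma chcos_int_rf (T : R) (s : C) (w : R) (N : nat) : 0 < T -> 0 < Re s ->
  (chcos_int T s w * (rf (apar s w) N * rf (bpar s w) N)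
   = rf s (2 * N) * chcos_int T (s + RtoC (2 * INR N)) w)%C.
Proof.
  intros HT Hs; induction N as [|N IH].
  - simpl; rewrite Rmult_0_r, Cplus_0_r; ring.
  - assert (P := pos_INR N).
    replace (2 * S N)%nat with (S (S (2 * N))) by lia.
    change (rf s (S (S (2 * N)))) with
      (rf s (2 * N) * (s + RtoC (INR (2 * N))) * (s + RtoC (INR (S (2 * N)))))%C.
    change (rf (apar s w) (S N)) with (rf (apar s w) N * (apar s w + RtoC (INR N)))%C.
    change (rf (bpar s w) (S N)) with (rf (bpar s w) N * (bpar s w + RtoC (INR N)))%C.
    transitivity (chcos_int T s w * (rf (apar s w) N * rf (bpar s w) N)
      * ((apar s w + RtoC (INR N)) * (bpar s w + RtoC (INR N))))%C; [ring|].
    rewrite IH, apar_bpar_mult, !S_INR, mult_INR; replace (INR 2) with 2 by (simpl; ring).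
    set (t := (s + RtoC (2 * INR N))%C).
    assert (Ht : 0 < Re t) by (unfold t; rewrite Re_plus_INR; lra).
    assert (R := chcos_int_rec T t w HT Ht).
    replace (s + 2 * RtoC (INR N))%C with t by (unfold t; rewrite RtoC_mult; ring).
    replace (s + RtoC (2 * (INR N + 1)))%C with (t + 2)%C
      by (unfold t; rewrite !RtoC_mult, RtoC_plus; ring).
    replace (s + RtoC (2 * INR N + 1))%C with (t + 1)%C by (unfold t; rewrite RtoC_plus; ring).
    unfold Cdiv; transitivity (rf s (2 * N) * / 4
      * ((t * t + RtoC w * RtoC w) * chcos_int T t w))%C; [ring|].
    rewrite R; fold t; field; apply RtoC_neq0; lra.
Qed.

Lemma rf_gauss (z : C) (n : nat) :
  rf z (S n) = (gauss z n * (RtoC (INR (fact n)) * cpow_pos (INR n) z))%C.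
Proof.
  rewrite <- poch_rf; unfold gauss; field; split; [apply cpow_pos_neq0|apply fact_neq0].
Qed.

Lemma apar_bpar_plus (s : C) (w : R) : (apar s w + bpar s w = s)%C.
Proof. unfold apar, bpar; field; apply RtoC_neq0; lra. Qed.

Lemma cpow_pos_plus (x : R) (z z' : C) : cpow_pos x (z + z')%C = (cpow_pos x z * cpow_pos x z')%C.
Proof. unfold cpow_pos; rewrite <- Cexp_plus; f_equal; ring. Qed.

Lemma INR_double_S (n : nat) : INR (2 * S n) = 2 * INR n + 2.
Proof. rewrite mult_INR, (S_INR n); simpl (INR 2); ring. Qed.

(** Rising factorials are replaced by Gauss approximants: the powers n^a n^b combine into n^s
    because a + b = s, and the factorials left over, (2n+1)!/(n!)^2, are 1/(4 [bcoef n]). *)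
Lemma chcos_int_gauss (T : R) (s : C) (w : R) (n : nat) : 0 < T -> 0 < Re s -> (0 < n)%nat ->
  (chcos_int T s w * (gauss (apar s w) n * gauss (bpar s w) n)
   = gauss s (2 * n + 1) * Cexp (s * RtoC (ln (INR (2 * n + 1)) - ln (INR n)))
     * (RtoC (/ (4 * bcoef n)) * chcos_int T (s + RtoC (2 * INR (S n))) w))%C.
Proof.
  intros HT Hs Hn.
  assert (H := chcos_int_rf T s w (S n) HT Hs).
  replace (2 * S n)%nat with (S (2 * n + 1)) in H by lia.
  rewrite !rf_gauss in H.
  assert (F := fact_neq0 n); assert (F' := fact_neq0 (2 * n + 1)).
  assert (Q := cpow_pos_neq0 (INR n) s).
  assert (E : Cexp (s * RtoC (ln (INR (2 * n + 1)) - ln (INR n)))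
    = (cpow_pos (INR (2 * n + 1)) s * / cpow_pos (INR n) s)%C).
  { apply (Cmult_eq_reg_r (cpow_pos (INR n) s)); [|exact Q].
    rewrite <- Cmult_assoc, Cinv_l, Cmult_1_r by exact Q.
    unfold cpow_pos; rewrite <- Cexp_plus; f_equal; rewrite RtoC_minus; ring. }
  assert (B : RtoC (/ (4 * bcoef n))
    = (RtoC (INR (fact (2 * n + 1))) * / (RtoC (INR (fact n)) * RtoC (INR (fact n))))%C).
  { rewrite <- RtoC_mult, <- RtoC_inv, <- RtoC_mult
      by (apply Rmult_integral_contrapositive; split; apply INR_fact_neq_0).
    f_equal; unfold bcoef; field; split; apply INR_fact_neq_0. }
  assert (A : cpow_pos (INR n) s = (cpow_pos (INR n) (apar s w) * cpow_pos (INR n) (bpar s w))%C).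
  { now rewrite <- cpow_pos_plus, apar_bpar_plus. }
  rewrite E, B.
  apply (Cmult_eq_reg_r (RtoC (INR (fact n)) * RtoC (INR (fact n)) * cpow_pos (INR n) s)%C).
  - rewrite A at 1.
    match goal with |- ?lhs = _ => match type of H with ?h = _ => transitivity h; [ring|] end end.
    rewrite H; field; auto.
  - repeat apply Cmult_neq_0; auto.
Qed.

Lemma is_lim_seq_ratio_lin (a b c d : R) : c <> 0 ->
  is_lim_seq (fun n => (a * INR n + b) / (c * INR n + d)) (a / c).
Proof.
  intros Hc.
  apply is_lim_seq_ext_loc with (fun n => (a + b * / INR n) / (c + d * / INR n)).
  - destruct (nfloor_ex (Rabs (d / c)) (Rabs_pos _)) as [N [_ HN]].
    exists (S N); intros n Hn; apply le_INR in Hn; rewrite S_INR in Hn.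
    assert (P := pos_INR N).
    assert (D : c * INR n + d <> 0).
    { intros E; assert (d / c = - INR n) by (field_simplify_eq; auto; lra).
      rewrite H, Rabs_Ropp, Rabs_pos_eq in HN; lra. }
    field; repeat split; auto; lra.
  - assert (L : is_lim_seq (fun n => / INR n) 0).
    { replace (Finite 0) with (Rbar_inv p_infty) by reflexivity.
      apply is_lim_seq_inv; [apply is_lim_seq_INR|discriminate]. }
    replace (a / c) with ((a + b * 0) / (c + d * 0)) by (field; auto).
    apply is_lim_seq_div'; [| |lra];
      (apply is_lim_seq_plus'; [apply is_lim_seq_const|
        apply is_lim_seq_mult'; [apply is_lim_seq_const|exact L]]).
Qed.

Lemma Clim_Cexp_ratio (s : C) :
  Clim (fun n => Cexp (s * RtoC (ln (INR (2 * S n + 1)) - ln (INR (S n)))))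
    (Cexp (s * RtoC (ln 2))).
Proof.
  assert (L : is_lim_seq (fun n => ln (INR (2 * S n + 1)) - ln (INR (S n))) (ln 2)).
  { apply is_lim_seq_ext with (fun n => ln ((2 * INR n + 3) / (1 * INR n + 1))).
    - intros n; rewrite plus_INR, INR_double_S, (S_INR n); simpl (INR 1).
      assert (P := pos_INR n).
      replace (1 * INR n + 1) with (INR n + 1) by ring.
      replace (2 * INR n + 2 + 1) with (2 * INR n + 3) by ring.
      unfold Rdiv; rewrite ln_mult, ln_Rinv; try lra; apply Rinv_0_lt_compat; lra.
    - apply (is_lim_seq_continuous ln).
      + apply derivable_continuous_pt; exists (/ 2); apply derivable_pt_lim_ln; lra.
      + replace (Finite 2) with (Finite (2 / 1)) by (f_equal; field).
        apply is_lim_seq_ratio_lin; lra. }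
  assert (Cc : Ccont (fun t => Cexp (s * RtoC t))%C (ln 2)).
  { apply (Ccont_ext (fun t => Cexp (RtoC t * s))); [intros t; f_equal; ring|].
    eapply Cder_cont, Cder_Cexp_t. }
  destruct Cc as [A B]; split.
  - exact (filterlim_comp _ _ _ _ _ _ _ _ L A).
  - exact (filterlim_comp _ _ _ _ _ _ _ _ L B).
Qed.

Lemma Clim_rescaled_chcos_int (T : R) (s : C) (w : R) : 0 < T -> 4 <= Re s ->
  Clim (fun n => RtoC (/ (4 * bcoef (S n))) * chcos_int T (s + RtoC (2 * INR (S (S n)))) w)%C
    (Cexp ((2 - s) * RtoC (ln 2)) / 16)%C.
Proof.
  intros HT Hs.
  set (c := Cexp ((2 - s) * RtoC (ln 2))%C).
  set (K := (Cmod (s - 2)%C + Rabs w) / 4).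
  assert (HK : 0 <= K).
  { unfold K; assert (H := Cmod_ge_0 (s - 2)%C); assert (H' := Rabs_pos w); lra. }
  (* This is [bcoef (S (S n)) / (4 * bcoef (S n))]. The two ranks differ by one because n + 1 in the
     Gauss approximant corresponds to n + 2 steps of the recurrence. *)
  set (rho := fun n => (1 * INR n + 2) / (16 * INR n + 40)).
  assert (Lrho : is_lim_seq rho (1 / 16)) by (apply is_lim_seq_ratio_lin; lra).
  assert (M : Clim (fun n => c * RtoC (rho n))%C (c / 16)%C).
  { replace (c / 16)%C with (c * RtoC (1 / 16))%C.
    - apply Clim_mult; [apply Clim_const|apply Clim_RtoC, Lrho].
    - unfold Rdiv; rewrite Rmult_1_l, RtoC_inv by lra; reflexivity. }
  assert (Er : Clim (fun n => RtoC (/ (4 * bcoef (S n)))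
    * chcos_int T (s + RtoC (2 * INR (S (S n)))) w - c * RtoC (rho n))%C 0).
  { apply Clim_le with (fun n => K * wallis_err (S (S n))) O.
    - intros n _.
      assert (H := chcos_int_asymptotic T s w (S (S n)) HT Hs); fold K c in H.
      assert (P := pos_INR n); assert (Bp := bcoef_pos (S n)).
      assert (E : rho n = / (4 * bcoef (S n)) * bcoef (S (S n))).
      { rewrite (bcoef_S (S n)), S_INR; unfold rho; field; split; lra. }
      rewrite E, (RtoC_mult (/ (4 * bcoef (S n)))).
      match goal with |- Cmod ?z <= _ => replace z with
        (RtoC (/ (4 * bcoef (S n))) * (chcos_int T (s + RtoC (2 * INR (S (S n)))) w
          - c * RtoC (bcoef (S (S n)))))%C by ring end.
      rewrite Cmod_mult, Cmod_R, Rabs_pos_eq by (left; apply Rinv_0_lt_compat; lra).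
      eapply Rle_trans; [apply Rmult_le_compat_l; [left; apply Rinv_0_lt_compat; lra|apply H]|].
      unfold wallis_err; rewrite (bcoef_S (S n)).
      set (m := S (S n)); set (X := exp _); assert (HX : 0 < X) by apply exp_pos.
      assert (Hm : INR m = INR n + 2) by (unfold m; rewrite !S_INR; ring).
      rewrite S_INR, Hm.
      set (y := INR n) in *; set (b := bcoef (S n)) in *.
      assert (Q : K * X / (2 * (y + 2) + 2) / b >= 0).
      { apply Rle_ge; repeat (apply Rdiv_le_0_compat; [|lra]); nra. }
      replace (/ (4 * b) * (K * (X / (2 * (y + 2) + 2))))
        with (K * X / (2 * (y + 2) + 2) / b * / 4) by (field; lra).
      replace (K * (X / ((2 * (y + 2) + 2) * (b * ((y + 1 + 1) / (2 * (2 * (y + 1) + 3)))))))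
        with (K * X / (2 * (y + 2) + 2) / b * ((4 * y + 10) / (y + 2))) by (field; lra).
      apply Rmult_le_compat_l; [lra|].
      apply Rmult_le_reg_r with (y + 2); [lra|].
      unfold Rdiv; rewrite (Rmult_assoc _ (/ (y + 2))), Rinv_l; lra.
    - replace (Finite 0) with (Finite (K * 0)) by (f_equal; ring).
      apply is_lim_seq_mult'; [apply is_lim_seq_const|].
      apply (is_lim_seq_incr_1 (fun n => wallis_err (S n))), (is_lim_seq_incr_1 wallis_err), wallis_err_lim. }
  assert (R := Clim_plus _ _ _ _ Er M).
  rewrite Cplus_0_l in R; eapply Clim_ext_loc with (N := O); [|exact R].
  intros n _; simpl; ring.
Qed.

Definition gamma_formula (T : R) (s : C) (w : R) : Prop :=
  (chcos_int T s w * (rGamma (apar s w) * rGamma (bpar s w)) = rGamma s / 4)%C.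

(** The limit of [chcos_int_gauss]; the constant is 2^s 2^(2-s) / 16 = 1/4. The bound on Re s comes
    from the Laplace estimate. *)
Lemma gamma_formula_large (T : R) (s : C) (w : R) : 0 < T -> 4 <= Re s -> gamma_formula T s w.
Proof.
  intros HT Hs; unfold gamma_formula.
  assert (L := Clim_mult _ _ _ _ (Clim_const (chcos_int T s w))
    (Clim_mult _ _ _ _ (proj1 (gauss_limit (apar s w))) (proj1 (gauss_limit (bpar s w))))).
  assert (S1 : Clim (fun n => gauss s (2 * S n + 1)) (rGamma s)).
  { apply Clim_ext_loc with (fun n => gauss s (S (2 * S n))) O.
    { intros n _; f_equal; lia. }
    apply (Clim_subseq (fun n => gauss s (S n)) (rGamma s) (fun n => (2 * S n)%nat)).
    - intros P [K HK]; exists K; intros n H; apply HK; lia.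
    - apply gauss_limit. }
  assert (R := Clim_mult _ _ _ _ (Clim_mult _ _ _ _ S1 (Clim_Cexp_ratio s))
    (Clim_rescaled_chcos_int T s w HT Hs)).
  rewrite (Clim_unique _ _ _ L (Clim_ext_loc _ _ _ O
    (fun n _ => eq_sym (chcos_int_gauss T s w (S n) HT ltac:(lra) ltac:(lia))) R)).
  unfold Cdiv; transitivity
    (rGamma s * (Cexp (s * RtoC (ln 2)) * Cexp ((2 - s) * RtoC (ln 2))) * / 16)%C; [ring|].
  rewrite <- Cexp_plus.
  replace (s * RtoC (ln 2) + (2 - s) * RtoC (ln 2))%C with (RtoC (ln 2 + ln 2))
    by (rewrite RtoC_plus; ring).
  rewrite Cexp_RtoC, exp_plus, exp_ln by lra.
  replace (RtoC 16) with (RtoC (2 * 2) * 4)%C by (rewrite <- !RtoC_mult; f_equal; ring).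
  field; apply RtoC_neq0; lra.
Qed.

Lemma apar_shift (s : C) (w : R) (n : nat) :
  (apar s w + RtoC (INR n) = apar (s + RtoC (2 * INR n)) w)%C.
Proof. unfold apar; rewrite RtoC_mult; field; apply RtoC_neq0; lra. Qed.

Lemma bpar_shift (s : C) (w : R) (n : nat) :
  (bpar s w + RtoC (INR n) = bpar (s + RtoC (2 * INR n)) w)%C.
Proof. unfold bpar; rewrite RtoC_mult; field; apply RtoC_neq0; lra. Qed.

Lemma chcos_int_gamma (T : R) (s : C) (w : R) : 0 < T -> 0 < Re s -> gamma_formula T s w.
Proof.
  intros HT Hs; unfold gamma_formula.
  (* Two steps of the recurrence reach s + 4, within the range already treated; the functional
     equation of 1/Gamma brings the formula back to s. *)
  assert (G := gamma_formula_large T (s + RtoC (2 * INR 2)) w HT).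
  rewrite Re_plus_INR in G; specialize (G ltac:(simpl; lra)).
  unfold gamma_formula in G.
  assert (R := chcos_int_rf T s w 2 HT Hs).
  rewrite (rGamma_rf (apar s w) 2), (rGamma_rf (bpar s w) 2), (rGamma_rf s (2 * 2)).
  rewrite apar_shift, bpar_shift, mult_INR.
  match goal with |- (?c * (?x * ?y * (?u * ?v)) = _)%C =>
    transitivity (c * (x * u) * (y * v))%C; [ring|] end.
  rewrite R; replace (RtoC (INR 2 * INR 2)) with (RtoC (2 * INR 2)) by (f_equal; simpl; ring).
  unfold Cdiv in *; rewrite <- Cmult_assoc, G; ring.
Qed.

(** * Fejer summation on the half-line *)

Fixpoint dirichlet (k : nat) (t : R) : R :=
  match k with
  | O => 1
  | S j => dirichlet j t + 2 * cos (INR (S j) * t)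
  end.

(** Left unnormalised: n + 1 times the classical kernel of mean 1. *)
Fixpoint fejer (n : nat) (t : R) : R :=
  match n with
  | O => dirichlet 0 t
  | S j => fejer j t + dirichlet (S j) t
  end.

Lemma dirichlet_closed (k : nat) (t : R) :
  (1 - cos t) * dirichlet k t = cos (INR k * t) - cos (INR (S k) * t).
Proof.
  induction k as [|k IH].
  - simpl; rewrite Rmult_0_l, cos_0, Rmult_1_l; ring.
  - change (dirichlet (S k) t) with (dirichlet k t + 2 * cos (INR (S k) * t)).
    rewrite Rmult_plus_distr_l, IH.
    set (a := INR (S k) * t).
    replace (INR k * t) with (a - t) by (unfold a; rewrite S_INR; ring).
    replace (INR (S (S k)) * t) with (a + t) by (unfold a; rewrite (S_INR (S k)); ring).
    rewrite cos_minus, cos_plus; ring.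
Qed.

(** Multiplied by 1 - cos t, the Dirichlet kernels telescope. The identity serves twice, for
    nonnegativity and for the moment of the kernel against 1 - cos t. *)
Lemma fejer_closed (n : nat) (t : R) : (1 - cos t) * fejer n t = 1 - cos (INR (S n) * t).
Proof.
  induction n as [|n IH].
  - simpl; rewrite !Rmult_1_l; ring.
  - change (fejer (S n) t) with (fejer n t + dirichlet (S n) t).
    rewrite Rmult_plus_distr_l, IH, dirichlet_closed; ring.
Qed.

(** Covers the points where [fejer_closed] reads 0 = 0 and gives no sign: all the cosines are 1
    there. *)
Lemma dirichlet_cos_1 (k : nat) (t : R) : cos t = 1 -> 0 <= dirichlet k t.
Proof.
  intros H.
  assert (Hs : sin t = 0).
  { assert (Q := sin2_cos2 t); unfold Rsqr in Q; rewrite H in Q; nra. }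
  assert (Hc : forall m, cos (INR m * t) = 1 /\ sin (INR m * t) = 0).
  { induction m as [|m [C S]]; [simpl; rewrite Rmult_0_l, cos_0, sin_0; auto|].
    rewrite S_INR, Rmult_plus_distr_r, Rmult_1_l, cos_plus, sin_plus, C, S, H, Hs.
    split; ring. }
  induction k as [|k IH]; [simpl; lra|].
  change (dirichlet (S k) t) with (dirichlet k t + 2 * cos (INR (S k) * t)).
  rewrite (proj1 (Hc (S k))); lra.
Qed.

Lemma fejer_nonneg (n : nat) (t : R) : 0 <= fejer n t.
Proof.
  destruct (Req_dec (cos t) 1) as [H|H].
  - induction n as [|n IH]; [simpl; lra|].
    change (fejer (S n) t) with (fejer n t + dirichlet (S n) t).
    assert (Q := dirichlet_cos_1 (S n) t H); lra.
  - assert (B := COS_bound t); assert (B' := COS_bound (INR (S n) * t)).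
    assert (E := fejer_closed n t).
    apply Rmult_le_reg_l with (1 - cos t); lra.
Qed.

(** From sin u >= u - u^3/6, which is at least u/3 as long as u^2 <= 4. *)
Lemma sin_ge_third (u : R) : 0 <= u <= 2 -> u / 3 <= sin u.
Proof.
  intros H; destruct (pre_sin_bound u 0) as [B _]; [lra|lra|].
  eapply Rle_trans; [|exact B].
  unfold sin_approx, sin_term; simpl; unfold Rdiv; nra.
Qed.

(** By 1 - cos t = 2 sin^2(t/2) and sin(t/2) >= t/6 for 0 <= t <= PI, hence the constant 18; PI <= 4
    places t/2 in the range of [sin_ge_third]. *)
Lemma sqr_le_1_minus_cos (t : R) : Rabs t <= PI -> t ^ 2 <= 18 * (1 - cos t).
Proof.
  intros H; assert (P := PI_4).
  assert (Q : Rabs t ^ 2 <= 18 * (1 - cos (Rabs t))).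
  { set (u := Rabs t / 2); assert (Hu : 0 <= u <= 2) by (unfold u; assert (X := Rabs_pos t); lra).
    replace (Rabs t) with (2 * u) by (unfold u; field).
    rewrite cos_2a_sin; assert (S := sin_ge_third u Hu); nra. }
  rewrite pow2_abs in Q; unfold Rabs in Q; destruct (Rcase_abs t); auto.
  now rewrite cos_neg in Q.
Qed.

Lemma continuous_cos_shift (m a b x : R) : continuous (fun x => cos (m * (a * (x - b)))) x.
Proof. apply (ex_derive_continuous (V := R_NormedModule)); auto_derive; auto. Qed.

Lemma continuous_dirichlet (k : nat) (a b x : R) :
  continuous (fun x => dirichlet k (a * (x - b))) x.
Proof.
  induction k as [|k IH]; [apply continuous_const|].
  apply (continuous_plus (V := R_NormedModule)); [apply IH|].
  apply (continuous_mult (K := R_AbsRing)); [apply continuous_const|apply continuous_cos_shift].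
Qed.

Lemma continuous_fejer (n : nat) (a b x : R) :
  continuous (fun x => fejer n (a * (x - b))) x.
Proof.
  induction n as [|n IH]; [apply continuous_const|].
  apply (continuous_plus (V := R_NormedModule)); [apply IH|apply continuous_dirichlet].
Qed.

Lemma sin_int_PI (k : Z) : sin (IZR k * PI) = 0.
Proof. apply sin_eq_0_1; exists k; reflexivity. Qed.

(** The angular frequency for which a cell of length 2L is one full period. *)
Definition freq (L : R) : R := PI / L.

Lemma freq_pos (L : R) : 0 < L -> 0 < freq L.
Proof. apply Rdiv_lt_0_compat, PI_RGT_0. Qed.

Lemma is_RInt_cos_cell (L : R) (m n : nat) : 0 < L -> (0 < m)%nat ->
  is_RInt (fun x => cos (INR m * (freq L * (x - L)))) (INR n * (2 * L)) (INR (S n) * (2 * L)) 0.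
Proof.
  intros HL Hm; assert (A := freq_pos L HL); apply lt_0_INR in Hm as Hm'.
  assert (Z : forall k : nat, sin (INR m * (freq L * (INR k * (2 * L) - L))) = 0).
  { intros k; replace (INR m * (freq L * (INR k * (2 * L) - L)))
      with (IZR (Z.of_nat m * (2 * Z.of_nat k - 1)) * PI).
    - apply sin_int_PI.
    - rewrite mult_IZR, minus_IZR, mult_IZR, <- !INR_IZR_INZ; unfold freq; field; lra. }
  set (F := fun x => sin (INR m * (freq L * (x - L))) / (INR m * freq L)).
  replace 0 with (minus (F (INR (S n) * (2 * L))) (F (INR n * (2 * L)))).
  - apply (is_RInt_derive (V := R_CompleteNormedModule) F).
    + intros x _; unfold F; auto_derive; auto; unfold Rminus; field; split; lra.
    + intros x _; apply continuous_cos_shift.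
  - unfold F; rewrite !Z; unfold minus, plus, opp; simpl; unfold Rdiv; ring.
Qed.

Lemma is_RInt_one_cell (L : R) (n : nat) :
  is_RInt (fun _ => 1) (INR n * (2 * L)) (INR (S n) * (2 * L)) (2 * L).
Proof.
  evar_last.
  - apply (is_RInt_const (V := R_NormedModule)).
  - change ((INR (S n) * (2 * L) - INR n * (2 * L)) * 1 = 2 * L); rewrite S_INR; ring.
Qed.

Lemma is_RInt_dirichlet_cell (L : R) (k n : nat) : 0 < L ->
  is_RInt (fun x => dirichlet k (freq L * (x - L))) (INR n * (2 * L)) (INR (S n) * (2 * L)) (2 * L).
Proof.
  intros HL; induction k as [|k IH]; [apply is_RInt_one_cell|].
  evar_last.
  - apply (is_RInt_plus (V := R_NormedModule)); [apply IH|].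
    apply (is_RInt_scal (V := R_NormedModule)), is_RInt_cos_cell; auto; lia.
  - unfold plus, scal; simpl; unfold mult; simpl; ring.
Qed.

Lemma is_RInt_fejer_cell (L : R) (k n : nat) : 0 < L ->
  is_RInt (fun x => fejer k (freq L * (x - L))) (INR n * (2 * L)) (INR (S n) * (2 * L))
    (INR (S k) * (2 * L)).
Proof.
  intros HL; induction k as [|k IH].
  - simpl (INR 1); rewrite Rmult_1_l; apply is_RInt_one_cell.
  - replace (INR (S (S k)) * (2 * L)) with (plus (INR (S k) * (2 * L)) (2 * L))
      by (rewrite (S_INR (S k)); unfold plus; simpl; ring).
    apply (is_RInt_plus (V := R_NormedModule)); [apply IH|apply is_RInt_dirichlet_cell, HL].
Qed.

(** By [fejer_closed] the integrand is 1 minus a cosine of positive integer frequency. The moment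
    thus stays fixed while the mass of the kernel grows like k + 1, which expresses its
    concentration at the cell centre. *)
Lemma is_RInt_fejer_moment_cell (L : R) (k n : nat) : 0 < L ->
  is_RInt (fun x => (1 - cos (freq L * (x - L))) * fejer k (freq L * (x - L)))
    (INR n * (2 * L)) (INR (S n) * (2 * L)) (2 * L).
Proof.
  intros HL; apply (is_RInt_ext (fun x => minus 1 (cos (INR (S k) * (freq L * (x - L)))))).
  - intros x _; rewrite fejer_closed; reflexivity.
  - evar_last.
    + apply (is_RInt_minus (V := R_NormedModule));
        [apply is_RInt_one_cell|apply is_RInt_cos_cell; auto; lia].
    + unfold minus, plus, opp; simpl; ring.
Qed.

(** A single kernel, written with x - L, serves all cells; periodicity recentres it at the midpoint
    of the n-th one. *)
Lemma cos_cell_center (L : R) (n : nat) (x : R) : 0 < L ->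
  cos (freq L * (x - L)) = cos (freq L * (x - (2 * INR n + 1) * L)).
Proof.
  intros HL; replace (freq L * (x - L)) with (freq L * (x - (2 * INR n + 1) * L) + 2 * INR n * PI)
    by (unfold freq; field; lra).
  apply cos_period.
Qed.

(* A Korovkin estimate: |t| <= eta + t^2 / (4 eta) and t^2 <= 18 (1 - cos t), and the moments of
   the Fejer kernel against 1 and 1 - cos t are explicit. *)
Lemma fejer_cell_error (L : R) (f df : R -> C) (K eta : R) (k n : nat) : 0 < L ->
  (forall x, Cder f x (df x)) -> (forall x, Ccont df x) ->
  (forall x, INR n * (2 * L) <= x -> Cmod (df x) <= K) -> 0 < eta ->
  Cmod (cell (2 * L) (fun x => f x * RtoC (fejer k (freq L * (x - L)))) n
        - RtoC (INR (S k) * (2 * L)) * f ((2 * INR n + 1) * L)%R)%C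
  <= K * (2 * L / freq L * (INR (S k) * eta + 18 / (4 * eta))).
Proof.
  intros HL Hd Hc HK He.
  assert (A := freq_pos L HL); assert (P := pos_INR n).
  set (xn := (2 * INR n + 1) * L).
  assert (Hxn : xn = INR n * (2 * L) + L) by (unfold xn; ring).
  assert (Hxn' : INR (S n) * (2 * L) = INR n * (2 * L) + 2 * L) by (rewrite S_INR; ring).
  assert (Cf : forall x, Ccont f x) by (intros x; eapply Cder_cont, Hd).
  assert (CF : forall x, Ccont (fun x => RtoC (fejer k (freq L * (x - L)))) x)
    by (intros x; apply Ccont_RtoC, continuous_fejer).
  assert (E : (RtoC (INR (S k) * (2 * L)) * f xn)%C
    = CInt (fun x => f xn * RtoC (fejer k (freq L * (x - L))))%C
        (INR n * (2 * L)) (INR (S n) * (2 * L))).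
  { rewrite CInt_scal by exact CF.
    rewrite CInt_RtoC, (is_RInt_unique (V := R_CompleteNormedModule) _ _ _ _ (is_RInt_fejer_cell L k n HL)).
    ring. }
  unfold cell; rewrite E, <- CInt_minus.
  2: intros x; apply Ccont_mult; [apply Cf|apply CF].
  2: intros x; apply Ccont_mult; [apply Ccont_const|apply CF].
  assert (K0 : 0 <= K) by (eapply Rle_trans; [apply Cmod_ge_0|apply (HK xn); lra]).
  assert (G := is_RInt_plus (V := R_NormedModule) _ _ _ _ _ _
    (is_RInt_scal (V := R_NormedModule) _ _ _ (K / freq L * eta) _ (is_RInt_fejer_cell L k n HL))
    (is_RInt_scal (V := R_NormedModule) _ _ _ (K / freq L * (18 / (4 * eta))) _
      (is_RInt_fejer_moment_cell L k n HL))).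
  replace (K * (2 * L / freq L * (INR (S k) * eta + 18 / (4 * eta)))) with
    (K / freq L * eta * (INR (S k) * (2 * L)) + K / freq L * (18 / (4 * eta)) * (2 * L))
    by (field; lra).
  eapply Rle_trans; [|right; apply (is_RInt_unique (V := R_CompleteNormedModule) _ _ _ _ G)].
  apply CInt_Cmod_le.
  - lra.
  - intros x; apply Ccont_minus; apply Ccont_mult; auto; apply Ccont_const.
  - eexists; apply G.
  - intros x Hx.
    replace (f x * RtoC (fejer k (freq L * (x - L))) - f xn * RtoC (fejer k (freq L * (x - L))))%C
      with ((f x - f xn) * RtoC (fejer k (freq L * (x - L))))%C by ring.
    assert (F0 := fejer_nonneg k (freq L * (x - L))).
    set (F := fejer k (freq L * (x - L))) in *.
    rewrite Cmod_mult, Cmod_R, Rabs_pos_eq by auto.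
    assert (Lip : Cmod (f x - f xn)%C <= K * Rabs (x - xn)).
    { apply (Cder_lipschitz f df); auto; intros y Hy; apply HK.
      eapply Rle_trans; [|apply Hy]; apply Rmin_glb; lra. }
    set (t := freq L * (x - xn)).
    assert (Ht : Rabs t <= PI).
    { unfold t; rewrite Rabs_mult, (Rabs_pos_eq (freq L)) by lra.
      replace PI with (freq L * L) by (unfold freq; field; lra).
      apply Rmult_le_compat_l; [lra|apply Rabs_le; lra]. }
    assert (Q := sqr_le_1_minus_cos t Ht).
    unfold plus, scal; simpl; unfold mult; simpl.
    rewrite (cos_cell_center L n x HL); fold xn t.
    assert (At : Rabs (x - xn) = / freq L * Rabs t).
    { unfold t; rewrite Rabs_mult, (Rabs_pos_eq (freq L)) by lra; field; lra. }
    assert (AG : Rabs t <= eta + 18 / (4 * eta) * (1 - cos t)).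
    { replace (18 / (4 * eta) * (1 - cos t)) with (18 * (1 - cos t) / (4 * eta)) by (field; lra).
      apply Rle_trans with (eta + t ^ 2 / (4 * eta)).
      - rewrite <- pow2_abs; set (r := Rabs t).
        apply Rmult_le_reg_r with (4 * eta); [lra|].
        rewrite Rmult_plus_distr_r; unfold Rdiv; rewrite Rmult_assoc, Rinv_l by lra.
        assert (0 <= (r - 2 * eta) ^ 2) by apply pow2_ge_0; nra.
      - apply Rplus_le_compat_l; unfold Rdiv; apply Rmult_le_compat_r; auto.
        left; apply Rinv_0_lt_compat; lra. }
    replace (K / freq L * eta * F + K / freq L * (18 / (4 * eta)) * ((1 - cos t) * F))
      with (K * (/ freq L * (eta + 18 / (4 * eta) * (1 - cos t))) * F) by (field; lra).
    apply Rmult_le_compat_r; auto.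
    eapply Rle_trans; [apply Lip|]; apply Rmult_le_compat_l; auto.
    rewrite At; apply Rmult_le_compat_l; auto.
    left; apply Rinv_0_lt_compat; lra.
Qed.

(* Folds the sum over Z of the even sequence (-1)^m u_|m| into a sum over nat. *)
Definition mode_weight (m : nat) : R := match m with O => 1 | S _ => 2 * (-1) ^ m end.

Definition mode (L : R) (s : C) (m : nat) : C :=
  (RtoC (mode_weight m) * chcos_int (2 * L) s (INR m * freq L))%C.

(** The origin of the alternating sign: a translation by L is half a period of the fundamental
    frequency. *)
Lemma cos_half_period_shift (L : R) (m : nat) (x : R) : 0 < L ->
  cos (INR m * (freq L * (x - L))) = (-1) ^ m * cos (INR m * freq L * x).
Proof.
  intros HL.
  replace (INR m * (freq L * (x - L))) with (INR m * freq L * x - INR m * PI)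
    by (unfold freq; field; lra).
  set (y := INR m * freq L * x); clearbody y; revert y.
  induction m as [|m IH]; intros y; [simpl; rewrite Rmult_0_l, Rminus_0_r; ring|].
  replace (y - INR (S m) * PI) with ((y - PI) - INR m * PI) by (rewrite S_INR; ring).
  rewrite IH, <- cos_neg; replace (- (y - PI)) with (PI - y) by ring.
  rewrite Rtrigo_facts.cos_pi_minus; simpl; ring.
Qed.

Lemma cell_dirichlet (L : R) (s : C) (k : nat) : 0 < L -> 0 < Re s ->
  CIs (cell (2 * L) (fun x => chpow s x * RtoC (dirichlet k (freq L * (x - L))))%C)
    (sum_n (G := C_AbelianMonoid) (mode L s) k).
Proof.
  intros HL Hs; assert (HT : 0 < 2 * L) by lra.
  assert (B : forall w, CIs (cell (2 * L) (chcos s w)) (chcos_int (2 * L) s w))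
    by (intros w; apply (half_line_int_spec _ _ _ _ HT (chcos_decay s w Hs))).
  induction k as [|k IH].
  - rewrite sum_O; unfold mode; simpl (mode_weight 0); rewrite Cmult_1_l.
    eapply CIs_ext; [|apply B]; intros n; apply CInt_ext; intros x.
    unfold chcos; simpl; rewrite !Rmult_0_l, cos_0; reflexivity.
  - rewrite sum_Sn; eapply CIs_ext; [|apply CIs_plus; [apply IH|apply CIs_scal, B]].
    intros n; unfold cell; rewrite <- CInt_scal by (intros x; apply Ccont_chcos).
    rewrite <- CInt_plus.
    + apply CInt_ext; intros x.
      change (dirichlet (S k) (freq L * (x - L))) with
        (dirichlet k (freq L * (x - L)) + 2 * cos (INR (S k) * (freq L * (x - L)))).
      rewrite cos_half_period_shift by auto; unfold chcos, mode_weight.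
      rewrite RtoC_plus, !RtoC_mult; ring.
    + intros x; apply Ccont_mult; [apply Ccont_chpow|apply Ccont_RtoC, continuous_dirichlet].
    + intros x; apply Ccont_mult; [apply Ccont_const|apply Ccont_chcos].
Qed.

(** Integration against a Dirichlet kernel gives a partial sum of the modes, so the Fejer kernel
    gives a sum of partial sums, that is, k + 1 times a Cesaro mean. *)
Lemma cell_fejer (L : R) (s : C) (k : nat) : 0 < L -> 0 < Re s ->
  CIs (cell (2 * L) (fun x => chpow s x * RtoC (fejer k (freq L * (x - L))))%C)
    (sum_n (G := C_AbelianMonoid) (sum_n (G := C_AbelianMonoid) (mode L s)) k).
Proof.
  intros HL Hs; induction k as [|k IH].
  - rewrite sum_O; apply (cell_dirichlet L s 0 HL Hs).
  - rewrite sum_Sn; eapply CIs_ext; [|apply CIs_plus; [apply IH|apply cell_dirichlet; auto]].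
    intros n; unfold cell; rewrite <- CInt_plus.
    + apply CInt_ext; intros x.
      change (fejer (S k) (freq L * (x - L))) with
        (fejer k (freq L * (x - L)) + dirichlet (S k) (freq L * (x - L))).
      rewrite RtoC_plus; ring.
    + intros x; apply Ccont_mult; [apply Ccont_chpow|apply Ccont_RtoC, continuous_fejer].
    + intros x; apply Ccont_mult; [apply Ccont_chpow|apply Ccont_RtoC, continuous_dirichlet].
Qed.

(** * Cesaro means and Poisson summation *)

Lemma is_lim_seq_cesaro (u : nat -> R) (l : R) : is_lim_seq u l ->
  is_lim_seq (fun n => / INR (S n) * sum_n u n) l.
Proof.
  intros H; apply is_lim_seq_Reals in H; apply Cesaro_1, is_lim_seq_Reals in H.
  apply is_lim_seq_incr_1 in H; eapply is_lim_seq_ext; [|exact H].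
  intros n; rewrite sum_n_Reals; unfold Rdiv; rewrite Rmult_comm; reflexivity.
Qed.

Lemma Re_scal (r : R) (z : C) : Re (RtoC r * z)%C = r * Re z.
Proof. rewrite Re_mult; simpl; ring. Qed.

Lemma Im_scal (r : R) (z : C) : Im (RtoC r * z)%C = r * Im z.
Proof. rewrite Im_mult; simpl; ring. Qed.

Lemma Clim_cesaro (u : nat -> C) (l : C) : Clim u l ->
  Clim (fun n => RtoC (/ INR (S n)) * sum_n (G := C_AbelianMonoid) u n)%C l.
Proof.
  intros [A B]; apply is_lim_seq_cesaro in A, B; split;
    (eapply is_lim_seq_ext; [|first [exact A|exact B]]); intros n.
  - rewrite Re_scal, Re_sum_n; reflexivity.
  - rewrite Im_scal, Im_sum_n; reflexivity.
Qed.

Lemma is_series_exp (c : R) : 0 < c -> ex_series (fun n => exp (- c * INR n)).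
Proof.
  intros Hc; apply (ex_series_ext (V := R_NormedModule) (fun n => exp (- c) ^ n)).
  - induction n as [|n IH]; [simpl; rewrite Rmult_0_r, exp_0; auto|].
    simpl pow; rewrite IH, S_INR, <- exp_plus; f_equal; ring.
  - apply ex_series_geom; rewrite Rabs_pos_eq by (left; apply exp_pos).
    rewrite <- exp_0; apply exp_increasing; lra.
Qed.

Lemma eq_of_Cmod_le_eps (x y : C) (K : R) :
  (forall eta, 0 < eta -> Cmod (x - y)%C <= K * eta) -> x = y.
Proof.
  intros H.
  assert (E : Cmod (x - y)%C = 0).
  { apply Rle_antisym; [|apply Cmod_ge_0]; apply le_epsilon; intros e He; rewrite Rplus_0_l.
    destruct (Rle_dec K 0) as [HK|HK].
    - eapply Rle_trans; [apply (H 1)|]; lra.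
    - eapply Rle_trans; [apply (H (e / K)); apply Rdiv_lt_0_compat; lra|].
      right; field; lra. }
  apply Cmod_eq_0 in E; replace x with (x - y + y)%C by ring; rewrite E; ring.
Qed.

(** The Fejer integrals are evaluated in two ways. In frequency, their Cesaro means tend to [S0],
    the modes being assumed summable; in space, the Korovkin estimate compares them with 2L times
    the sum of the samples. *)
Lemma poisson_chpow (L : R) (s S0 : C) : 0 < L -> 0 < Re s -> CIs (mode L s) S0 ->
  CIs (fun n => chpow s ((2 * INR n + 1) * L)) (S0 / RtoC (2 * L))%C.
Proof.
  intros HL Hs HS.
  assert (A := freq_pos L HL).
  set (sg := Re s) in *.
  assert (Hb : forall n, Cmod (chpow s ((2 * INR n + 1) * L)) <= exp (- (2 * L * sg) * INR n)).
  { intros n; assert (P := pos_INR n).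
    eapply Rle_trans; [apply Cmod_chpow_le; fold sg; nra|]; apply exp_le; fold sg; nra. }
  assert (Hg : ex_series (fun n => exp (- (2 * L * sg) * INR n))) by (apply is_series_exp; nra).
  assert (HV := CIs_dominated _ _ Hb Hg); set (V := CSeries _) in HV.
  (* On the n-th cell, which starts at 2nL, the derivative -s th(x) f_s(x) is at most |s| exp(-2 L
     sg n); K is the sum of these bounds. *)
  assert (HK : is_series (fun n => Cmod s * exp (- (2 * L * sg) * INR n))
    (Cmod s * Series (fun n => exp (- (2 * L * sg) * INR n)))).
  { apply (is_series_scal (V := R_NormedModule)), Series_correct, Hg. }
  set (K := Cmod s * _) in HK.
  assert (Err : forall eta k, 0 < eta ->
    Cmod (sum_n (G := C_AbelianMonoid) (sum_n (G := C_AbelianMonoid) (mode L s)) k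
          - RtoC (INR (S k) * (2 * L)) * V)%C
    <= K * (2 * L / freq L * (INR (S k) * eta + 18 / (4 * eta)))).
  { intros eta k He.
    assert (D := CIs_minus _ _ _ _ (cell_fejer L s k HL Hs)
      (CIs_scal (RtoC (INR (S k) * (2 * L))) _ _ HV)).
    refine (CIs_Cmod_le _ _ _ _ _ _ D).
    2: { apply (is_series_scal_r (2 * L / freq L * (INR (S k) * eta + 18 / (4 * eta)))), HK. }
    intros n.
    apply (fejer_cell_error L (chpow s) _ (Cmod s * exp (- (2 * L * sg) * INR n)) eta k n HL
      (Cder_chpow s)); auto.
    - intros x; ccont.
    - intros x Hx; assert (P := pos_INR n).
      rewrite <- Cmult_assoc, Cmod_mult, Cmod_opp; apply Rmult_le_compat_l; [apply Cmod_ge_0|].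
      rewrite Cmult_comm; eapply Rle_trans; [apply Cmod_mult_le_l, th_bound|].
      assert (0 <= x) by nra.
      eapply Rle_trans; [apply Cmod_chpow_le; fold sg; lra|]; apply exp_le; fold sg; nra. }
  assert (HS' : Clim (sum_n (G := C_AbelianMonoid) (mode L s)) S0) by (apply CIs_Clim, HS).
  apply Clim_cesaro in HS'.
  assert (E : S0 = (RtoC (2 * L) * V)%C).
  (* For fixed eta, letting k tend to infinity removes the term 18/(4 eta (k+1)) and leaves a
     multiple of eta, which is arbitrary. *)
  { apply eq_of_Cmod_le_eps with (K * (2 * L / freq L)); intros eta He.
    assert (C1 := Clim_Cmod _ _ (Clim_plus _ _ _ _ HS' (Clim_const (- (RtoC (2 * L) * V))%C))).
    assert (U : is_lim_seq (fun k => K * (2 * L / freq L) * (eta + 18 / (4 * eta) * / INR (S k)))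
      (K * (2 * L / freq L) * (eta + 18 / (4 * eta) * 0))).
    { apply is_lim_seq_mult'; [apply is_lim_seq_const|].
      apply is_lim_seq_plus'; [apply is_lim_seq_const|].
      apply is_lim_seq_mult'; [apply is_lim_seq_const|apply is_lim_seq_inv_INR_S]. }
    rewrite Rmult_0_r, Rplus_0_r in U.
    refine (is_lim_seq_le _ _ _ _ _ C1 U); intros k.
    assert (P : 0 < INR (S k)) by (apply lt_0_INR; lia).
    match goal with |- Cmod ?z <= _ => replace z with (RtoC (/ INR (S k)) *
      (sum_n (G := C_AbelianMonoid) (sum_n (G := C_AbelianMonoid) (mode L s)) k
          - RtoC (INR (S k) * (2 * L)) * V))%C end.
    - rewrite Cmod_mult, Cmod_R, Rabs_pos_eq by (left; now apply Rinv_0_lt_compat).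
      eapply Rle_trans; [apply Rmult_le_compat_l; [left; now apply Rinv_0_lt_compat|]; apply (Err eta k He)|].
      right; field; repeat split; lra.
    - rewrite RtoC_inv, (RtoC_mult (INR (S k))) by lra; field; apply RtoC_neq0; lra. }
  replace (S0 / RtoC (2 * L))%C with V; [exact HV|].
  rewrite E; field; apply RtoC_neq0; lra.
Qed.

(** * Families of functions with a uniform second-order expansion *)

(* Uniformity in [m] makes termwise differentiation of a series of such functions
   elementary, without Cauchy's formula. *)
Definition UF (F : nat -> C -> C) (s0 : C) : Prop :=
  exists (d : nat -> C) (delta M : R), 0 < delta /\ 0 <= M /\
  forall m h, Cmod h < delta ->
    Cmod (F m (s0 + h)%C) <= M /\ Cmod (d m) <= M /\
    Cmod (F m (s0 + h) - F m s0 - h * d m)%C <= M * Cmod h ^ 2.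

Lemma UF_ext (F G : nat -> C -> C) (s0 : C) : (forall m s, F m s = G m s) -> UF F s0 -> UF G s0.
Proof.
  intros E (d & delta & M & H1 & H2 & H3); exists d, delta, M.
  split; [auto|split; [auto|]]; intros m h; rewrite <- !E; apply H3.
Qed.

Lemma UF_const (c : nat -> C) (M : R) (s0 : C) : (forall m, Cmod (c m) <= M) ->
  UF (fun m _ => c m) s0.
Proof.
  intros H; assert (HM : 0 <= M) by (eapply Rle_trans; [apply Cmod_ge_0|apply (H O)]).
  exists (fun _ => RtoC 0), 1, M; split; [lra|split; [auto|]]; intros m h Hh; repeat split; auto.
  - rewrite Cmod_0; auto.
  - replace (c m - c m - h * 0)%C with (RtoC 0) by ring; rewrite Cmod_0.
    apply Rmult_le_pos; [auto|apply pow2_ge_0].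
Qed.

Lemma UF_id (s0 : C) : UF (fun _ s => s) s0.
Proof.
  assert (P := Cmod_ge_0 s0).
  exists (fun _ => RtoC 1), 1, (Cmod s0 + 1); split; [lra|split; [lra|]]; intros m h Hh.
  assert (Q := Cmod_triangle s0 h); rewrite Cmod_1; repeat split; try lra.
  replace (s0 + h - s0 - h * 1)%C with (RtoC 0) by ring; rewrite Cmod_0.
  apply Rmult_le_pos; [lra|apply pow2_ge_0].
Qed.

Lemma UF_plus (F G : nat -> C -> C) (s0 : C) :
  UF F s0 -> UF G s0 -> UF (fun m s => F m s + G m s)%C s0.
Proof.
  intros (d & d1 & M & H1 & H2 & H3) (e & d2 & N & K1 & K2 & K3).
  exists (fun m => d m + e m)%C, (Rmin d1 d2), (M + N).
  split; [apply Rmin_pos; auto|split; [lra|]]; intros m h Hh.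
  destruct (H3 m h) as (A1 & A2 & A3); [eapply Rlt_le_trans; [apply Hh|apply Rmin_l]|].
  destruct (K3 m h) as (B1 & B2 & B3); [eapply Rlt_le_trans; [apply Hh|apply Rmin_r]|].
  repeat split; try (eapply Rle_trans; [apply Cmod_triangle|lra]).
  replace (F m (s0 + h) + G m (s0 + h) - (F m s0 + G m s0) - h * (d m + e m))%C
    with ((F m (s0 + h) - F m s0 - h * d m) + (G m (s0 + h) - G m s0 - h * e m))%C by ring.
  eapply Rle_trans; [apply Cmod_triangle|]; lra.
Qed.

Lemma UF_increment (z u w h : C) (M : R) : Cmod h <= 1 -> 0 <= M -> Cmod w <= M ->
  Cmod (z - u - h * w)%C <= M * Cmod h ^ 2 -> Cmod (z - u)%C <= 2 * M * Cmod h.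
Proof.
  intros Hh HM Hw H; replace (z - u)%C with ((z - u - h * w) + h * w)%C by ring.
  eapply Rle_trans; [apply Cmod_triangle|]; rewrite Cmod_mult.
  assert (P := Cmod_ge_0 h).
  assert (Cmod h * Cmod w <= Cmod h * M) by (apply Rmult_le_compat_l; auto).
  assert (M * Cmod h ^ 2 <= M * Cmod h) by (apply Rmult_le_compat_l; [auto|simpl; nra]).
  lra.
Qed.

Lemma UF_mult (F G : nat -> C -> C) (s0 : C) :
  UF F s0 -> UF G s0 -> UF (fun m s => F m s * G m s)%C s0.
Proof.
  intros (d & d1 & M & H1 & H2 & H3) (e & d2 & N & K1 & K2 & K3).
  (* The remainder of the product splits into three terms, bounded by 1, 2 and 1 times M N |h|^2,
     hence the factor 4. *)
  exists (fun m => d m * G m s0 + F m s0 * e m)%C, (Rmin 1 (Rmin d1 d2)), (4 * (M * N)).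
  assert (MN : 0 <= M * N) by nra.
  split; [repeat apply Rmin_pos; auto; lra|split; [lra|]]; intros m h Hh.
  assert (L1 : Cmod h < 1) by (eapply Rlt_le_trans; [apply Hh|apply Rmin_l]).
  assert (L2 : Cmod h < Rmin d1 d2) by (eapply Rlt_le_trans; [apply Hh|apply Rmin_r]).
  destruct (H3 m h) as (A1 & A2 & A3); [eapply Rlt_le_trans; [apply L2|apply Rmin_l]|].
  destruct (K3 m h) as (B1 & B2 & B3); [eapply Rlt_le_trans; [apply L2|apply Rmin_r]|].
  destruct (H3 m 0%C) as (A0 & _ & _); [rewrite Cmod_0; auto|].
  destruct (K3 m 0%C) as (B0 & _ & _); [rewrite Cmod_0; auto|].
  rewrite Cplus_0_r in A0, B0.
  assert (mul : forall x y p q, Cmod x <= p -> Cmod y <= q -> Cmod (x * y)%C <= p * q).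
  { intros; rewrite Cmod_mult; apply Rmult_le_compat; auto; apply Cmod_ge_0. }
  assert (P := pow2_ge_0 (Cmod h)); assert (P1 := Cmod_ge_0 h).
  repeat split.
  - eapply Rle_trans; [apply mul; eauto|lra].
  - eapply Rle_trans; [apply Cmod_triangle|].
    assert (Q1 := mul _ _ _ _ A2 B0); assert (Q2 := mul _ _ _ _ A0 B2); lra.
  - assert (Ig := UF_increment _ _ _ _ _ (Rlt_le _ _ L1) K2 B2 B3).
    replace (F m (s0 + h) * G m (s0 + h) - F m s0 * G m s0 - h * (d m * G m s0 + F m s0 * e m))%C
      with ((F m (s0 + h) - F m s0 - h * d m) * G m (s0 + h)
            + h * (d m * (G m (s0 + h) - G m s0))
            + F m s0 * (G m (s0 + h) - G m s0 - h * e m))%C by ring.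
    eapply Rle_trans; [apply Cmod_triangle|].
    eapply Rle_trans; [apply Rplus_le_compat_r, Cmod_triangle|].
    assert (Q1 := mul _ _ _ _ A3 B1); assert (Q3 := mul _ _ _ _ A0 B3).
    assert (Q2 := mul _ _ _ _ (Rle_refl (Cmod h)) (mul _ _ _ _ A2 Ig)).
    eapply Rle_trans; [apply Rplus_le_compat; [apply Rplus_le_compat; [apply Q1|apply Q2]|apply Q3]|].
    right; ring.
Qed.

Lemma UF_inv (F : nat -> C -> C) (s0 : C) (c : R) : 0 < c -> (forall m, c <= Cmod (F m s0)) ->
  UF F s0 -> UF (fun m s => / F m s)%C s0.
Proof.
  intros Hc HF (d & d1 & M & H1 & H2 & H3).
  (* Within this radius the increment 2 M |h| is at most c/2, so |F| >= c/2 for all m at once; the +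
     1 covers M = 0. *)
  assert (Hd : 0 < c / (4 * M + 1)) by (apply Rdiv_lt_0_compat; lra).
  exists (fun m => - d m * (/ F m s0 * / F m s0))%C, (Rmin 1 (Rmin d1 (c / (4 * M + 1)))),
    (2 * / c + M * (/ c * / c) + 8 * M ^ 2 * (/ c * / c * / c)).
  assert (C1 : 0 < / c) by now apply Rinv_0_lt_compat.
  assert (C2 : 0 <= M * (/ c * / c)) by (apply Rmult_le_pos; [auto|nra]).
  assert (C3 : 0 <= 8 * M ^ 2 * (/ c * / c * / c)).
  { apply Rmult_le_pos; [assert (Q := pow2_ge_0 M); lra|].
    left; repeat apply Rmult_lt_0_compat; auto. }
  split; [repeat apply Rmin_pos; auto; lra|split; [lra|]]; intros m h Hh.
  assert (L1 : Cmod h < 1) by (eapply Rlt_le_trans; [apply Hh|apply Rmin_l]).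
  assert (L2 : Cmod h < Rmin d1 (c / (4 * M + 1)))
    by (eapply Rlt_le_trans; [apply Hh|apply Rmin_r]).
  assert (L3 : Cmod h < c / (4 * M + 1)) by (eapply Rlt_le_trans; [apply L2|apply Rmin_r]).
  destruct (H3 m h) as (A1 & A2 & A3); [eapply Rlt_le_trans; [apply L2|apply Rmin_l]|].
  assert (Ig := UF_increment _ _ _ _ _ (Rlt_le _ _ L1) H2 A2 A3).
  assert (P1 := Cmod_ge_0 h); assert (P := pow2_ge_0 (Cmod h)).
  assert (I2 : 2 * M * Cmod h <= c / 2).
  { assert (Cmod h * (4 * M + 1) <= c).
    { apply Rmult_lt_compat_r with (r := 4 * M + 1) in L3; [|lra].
      unfold Rdiv in L3; rewrite Rmult_assoc, Rinv_l in L3; lra. }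
    lra. }
  assert (HF0 := HF m).
  assert (HF1 : c / 2 <= Cmod (F m (s0 + h)%C)).
  { assert (T := Cmod_triangle_inv (F m s0) (F m (s0 + h)%C)).
    rewrite Cmod_minus_sym in T; lra. }
  assert (N0 : F m s0 <> 0) by (apply Cmod_gt_0; lra).
  assert (N1 : F m (s0 + h)%C <> 0) by (apply Cmod_gt_0; lra).
  assert (J0 : Cmod (/ F m s0)%C <= / c).
  { rewrite Cmod_inv by auto; apply Rinv_le_contravar; lra. }
  assert (J1 : Cmod (/ F m (s0 + h))%C <= 2 * / c).
  { rewrite Cmod_inv by auto; replace (2 * / c) with (/ (c / 2)) by (field; lra).
    apply Rinv_le_contravar; lra. }
  assert (mul : forall x y p q, Cmod x <= p -> Cmod y <= q -> Cmod (x * y)%C <= p * q).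
  { intros; rewrite Cmod_mult; apply Rmult_le_compat; auto; apply Cmod_ge_0. }
  assert (J00 := mul _ _ _ _ J0 J0).
  repeat split.
  - lra.
  - assert (Q : Cmod (- d m)%C <= M) by (rewrite Cmod_opp; auto).
    assert (Q' := mul _ _ _ _ Q J00); lra.
  - set (D := (F m (s0 + h) - F m s0)%C) in *.
    replace (/ F m (s0 + h) - / F m s0 - h * (- d m * (/ F m s0 * / F m s0)))%C
      with (D * D * (/ F m s0 * / F m s0 * / F m (s0 + h))
            + - (D - h * d m) * (/ F m s0 * / F m s0))%C by (unfold D; field; auto).
    eapply Rle_trans; [apply Cmod_triangle|].
    assert (Q1 := mul _ _ _ _ (mul _ _ _ _ Ig Ig) (mul _ _ _ _ J00 J1)).
    rewrite <- Cmod_opp in A3; assert (Q2 := mul _ _ _ _ A3 J00).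
    eapply Rle_trans; [apply Rplus_le_compat; [apply Q1|apply Q2]|].
    replace (2 * M * Cmod h * (2 * M * Cmod h) * (/ c * / c * (2 * / c)) + M * Cmod h ^ 2 * (/ c * / c))
      with ((M * (/ c * / c) + 8 * M ^ 2 * (/ c * / c * / c)) * Cmod h ^ 2) by ring.
    apply Rmult_le_compat_r; lra.
Qed.

Lemma UF_Cexp (c s0 : C) : UF (fun _ s => Cexp (s * c)) s0.
Proof.
  set (E := Cmod (Cexp (s0 * c)%C)); set (k := Cmod c).
  assert (HE : 0 <= E) by apply Cmod_ge_0; assert (Hk : 0 <= k) by apply Cmod_ge_0.
  assert (X := exp_pos k).
  assert (E1 : 1 <= exp k) by (rewrite <- exp_0; now apply exp_le).
  exists (fun _ => c * Cexp (s0 * c))%C, 1, (E * exp k * (1 + k + k ^ 2)).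
  assert (Q : 0 <= k ^ 2) by apply pow2_ge_0.
  assert (EX : 0 <= E * exp k) by (apply Rmult_le_pos; lra).
  split; [lra|split; [apply Rmult_le_pos; lra|]]; intros _ h Hh.
  assert (P := Cmod_ge_0 h).
  assert (Hc : Cmod (h * c)%C <= k) by (rewrite Cmod_mult; fold k; nra).
  rewrite Cmult_plus_distr_r, Cexp_plus.
  assert (Y : exp (Cmod (h * c)%C) <= exp k) by now apply exp_le.
  assert (EK : 0 <= E * exp k * k /\ 0 <= E * exp k * k ^ 2) by (split; apply Rmult_le_pos; auto).
  repeat split.
  - rewrite Cmod_mult, (Cmod_Cexp (h * c)); fold E.
    assert (exp (Re (h * c)%C) <= exp k).
    { apply exp_le; eapply Rle_trans; [apply Rle_abs|]; eapply Rle_trans; [apply re_le_Cmod|auto]. }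
    assert (E * exp (Re (h * c)%C) <= E * exp k) by (apply Rmult_le_compat_l; auto).
    lra.
  - rewrite Cmod_mult; fold E k.
    assert (k * E <= E * exp k * k) by (rewrite Rmult_comm; apply Rmult_le_compat_r; nra).
    lra.
  - replace (Cexp (s0 * c) * Cexp (h * c) - Cexp (s0 * c) - h * (c * Cexp (s0 * c)))%C
      with (Cexp (s0 * c) * (Cexp (h * c) - 1 - h * c))%C by ring.
    rewrite Cmod_mult; fold E.
    eapply Rle_trans; [apply Rmult_le_compat_l; [auto|apply Cexp_minus_1_minus_le]|].
    rewrite Cmod_mult at 1; fold k; rewrite Rpow_mult_distr.
    apply Rle_trans with (E * exp k * k ^ 2 * Cmod h ^ 2).
    + replace (E * exp k * k ^ 2 * Cmod h ^ 2) with (E * (Cmod h ^ 2 * k ^ 2 * exp k)) by ring.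
      apply Rmult_le_compat_l; auto; apply Rmult_le_compat_l; auto.
      apply Rmult_le_pos; apply pow2_ge_0.
    + apply Rmult_le_compat_r; [apply pow2_ge_0|lra].
Qed.

(** Values, derivatives and remainders are bounded uniformly in m, so the absolutely summable
    coefficients dominate all three series. Convergence on a whole disc is recorded for identifying
    the sum near [s0]. *)
Lemma UF_sum (F : nat -> C -> C) (c : nat -> R) (s0 : C) : ex_series (fun m => Rabs (c m)) ->
  UF F s0 ->
  UF (fun _ s => CSeries (fun m => RtoC (c m) * F m s)%C) s0 /\
  exists delta, 0 < delta /\ forall h, Cmod h < delta ->
    CIs (fun m => RtoC (c m) * F m (s0 + h))%C (CSeries (fun m => RtoC (c m) * F m (s0 + h))%C).
Proof.
  intros [S HS] (d & delta & M & H1 & H2 & H3).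
  assert (Hc : forall (u : nat -> C) K, (forall m, Cmod (u m) <= K) ->
    CIs (fun m => RtoC (c m) * u m)%C (CSeries (fun m => RtoC (c m) * u m)%C) /\
    Cmod (CSeries (fun m => RtoC (c m) * u m)%C) <= S * K).
  { intros u K HK.
    assert (B : forall m, Cmod (RtoC (c m) * u m)%C <= Rabs (c m) * K).
    { intros m; rewrite Cmod_mult, Cmod_R; apply Rmult_le_compat_l; [apply Rabs_pos|auto]. }
    assert (B' : is_series (fun m => Rabs (c m) * K) (S * K))
      by (apply (is_series_scal_r K), HS).
    assert (I := CIs_dominated _ _ B (ex_intro _ _ B')); split; auto.
    apply (CIs_Cmod_le _ _ _ _ B B' I). }
  assert (S0 : 0 <= S).
  { eapply Rle_trans; [apply (Rabs_pos (c O))|]. rewrite <- (sum_O (fun m => Rabs (c m))).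
    apply is_series_nonneg_sum_le; auto; intros; apply Rabs_pos. }
  assert (Z : Cmod (RtoC 0) < delta) by now rewrite Cmod_0.
  assert (F0 : forall m, Cmod (F m s0) <= M).
  { intros m; assert (A := proj1 (H3 m _ Z)); rewrite Cplus_0_r in A; auto. }
  split.
  2: { exists delta; split; auto; intros h Hh.
       apply (Hc (fun m => F m (s0 + h)%C) M (fun m => proj1 (H3 m h Hh))). }
  exists (fun _ => CSeries (fun m => RtoC (c m) * d m)%C), delta, (S * M).
  split; [auto|split; [now apply Rmult_le_pos|]]; intros _ h Hh.
  destruct (Hc (fun m => F m (s0 + h)%C) M (fun m => proj1 (H3 m h Hh))) as [I1 B1].
  destruct (Hc (fun m => F m s0) M F0) as [I0 _].
  destruct (Hc d M (fun m => proj1 (proj2 (H3 m h Hh)))) as [I2 B2].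
  repeat split; auto.
  destruct (Hc (fun m => F m (s0 + h) - F m s0 - h * d m)%C (M * Cmod h ^ 2)
    (fun m => proj2 (proj2 (H3 m h Hh)))) as [I3 B3].
  rewrite Rmult_assoc.
  match goal with |- Cmod ?z <= _ => match type of B3 with Cmod ?w <= _ =>
    replace z with w; [exact B3|] end end.
  apply CIs_CSeries.
  eapply CIs_ext; [|apply CIs_minus; [apply CIs_minus; [apply I1|apply I0]|apply CIs_scal, I2]].
  intros m; simpl; ring.
Qed.

Lemma Cplus_minus_cancel (x y : C) : (x + (y - x) = y)%C.
Proof. ring. Qed.

Lemma UF_ex_derive (f : C -> C) (s0 : C) : UF (fun _ => f) s0 ->
  ex_derive (K := C_AbsRing) (V := C_NormedModule) f s0.
Proof.
  intros (d & delta & M & H1 & H2 & H3); exists (d O); split.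
  { apply (is_linear_scal_l (K := C_AbsRing) (V := C_NormedModule)). }
  intros x Hx.
  apply (is_filter_lim_locally_unique (V := AbsRing_NormedModule C_AbsRing)) in Hx; subst x.
  intros eps.
  assert (Hd : 0 < Rmin delta (eps / (M + 1))).
  { apply Rmin_pos; auto; apply Rdiv_lt_0_compat; [apply cond_pos|lra]. }
  exists (mkposreal _ Hd); intros y Hy.
  assert (Hh : Cmod (y - s0)%C < Rmin delta (eps / (M + 1))) by exact Hy.
  set (h := (y - s0)%C) in *.
  destruct (H3 O h) as (_ & _ & A); [eapply Rlt_le_trans; [apply Hh|apply Rmin_l]|].
  unfold h in A; rewrite Cplus_minus_cancel in A; fold h in A.
  change (Cmod (f y - f s0 - h * d O)%C <= eps * Cmod h).
  eapply Rle_trans; [apply A|]; simpl; rewrite Rmult_1_r, <- Rmult_assoc.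
  apply Rmult_le_compat_r; [apply Cmod_ge_0|].
  assert (L : Cmod h < eps / (M + 1)) by (eapply Rlt_le_trans; [apply Hh|apply Rmin_r]).
  apply Rmult_lt_compat_r with (r := M + 1) in L; [|lra].
  unfold Rdiv in L; rewrite Rmult_assoc, Rinv_l in L by lra.
  assert (P := Cmod_ge_0 h); nra.
Qed.

Lemma UF_ex_derive_loc (f g : C -> C) (s0 : C) (delta : R) : 0 < delta ->
  (forall h : C, Cmod h < delta -> f (s0 + h)%C = g (s0 + h)%C) -> UF (fun _ => g) s0 ->
  ex_derive (K := C_AbsRing) (V := C_NormedModule) f s0.
Proof.
  intros Hd E H.
  apply (ex_derive_ext_loc (K := C_AbsRing) (V := C_NormedModule) g).
  - exists (mkposreal _ Hd); intros y Hy.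
    symmetry; rewrite <- (Cplus_minus_cancel s0 y); apply E, Hy.
  - now apply UF_ex_derive.
Qed.

Lemma UF_filterlim_loc (f g : C -> C) (s0 : C) (delta : R) : 0 < delta ->
  (forall h : C, h <> 0 -> Cmod h < delta -> f (s0 + h)%C = g (s0 + h)%C) -> UF (fun _ => g) s0 ->
  filterlim f (locally' (T := C_UniformSpace) s0) (locally (T := C_UniformSpace) (g s0)).
Proof.
  intros Hd E (d & d1 & M & H1 & H2 & H3).
  apply filterlim_locally; intros eps.
  set (r := Rmin (Rmin 1 delta) (Rmin d1 (eps / (2 * M + 1)))).
  (* Neighbourhoods in [C_UniformSpace] are boxes; half of r in each coordinate ensures modulus
     below r. *)
  assert (Hr : 0 < r / 2).
  { unfold r; apply Rdiv_lt_0_compat; [|lra]; repeat apply Rmin_pos; auto; try lra.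
    apply Rdiv_lt_0_compat; [apply cond_pos|lra]. }
  exists (mkposreal _ Hr); intros y [By1 By2] Hy.
  set (h := (y - s0)%C).
  assert (Hh : Cmod h < r).
  { eapply Rle_lt_trans; [apply Cmod_le_Re_Im|].
    change (Rabs (Re h) < r / 2) in By1; change (Rabs (Im h) < r / 2) in By2; lra. }
  assert (L1 : Cmod h < Rmin 1 delta) by (eapply Rlt_le_trans; [apply Hh|apply Rmin_l]).
  assert (L2 : Cmod h < Rmin d1 (eps / (2 * M + 1)))
    by (eapply Rlt_le_trans; [apply Hh|apply Rmin_r]).
  assert (L3 : Cmod h <= 1) by (left; eapply Rlt_le_trans; [apply L1|apply Rmin_l]).
  assert (Ey : y = (s0 + h)%C) by (symmetry; apply Cplus_minus_cancel).
  assert (Hn : h <> 0).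
  { intros E0; apply Hy; rewrite Ey, E0; apply Cplus_0_r. }
  rewrite Ey, E; auto; [|eapply Rlt_le_trans; [apply L1|apply Rmin_r]].
  destruct (H3 O h) as (_ & A2 & A3); [eapply Rlt_le_trans; [apply L2|apply Rmin_l]|].
  assert (Ig := UF_increment _ _ _ _ _ L3 H2 A2 A3).
  assert (L : Cmod h < eps / (2 * M + 1)) by (eapply Rlt_le_trans; [apply L2|apply Rmin_r]).
  apply Rmult_lt_compat_r with (r := 2 * M + 1) in L; [|lra].
  unfold Rdiv in L; rewrite Rmult_assoc, Rinv_l in L by lra.
  assert (P := Cmod_ge_0 h).
  assert (Cmod (g (s0 + h) - g s0)%C < eps) by nra.
  split.
  - eapply Rle_lt_trans; [apply (re_le_Cmod (g (s0 + h) - g s0)%C)|auto].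
  - eapply Rle_lt_trans; [apply (im_le_Cmod (g (s0 + h) - g s0)%C)|auto].
Qed.

(** * Holomorphy of the cosine integrals in s, uniformly in the frequency *)

Lemma sqr_le_4_exp (u : R) : 0 <= u -> u ^ 2 <= 4 * exp u.
Proof.
  intros H; replace u with (u / 2 + u / 2) at 2 by field; rewrite exp_plus.
  assert (u / 2 <= exp (u / 2)).
  { destruct (Req_dec u 0) as [->|N]; [replace (0 / 2) with 0 by field; rewrite exp_0; lra|].
    assert (X := exp_ineq1 (u / 2) ltac:(lra)); lra. }
  nra.
Qed.

(** With l = [lch x] and sg = Re s, the second-order term brings the factor l^2 exp(|h| l). Each of
    l^2 and exp(|h| l) is paid for with exp(sg l / 4), up to the constant 64/sg^2 for l^2, which
    leaves half of the decay. *)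
Lemma Cmod_chpow_incr_le (s h : C) (x : R) : 0 < Re s -> Cmod h <= Re s / 4 -> 0 <= x ->
  Cmod (chpow (s + h) x - chpow s x + h * (RtoC (lch x) * chpow s x))%C
  <= 64 / Re s ^ 2 * Cmod h ^ 2 * exp (- (Re s / 2) * x).
Proof.
  intros Hs Hh Hx; rewrite chpow_plus.
  set (sg := Re s) in *; set (l := lch x).
  assert (Hl : 0 <= l) by apply lch_nonneg; assert (Hlx : x <= l) by apply lch_ge.
  assert (P := Cmod_ge_0 h).
  replace (chpow s x * chpow h x - chpow s x + h * (RtoC l * chpow s x))%C
    with (chpow s x * (Cexp (- h * RtoC l) - 1 - - h * RtoC l))%C by (unfold chpow; fold l; ring).
  rewrite Cmod_mult, Cmod_chpow; fold sg l.
  eapply Rle_trans; [apply Rmult_le_compat_l; [left; apply exp_pos|apply Cexp_minus_1_minus_le]|].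
  rewrite Cmod_mult, Cmod_opp, Cmod_R, (Rabs_pos_eq l) by auto.
  assert (A : exp (Cmod h * l) <= exp (sg / 4 * l)) by (apply exp_le; nra).
  assert (B := sqr_le_4_exp (sg / 4 * l) ltac:(nra)).
  assert (E1 : exp (- sg * l) * (exp (sg / 4 * l) * exp (sg / 4 * l)) = exp (- (sg / 2) * l))
    by (rewrite <- !exp_plus; f_equal; field).
  assert (E2 : exp (- (sg / 2) * l) <= exp (- (sg / 2) * x)) by (apply exp_le; nra).
  assert (X1 := exp_pos (- sg * l)); assert (X2 := exp_pos (sg / 4 * l)).
  assert (P2 := pow2_ge_0 (Cmod h)).
  assert (B' : l ^ 2 <= 64 / sg ^ 2 * exp (sg / 4 * l)).
  { replace (l ^ 2) with (16 / sg ^ 2 * (sg / 4 * l) ^ 2) by (field; lra).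
    replace (64 / sg ^ 2 * exp (sg / 4 * l)) with (16 / sg ^ 2 * (4 * exp (sg / 4 * l))) by (field; lra).
    apply Rmult_le_compat_l; auto; apply Rdiv_le_0_compat; [lra|nra]. }
  assert (K0 : 0 < 64 / sg ^ 2) by (apply Rdiv_lt_0_compat; [lra|nra]).
  apply Rle_trans with (64 / sg ^ 2 * Cmod h ^ 2 * exp (- (sg / 2) * l)).
  2: { apply Rmult_le_compat_l; auto; nra. }
  rewrite <- E1.
  replace (64 / sg ^ 2 * Cmod h ^ 2 * (exp (- sg * l) * (exp (sg / 4 * l) * exp (sg / 4 * l))))
    with (exp (- sg * l) * (Cmod h ^ 2 * (64 / sg ^ 2 * exp (sg / 4 * l)) * exp (sg / 4 * l))) by ring.
  apply Rmult_le_compat_l; [lra|]; rewrite Rpow_mult_distr.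
  apply Rmult_le_compat; auto.
  - apply Rmult_le_pos; apply pow2_ge_0.
  - left; apply exp_pos.
  - apply Rmult_le_compat_l; auto.
Qed.

(** Differentiation under the integral sign. The cosine enters the bounds only through |cos| <= 1,
    so the constants do not depend on the frequencies [w m]. *)
Lemma UF_chcos_int (T : R) (z s0 : C) (w : nat -> R) : 0 < T -> 0 < Re (s0 + z)%C ->
  UF (fun m s => chcos_int T (s + z) (w m)) s0.
Proof.
  intros HT Hs; set (s1 := (s0 + z)%C) in *; set (sg := Re s1) in *.
  set (dphi := fun m x => (RtoC (lch x) * chcos s1 (w m) x)%C).
  assert (K0 : 0 < 64 / sg ^ 2) by (apply Rdiv_lt_0_compat; [lra|nra]).
  assert (Dd : forall m, exp_decay (2 / sg) (sg / 2) (dphi m)).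
  { intros m; split; [lra|split].
    - intros x; apply Ccont_mult; [|apply Ccont_chcos].
      eapply Cder_cont, Cder_RtoC, is_derive_lch.
    - intros x Hx; unfold dphi, chcos.
      assert (Hl := lch_nonneg x); assert (Hlx := lch_ge x).
      rewrite Cmult_assoc; eapply Rle_trans; [apply Cmod_mult_le_l, Rabs_cos_le|].
      rewrite Cmod_mult, Cmod_R, Rabs_pos_eq, Cmod_chpow by auto; fold sg.
      set (l := lch x) in *.
      assert (X : sg / 2 * l <= exp (sg / 2 * l)).
      { destruct (Req_dec (sg / 2 * l) 0) as [->|N]; [rewrite exp_0; lra|].
        assert (Y := exp_ineq1 _ N); lra. }
      replace (- sg * l) with (- (sg / 2) * l + - (sg / 2 * l)) by field.
      rewrite exp_plus, exp_Ropp.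
      assert (E2 : exp (- (sg / 2) * l) <= exp (- (sg / 2) * x)) by (apply exp_le; nra).
      apply Rle_trans with (2 / sg * exp (- (sg / 2) * l)).
      2: { apply Rmult_le_compat_l; auto; left; apply Rdiv_lt_0_compat; lra. }
      set (e := exp (sg / 2 * l)) in *; assert (He : 0 < e) by apply exp_pos.
      replace (l * (exp (- (sg / 2) * l) * / e))
        with (2 / sg * exp (- (sg / 2) * l) * (sg / 2 * l / e)) by (field; lra).
      rewrite <- (Rmult_1_r (2 / sg * exp _)) at 2.
      apply Rmult_le_compat_l.
      + apply Rmult_le_pos; [left; apply Rdiv_lt_0_compat; lra|left; apply exp_pos].
      + apply Rmult_le_reg_r with e; auto; unfold Rdiv; rewrite Rmult_assoc, Rinv_l; lra. }
  (* The three summands of the constant bound the value (as Re(s1 + h) >= sg/2), the derivative and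
     the remainder, respectively. *)
  exists (fun m => - half_line_int T (dphi m))%C, (sg / 4), (2 / sg + 4 / sg ^ 2 + 128 / sg ^ 3).
  assert (A1 : 0 < 2 / sg) by (apply Rdiv_lt_0_compat; lra).
  assert (A2 : 0 < 4 / sg ^ 2) by (apply Rdiv_lt_0_compat; [lra|apply pow_lt; auto]).
  assert (A3 : 0 < 128 / sg ^ 3) by (apply Rdiv_lt_0_compat; [lra|apply pow_lt; auto]).
  split; [lra|split; [lra|]]; intros m h Hh.
  replace (s0 + h + z)%C with (s1 + h)%C by (unfold s1; ring); fold s1.
  assert (Hre : sg - Cmod h <= Re (s1 + h)%C).
  { assert (R := re_le_Cmod h); apply Rabs_le_between in R.
    change (sg - Cmod h <= Re s1 + Re h); fold sg; lra. }
  assert (Hp : 0 < Re (s1 + h)%C) by lra.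
  repeat split.
  - eapply Rle_trans; [now apply chcos_int_bound|].
    apply Rle_trans with (2 / sg); [|lra].
    replace (2 / sg) with (/ (sg / 2)) by (field; lra); apply Rinv_le_contravar; lra.
  - rewrite Cmod_opp; eapply Rle_trans; [apply (half_line_int_spec T _ _ _ HT (Dd m))|].
    replace (2 / sg / (sg / 2)) with (4 / sg ^ 2) by (field; lra); lra.
  - unfold chcos_int.
    assert (D1 := chcos_decay (s1 + h) (w m) Hp); assert (D0 := chcos_decay s1 (w m) Hs).
    assert (D2 := exp_decay_scal (- h)%C _ _ _ (Dd m)).
    set (phi := fun x => (chcos (s1 + h) (w m) x - chcos s1 (w m) x - - h * dphi m x)%C).
    assert (Dphi : exp_decay (64 / sg ^ 2 * Cmod h ^ 2) (sg / 2) phi).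
    { split; [lra|split].
      - intros x; apply Ccont_minus; [apply Ccont_minus; apply Ccont_chcos|apply D2].
      - intros x Hx; unfold phi, dphi, chcos.
        match goal with |- Cmod ?u <= _ => replace u with
          ((chpow (s1 + h) x - chpow s1 x + h * (RtoC (lch x) * chpow s1 x))
           * RtoC (cos (w m * x)))%C by ring end.
        eapply Rle_trans; [apply Cmod_mult_le_l, Rabs_cos_le|].
        apply Cmod_chpow_incr_le; auto; fold sg; lra. }
    assert (E : half_line_int T phi
      = (half_line_int T (chcos (s1 + h) (w m)) - half_line_int T (chcos s1 (w m))
         - h * - half_line_int T (dphi m))%C).
    { apply half_line_int_unique.
      eapply CIs_ext; [|apply CIs_minus; [apply CIs_minus;
        [apply (half_line_int_spec T _ _ _ HT D1)|apply (half_line_int_spec T _ _ _ HT D0)]|]].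
      2: { replace (h * - half_line_int T (dphi m))%C with ((- h) * half_line_int T (dphi m))%C by ring.
           apply CIs_scal, (half_line_int_spec T _ _ _ HT (Dd m)). }
      intros n; cbv beta; unfold cell; rewrite <- CInt_scal by apply Dd.
      rewrite <- CInt_minus by (intros x; apply Ccont_chcos).
      rewrite <- CInt_minus; [reflexivity| |apply D2].
      intros x; apply Ccont_minus; apply Ccont_chcos. }
    rewrite <- E; eapply Rle_trans; [apply (half_line_int_spec T _ _ _ HT Dphi)|].
    replace (64 / sg ^ 2 * Cmod h ^ 2 / (sg / 2)) with (128 / sg ^ 3 * Cmod h ^ 2) by (field; lra).
    apply Rmult_le_compat_r; [apply pow2_ge_0|lra].
Qed.

(** * Meromorphic continuation *)

Lemma UF_cst (c s0 : C) : UF (fun _ _ => c) s0.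
Proof. apply (UF_const (fun _ => c) (Cmod c)); intros; lra. Qed.

Lemma UF_inv_fun (f : C -> C) (s0 : C) : f s0 <> 0 -> UF (fun _ => f) s0 ->
  UF (fun _ s => / f s)%C s0.
Proof.
  intros H; apply (UF_inv (fun _ => f) s0 (Cmod (f s0))); [now apply Cmod_gt_0|intros; lra].
Qed.

Lemma UF_rf (f : C -> C) (n : nat) (s0 : C) : UF (fun _ => f) s0 -> UF (fun _ s => rf (f s) n) s0.
Proof.
  intros Hf; induction n as [|n IH]; [apply (UF_cst (RtoC 1))|].
  apply (UF_mult (fun _ s => rf (f s) n) (fun _ s => f s + RtoC (INR n))%C); auto.
  apply (UF_plus (fun _ => f) (fun _ _ => RtoC (INR n))); auto; apply UF_cst.
Qed.

Lemma UF_cpow_half (x : R) (s0 : C) : UF (fun _ s => cpow_pos x (s / 2)) s0.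
Proof.
  apply (UF_ext (fun _ s => Cexp (s * (/ 2 * RtoC (ln x))))); [|apply UF_Cexp].
  intros _ s; unfold cpow_pos; f_equal; unfold Cdiv; ring.
Qed.

Lemma eventually_lower_bound (x : nat -> R) (c : R) (N : nat) : 0 < c ->
  (forall m, 0 < x m) -> (forall m, (N <= m)%nat -> c <= x m) ->
  exists c', 0 < c' /\ forall m, c' <= x m.
Proof.
  revert c; induction N as [|N IH]; intros c Hc Hx H.
  - exists c; split; auto; intros m; apply H; lia.
  - apply (IH (Rmin c (x N))); auto; [now apply Rmin_pos|].
    intros m Hm; destruct (Nat.eq_dec m N) as [->|Hn]; [apply Rmin_r|].
    eapply Rle_trans; [apply Rmin_l|apply H; lia].
Qed.

(* Quadratic factor [(a+j)(b+j)] of the recurrence, normalised to stay bounded in [m]. *)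
Definition qfactor (f : R) (m j : nat) (s : C) : C :=
  ((apar s (INR m * f) + RtoC (INR j)) * (bpar s (INR m * f) + RtoC (INR j))
   * RtoC (/ (1 + INR m ^ 2)))%C.

Lemma qfactor_expand (f : R) (m j : nat) (s : C) : qfactor f m j s =
  (RtoC (/ (4 * (1 + INR m ^ 2))) * ((s + RtoC (2 * INR j)) * (s + RtoC (2 * INR j)))
   + RtoC ((INR m * f) ^ 2 / (4 * (1 + INR m ^ 2))))%C.
Proof.
  assert (P := pow2_ge_0 (INR m)).
  unfold qfactor; rewrite apar_bpar_mult.
  replace (/ (4 * (1 + INR m ^ 2))) with (/ 4 * / (1 + INR m ^ 2)) by (field; lra).
  replace ((INR m * f) ^ 2 / (4 * (1 + INR m ^ 2)))
    with (INR m * f * (INR m * f) * (/ 4 * / (1 + INR m ^ 2))) by (field; lra).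
  rewrite !RtoC_mult, (RtoC_inv 4) by lra; unfold Cdiv; ring.
Qed.

(** For large m the term (m f)^2 dominates: it exceeds |z|^2 by at least 3/4 of itself, where z = s
    + 2j, and 1 + m^2 <= 2 m^2, which gives 3 f^2/32 >= f^2/16. *)
Lemma qfactor_lower (f : R) (m j : nat) (s : C) : 0 < f -> (1 <= m)%nat ->
  2 * Cmod (s + RtoC (2 * INR j))%C <= INR m * f -> f ^ 2 / 16 <= Cmod (qfactor f m j s).
Proof.
  intros Hf Hm H; apply le_INR in Hm; simpl (INR 1) in Hm.
  rewrite qfactor_expand.
  set (z := (s + RtoC (2 * INR j))%C) in *; set (x := INR m) in *.
  assert (Pz := Cmod_ge_0 z).
  assert (D : 0 < 4 * (1 + x ^ 2)) by (assert (Q := pow2_ge_0 x); lra).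
  assert (Di : 0 < / (4 * (1 + x ^ 2))) by now apply Rinv_0_lt_compat.
  assert (T := Cmod_triangle_inv (RtoC ((x * f) ^ 2 / (4 * (1 + x ^ 2))))
    (- (RtoC (/ (4 * (1 + x ^ 2))) * (z * z)))%C).
  replace (RtoC ((x * f) ^ 2 / (4 * (1 + x ^ 2))) - - (RtoC (/ (4 * (1 + x ^ 2))) * (z * z)))%C
    with (RtoC (/ (4 * (1 + x ^ 2))) * (z * z) + RtoC ((x * f) ^ 2 / (4 * (1 + x ^ 2))))%C in T by ring.
  rewrite Cmod_opp, !Cmod_mult, !Cmod_R, !Rabs_pos_eq in T.
  2: lra.
  2: apply Rdiv_le_0_compat; [apply pow2_ge_0|lra].
  eapply Rle_trans; [|apply T].
  replace ((x * f) ^ 2 / (4 * (1 + x ^ 2)) - / (4 * (1 + x ^ 2)) * (Cmod z * Cmod z))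
    with (((x * f) ^ 2 - Cmod z * Cmod z) / (4 * (1 + x ^ 2))) by (field; lra).
  apply Rmult_le_reg_r with (4 * (1 + x ^ 2)); auto.
  unfold Rdiv at 2; rewrite Rmult_assoc, Rinv_l, Rmult_1_r by lra.
  assert (E1 : 4 * (Cmod z * Cmod z) <= (x * f) ^ 2).
  { replace (4 * (Cmod z * Cmod z)) with ((2 * Cmod z) * (2 * Cmod z)) by ring.
    simpl; rewrite Rmult_1_r; apply Rmult_le_compat; lra. }
  assert (E2 : f ^ 2 <= (x * f) ^ 2).
  { rewrite Rpow_mult_distr; assert (Q := pow2_ge_0 f); assert (1 <= x ^ 2) by (simpl; nra); nra. }
  assert (E3 : (x * f) ^ 2 = x ^ 2 * f ^ 2) by apply Rpow_mult_distr.
  nra.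
Qed.

(** [qfactor_lower] bounds all but finitely many factors away from zero, and nonvanishing at [s0]
    handles the others. [act] selects the modes kept; a dropped mode gets the value 1, so that its
    factor may vanish without spoiling uniformity. *)
Lemma UF_qfactor_inv (act : nat -> bool) (f : R) (j : nat) (s0 : C) : 0 < f ->
  (forall m, act m = true -> qfactor f m j s0 <> 0) ->
  UF (fun m s => if act m then / qfactor f m j s else 1)%C s0.
Proof.
  intros Hf Hnz.
  set (al := fun m => if act m then / (4 * (1 + INR m ^ 2)) else 0).
  set (be := fun m => if act m then (INR m * f) ^ 2 / (4 * (1 + INR m ^ 2)) else 1).
  set (F := fun m s => (RtoC (al m) * ((s + RtoC (2 * INR j)) * (s + RtoC (2 * INR j)))
    + RtoC (be m))%C).
  assert (E : forall m s, F m s = if act m then qfactor f m j s else 1%C).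
  { intros m s; unfold F, al, be; destruct (act m); [now rewrite qfactor_expand|ring]. }
  apply (UF_ext (fun m s => / F m s)%C).
  { intros m s; rewrite E; destruct (act m); auto.
    apply C_ext; simpl; field. }
  assert (UFF : UF F s0).
  { assert (Lin : UF (fun _ s => s + RtoC (2 * INR j))%C s0).
    { apply (UF_plus (fun _ s => s) (fun _ _ => RtoC (2 * INR j))); [apply UF_id|apply UF_cst]. }
    apply (UF_plus (fun m s => RtoC (al m) * ((s + RtoC (2 * INR j)) * (s + RtoC (2 * INR j))))%C
      (fun m _ => RtoC (be m))).
    - apply (UF_mult (fun m _ => RtoC (al m))
        (fun _ s => (s + RtoC (2 * INR j)) * (s + RtoC (2 * INR j)))%C).
      + apply UF_const with 1; intros m; unfold al; rewrite Cmod_R.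
        destruct (act m); [|rewrite Rabs_R0; lra].
        assert (Q := pow2_ge_0 (INR m)).
        rewrite Rabs_pos_eq by (left; apply Rinv_0_lt_compat; lra).
        rewrite <- Rinv_1; apply Rinv_le_contravar; lra.
      + apply (UF_mult (fun _ s => s + RtoC (2 * INR j))%C
          (fun _ s => s + RtoC (2 * INR j))%C); apply Lin.
    - apply UF_const with (f ^ 2 + 1); intros m; unfold be; rewrite Cmod_R.
      assert (Q := pow2_ge_0 (INR m)); assert (Q' := pow2_ge_0 f).
      destruct (act m); [|rewrite Rabs_R1; lra].
      rewrite Rabs_pos_eq by (apply Rdiv_le_0_compat; [apply pow2_ge_0|lra]).
      apply Rmult_le_reg_r with (4 * (1 + INR m ^ 2)); [lra|].
      unfold Rdiv; rewrite Rmult_assoc, Rinv_l, Rmult_1_r, Rpow_mult_distr by lra; nra. }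
  destruct (nfloor_ex (2 * Cmod (s0 + RtoC (2 * INR j))%C / f)) as [N [_ HN]].
  { apply Rdiv_le_0_compat; auto; assert (Q := Cmod_ge_0 (s0 + RtoC (2 * INR j))%C); lra. }
  destruct (eventually_lower_bound (fun m => Cmod (F m s0)) (Rmin 1 (f ^ 2 / 16)) (S N))
    as [c [Hc Hlow]].
  - apply Rmin_pos; [lra|apply Rdiv_lt_0_compat; [apply pow_lt; auto|lra]].
  - intros m; apply Cmod_gt_0; rewrite E; destruct (act m) eqn:Em; auto.
    apply RtoC_neq0; lra.
  - intros m Hm; rewrite E; destruct (act m); [|rewrite Cmod_1; apply Rmin_l].
    eapply Rle_trans; [apply Rmin_r|]; apply qfactor_lower; auto; [lia|].
    apply le_INR in Hm; rewrite S_INR in Hm.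
    assert (X : 2 * Cmod (s0 + RtoC (2 * INR j))%C / f < INR m) by lra.
    apply Rmult_lt_compat_r with (r := f) in X; auto.
    unfold Rdiv in X; rewrite Rmult_assoc, Rinv_l in X; lra.
  - now apply (UF_inv F s0 c).
Qed.

Fixpoint qprod_inv (act : nat -> bool) (f : R) (N m : nat) (s : C) : C :=
  match N with
  | O => 1
  | S j => qprod_inv act f j m s * (if act m then / qfactor f m j s else 1)
  end%C.

Lemma UF_qprod_inv (act : nat -> bool) (f : R) (N : nat) (s0 : C) : 0 < f ->
  (forall m j, (j < N)%nat -> act m = true -> qfactor f m j s0 <> 0) ->
  UF (qprod_inv act f N) s0.
Proof.
  intros Hf; induction N as [|N IH]; intros H; [apply (UF_cst (RtoC 1))|].
  apply (UF_mult (qprod_inv act f N)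
    (fun m s => if act m then / qfactor f m N s else 1)%C).
  - apply IH; intros; apply H; auto; lia.
  - apply UF_qfactor_inv; auto; intros; apply H; auto; lia.
Qed.

(* The [m]-th term of the continued series, up to the factor [4 / Gamma (s + 2 N)]. *)
Definition cont_term (L : R) (N m : nat) (s : C) : C :=
  (chcos_int (2 * L) (s + RtoC (2 * INR N)) (INR m * freq L)
   * / (rf (apar s (INR m * freq L)) N * rf (bpar s (INR m * freq L)) N))%C.

Lemma qprod_inv_rf (act : nat -> bool) (f : R) (N m : nat) (s : C) : act m = true ->
  (/ (rf (apar s (INR m * f)) N * rf (bpar s (INR m * f)) N)
   = RtoC ((/ (1 + INR m ^ 2)) ^ N) * qprod_inv act f N m s)%C.
Proof.
  intros Hm; induction N as [|N IH].
  - simpl; apply C_ext; simpl; field.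
  - change (rf (apar s (INR m * f)) (S N)) with
      (rf (apar s (INR m * f)) N * (apar s (INR m * f) + RtoC (INR N)))%C.
    change (rf (bpar s (INR m * f)) (S N)) with
      (rf (bpar s (INR m * f)) N * (bpar s (INR m * f) + RtoC (INR N)))%C.
    rewrite !Cinv_mult_total.
    transitivity (/ (rf (apar s (INR m * f)) N * rf (bpar s (INR m * f)) N)
      * (/ (apar s (INR m * f) + RtoC (INR N)) * / (bpar s (INR m * f) + RtoC (INR N))))%C.
    { rewrite Cinv_mult_total; ring. }
    rewrite IH; simpl qprod_inv; rewrite Hm; simpl pow.
    assert (P : 0 < 1 + INR m ^ 2) by (assert (Q := pow2_ge_0 (INR m)); lra).
    assert (Pi : 0 < / (1 + INR m ^ 2)) by now apply Rinv_0_lt_compat.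
    unfold qfactor; rewrite !Cinv_mult_total, RtoC_mult.
    set (y := / (1 + INR m * (INR m * 1))) in *.
    assert (E : (RtoC y * / RtoC y = 1)%C) by (apply Cinv_r, RtoC_neq0; apply Rgt_not_eq, Pi).
    change (/ (1 + INR m ^ 2)) with y.
    transitivity (RtoC (y ^ N) * qprod_inv act f N m s *
      (/ (apar s (INR m * f) + RtoC (INR N)) * / (bpar s (INR m * f) + RtoC (INR N)))
      * (RtoC y * / RtoC y))%C; [rewrite E; ring|ring].
Qed.

(** The powers of 1/(1 + m^2) taken out of the N normalised quadratic factors become the
    coefficients, summable as soon as N >= 1. *)
Definition act_coef (act : nat -> bool) (N m : nat) : R :=
  if act m then mode_weight m * (/ (1 + INR m ^ 2)) ^ N else 0.

Lemma Rabs_mode_weight (m : nat) : Rabs (mode_weight m) <= 2.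
Proof.
  destruct m as [|m]; unfold mode_weight; [rewrite Rabs_R1; lra|].
  rewrite Rabs_mult, pow_1_abs, Rabs_pos_eq; lra.
Qed.

Lemma act_coef_summable (act : nat -> bool) (N : nat) : (1 <= N)%nat ->
  ex_series (fun m => Rabs (act_coef act N m)).
Proof.
  intros HN.
  apply (ex_series_le (V := R_CompleteNormedModule)) with (fun m => scal 4 (/ (INR m + 1) ^ 2)).
  2: apply (ex_series_scal (V := R_NormedModule)), ex_series_inv_sqr.
  intros m; change (Rabs (Rabs (act_coef act N m)) <= 4 * / (INR m + 1) ^ 2).
  rewrite Rabs_Rabsolu; assert (P := pos_INR m).
  assert (Q : 0 < / (INR m + 1) ^ 2) by (apply Rinv_0_lt_compat; nra).
  unfold act_coef; destruct (act m); [|rewrite Rabs_R0; lra].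
  rewrite Rabs_mult.
  set (y := / (1 + INR m ^ 2)).
  assert (Hy : 0 < y <= 1).
  { unfold y; split; [apply Rinv_0_lt_compat; nra|].
    rewrite <- Rinv_1; apply Rinv_le_contravar; nra. }
  assert (HyN : 0 <= y ^ N <= y).
  { destruct N as [|N]; [lia|]; simpl.
    assert (0 <= y ^ N <= 1).
    { split; [apply pow_le; lra|]. rewrite <- (pow1 N); apply pow_incr; lra. }
    nra. }
  rewrite (Rabs_pos_eq (y ^ N)) by lra.
  assert (W := Rabs_mode_weight m); assert (W' := Rabs_pos (mode_weight m)).
  assert (Hy2 : y <= 2 * / (INR m + 1) ^ 2).
  { unfold y; replace (2 * / (INR m + 1) ^ 2) with (/ ((INR m + 1) ^ 2 / 2)) by (field; lra).
    apply Rinv_le_contravar; [nra|assert (0 <= (INR m - 1) ^ 2) by apply pow2_ge_0; nra]. }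
  nra.
Qed.

Definition act_sum (L : R) (act : nat -> bool) (N : nat) (s : C) : C :=
  CSeries (fun m => RtoC (act_coef act N m)
    * (chcos_int (2 * L) (s + RtoC (2 * INR N)) (INR m * freq L)
       * qprod_inv act (freq L) N m s))%C.

Lemma act_sum_UF (L : R) (act : nat -> bool) (N : nat) (s0 : C) :
  0 < L -> (1 <= N)%nat -> 0 < Re s0 + 2 * INR N ->
  (forall m j, (j < N)%nat -> act m = true -> qfactor (freq L) m j s0 <> 0) ->
  UF (fun _ => act_sum L act N) s0 /\
  exists delta, 0 < delta /\ forall h, Cmod h < delta ->
    CIs (fun m => if act m then RtoC (mode_weight m) * cont_term L N m (s0 + h) else 0)%C
      (act_sum L act N (s0 + h)%C).
Proof.
  intros HL HN Hs Hq.
  destruct (UF_sum (fun m s => chcos_int (2 * L) (s + RtoC (2 * INR N)) (INR m * freq L)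
      * qprod_inv act (freq L) N m s)%C (act_coef act N) s0) as [H1 (delta & Hd & H2)].
  - now apply act_coef_summable.
  - apply (UF_mult (fun m s => chcos_int (2 * L) (s + RtoC (2 * INR N)) (INR m * freq L))
      (qprod_inv act (freq L) N)).
    + apply (UF_chcos_int (2 * L) (RtoC (2 * INR N)) s0 (fun m => INR m * freq L)); [lra|].
      rewrite Re_plus_INR; auto.
    + apply UF_qprod_inv; auto using freq_pos.
  - split; [exact H1|]; exists delta; split; auto; intros h Hh.
    eapply CIs_ext; [|apply (H2 h Hh)]; intros m; unfold act_coef, cont_term.
    destruct (act m) eqn:Em; [|ring].
    rewrite (qprod_inv_rf act _ _ _ _ Em), RtoC_mult; ring.
Qed.

(** The integral formula is applied at s + 2N, where the real part is positive, and the functional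
    equation of 1/Gamma descends N steps in each argument. At a pole of a Gamma factor both sides
    are 0. *)
Lemma CGamma_mult (L : R) (N m : nat) (s : C) : 0 < L -> 0 < Re s + 2 * INR N ->
  (CGamma (apar s (INR m * freq L)) * CGamma (bpar s (INR m * freq L))
   = 4 * / rGamma (s + RtoC (2 * INR N)) * cont_term L N m s)%C.
Proof.
  intros HL Hs; set (w := INR m * freq L); set (t := (s + RtoC (2 * INR N))%C).
  assert (Ht : 0 < Re t) by (unfold t; rewrite Re_plus_INR; auto).
  assert (G := chcos_int_gamma (2 * L) t w ltac:(lra) Ht); unfold gamma_formula in G.
  assert (Na : rGamma (apar t w) <> 0).
  { apply gauss_limit, nonpole_pos; unfold apar; simpl; unfold Re in Ht; simpl in Ht; lra. }
  assert (Nb : rGamma (bpar t w) <> 0).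
  { apply gauss_limit, nonpole_pos; unfold bpar; simpl; unfold Re in Ht; simpl in Ht; lra. }
  assert (Ns : rGamma t <> 0) by now apply gauss_limit, nonpole_pos.
  unfold CGamma, cont_term; fold w t.
  rewrite (rGamma_rf (apar s w) N), (rGamma_rf (bpar s w) N), apar_shift, bpar_shift; fold t.
  replace (chcos_int (2 * L) t w) with (rGamma t / 4 * / (rGamma (apar t w) * rGamma (bpar t w)))%C
    by (rewrite <- G; field; auto).
  rewrite !Cinv_mult_total.
  set (u := (/ rf (apar s w) N)%C); set (v := (/ rf (bpar s w) N)%C).
  field; repeat split; auto; apply RtoC_neq0; lra.
Qed.

(** * Folding the sum over all integers *)

Lemma sgnZ_of_nat (m : nat) : sgnZ (Z.of_nat m) = RtoC ((-1) ^ m).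
Proof.
  induction m as [|m IH]; [reflexivity|].
  replace (RtoC ((-1) ^ S m)) with (- RtoC ((-1) ^ m))%C
    by (rewrite <- RtoC_opp; f_equal; simpl; ring).
  rewrite <- IH, Nat2Z.inj_succ; unfold sgnZ; rewrite Z.even_succ, <- Z.negb_even.
  destruct (Z.even (Z.of_nat m)); simpl; apply C_ext; simpl; ring.
Qed.

Lemma sgnZ_opp (z : Z) : sgnZ (- z) = sgnZ z.
Proof. unfold sgnZ; now rewrite Z.even_opp. Qed.

Lemma Zterm_of_nat (eps : R) (s : C) (m : nat) : 1 < eps ->
  Zterm eps s (Z.of_nat m) = (RtoC ((-1) ^ m)
    * (CGamma (apar s (INR m * freq (ln eps))) * CGamma (bpar s (INR m * freq (ln eps)))))%C.
Proof.
  intros He; assert (HL : 0 < ln eps) by (rewrite <- ln_1; apply ln_increasing; lra).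
  unfold Zterm, apar, bpar; rewrite sgnZ_of_nat, <- INR_IZR_INZ.
  replace (PI * INR m / (2 * ln eps)) with (INR m * freq (ln eps) / 2)
    by (unfold freq; field; lra).
  ring.
Qed.

Lemma Zterm_opp (eps : R) (s : C) (z : Z) : Zterm eps s (- z) = Zterm eps s z.
Proof.
  unfold Zterm; rewrite sgnZ_opp, opp_IZR.
  replace (PI * - IZR z / (2 * ln eps)) with (- (PI * IZR z / (2 * ln eps)))
    by (unfold Rdiv; ring).
  rewrite RtoC_opp.
  replace (s / 2 + Ci * - RtoC (PI * IZR z / (2 * ln eps)))%C
    with (s / 2 - Ci * RtoC (PI * IZR z / (2 * ln eps)))%C by ring.
  replace (s / 2 - Ci * - RtoC (PI * IZR z / (2 * ln eps)))%C
    with (s / 2 + Ci * RtoC (PI * IZR z / (2 * ln eps)))%C by ring.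
  ring.
Qed.

Lemma CIs_single (k : nat) (c : C) : CIs (fun m => if Nat.eqb m k then c else RtoC 0) c.
Proof.
  apply CIs_Clim, Clim_ext_loc with (fun _ => c) k; [|apply Clim_const].
  assert (Z : forall n, (n < k)%nat ->
    sum_n (G := C_AbelianMonoid) (fun m => if Nat.eqb m k then c else RtoC 0) n = RtoC 0).
  { induction n as [|n IH]; intros Hn.
    - rewrite sum_O; destruct (Nat.eqb_spec 0 k); auto; lia.
    - rewrite sum_Sn, IH by lia; destruct (Nat.eqb_spec (S n) k); [lia|].
      apply Cplus_0_l. }
  intros n Hn; induction Hn as [|n Hn IH].
  - destruct k as [|k]; [rewrite sum_O; reflexivity|].
    rewrite sum_Sn, Z, Nat.eqb_refl by lia; symmetry; apply Cplus_0_l.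
  - rewrite sum_Sn, <- IH; destruct (Nat.eqb_spec (S n) k); [lia|].
    symmetry; apply Cplus_0_r.
Qed.

Lemma is_zsum_even (g : Z -> C) (c : C) (u : nat -> C) (S0 : C) :
  (forall z, g (- z)%Z = g z) ->
  (forall m, g (Z.of_nat m) = c * (RtoC ((-1) ^ m) * u m))%C ->
  CIs (fun m => RtoC (mode_weight m) * u m)%C S0 ->
  is_zsum g (zsum g) /\ zsum g = (c * S0)%C.
Proof.
  intros Hev Hg HS.
  set (t := fun m : nat => g (Z.of_nat m)).
  (* [c * S0] counts the index 0 once and every other index twice; adding [t O] gives twice the
     one-sided sum. *)
  assert (Ht : CIs t ((c * S0 + t O) / 2)%C).
  { assert (H := CIs_scal (/ 2)%C _ _ (CIs_plus _ _ _ _ (CIs_scal c _ _ HS) (CIs_single O (t O)))).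
    replace ((c * S0 + t O) / 2)%C with (/ 2 * (c * S0 + t O))%C by (unfold Cdiv; ring).
    eapply CIs_ext; [|exact H]; intros m; unfold t; cbv beta; rewrite (Hg m).
    assert (N : RtoC 2 <> 0) by (apply RtoC_neq0; lra).
    destruct m as [|m]; unfold mode_weight; simpl Nat.eqb; cbv iota.
    - rewrite (Hg O); change ((-1) ^ 0) with 1; field; auto.
    - rewrite RtoC_mult; set (e := RtoC ((-1) ^ S m)); field; auto. }
  assert (Ht' : CIs (fun m : nat => g (- Z.of_nat (S m))%Z) ((c * S0 + t O) / 2 - t O)%C).
  { eapply CIs_ext; [|apply CIs_incr_1, Ht]; intros m; symmetry; apply Hev. }
  assert (E : zsum g = ((c * S0 + t O) / 2 + ((c * S0 + t O) / 2 - t O))%C).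
  { unfold zsum; f_equal; now apply CIs_CSeries. }
  split.
  - exists ((c * S0 + t O) / 2)%C, ((c * S0 + t O) / 2 - t O)%C; repeat split; auto.
  - rewrite E; field; apply RtoC_neq0; lra.
Qed.

(** The prefactor 1/Gamma(s) = (s)_{2N} / Gamma(s + 2N) cancels the factor 4 Gamma(s + 2N) common to
    all terms, and 8 becomes 2. *)
Lemma Zodd_RHS_cont (D : Z) (eps : R) (N : nat) (s S0 : C) : 1 < eps ->
  0 < Re s + 2 * INR N ->
  CIs (fun m => RtoC (mode_weight m) * cont_term (ln eps) N m s)%C S0 ->
  is_zsum (Zterm eps s) (zsum (Zterm eps s)) /\
  Zodd_RHS D eps s
  = (cpow_pos (IZR (qD D)) (s / 2) / RtoC (2 * ln eps) * (rf s (2 * N) * S0))%C.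
Proof.
  intros He Hs HS.
  assert (HL : 0 < ln eps) by (rewrite <- ln_1; apply ln_increasing; lra).
  set (t := (s + RtoC (2 * INR N))%C).
  assert (Ht : 0 < Re t) by (unfold t; rewrite Re_plus_INR; auto).
  assert (Ns : rGamma t <> 0) by now apply gauss_limit, nonpole_pos.
  destruct (is_zsum_even (Zterm eps s) (4 * / rGamma t)%C (fun m => cont_term (ln eps) N m s) S0)
    as [H1 H2]; auto.
  - intros z; apply Zterm_opp.
  - intros m; rewrite Zterm_of_nat, (CGamma_mult (ln eps) N m s HL Hs) by auto; fold t; ring.
  - split; auto; unfold Zodd_RHS; rewrite H2, (rGamma_rf s (2 * N)).
    replace (RtoC (INR (2 * N))) with (RtoC (2 * INR N))
      by (rewrite mult_INR; f_equal; simpl; ring).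
    fold t.
    replace (RtoC (8 * ln eps)) with (4 * RtoC (2 * ln eps))%C
      by (rewrite <- RtoC_mult; f_equal; ring).
    field; repeat split; auto; apply RtoC_neq0; lra.
Qed.

(** * Holomorphy off the pole set and agreement with the Dirichlet series *)

Definition act_all (m : nat) : bool := true.

Lemma qfactor_neq0 (f : R) (m j : nat) (s : C) :
  (apar s (INR m * f) + RtoC (INR j) <> 0)%C -> (bpar s (INR m * f) + RtoC (INR j) <> 0)%C ->
  qfactor f m j s <> 0.
Proof.
  intros Ha Hb; unfold qfactor; repeat apply Cmult_neq_0; auto.
  assert (P := pow2_ge_0 (INR m)).
  apply RtoC_neq0, Rinv_neq_0_compat; lra.
Qed.

Lemma apar_eq (s : C) (w x : R) : (apar s w + RtoC x = 0)%C -> s = (- 2 * x, - w).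
Proof.
  intros H; unfold apar in H; assert (A := f_equal Re H); assert (B := f_equal Im H).
  destruct s as [u v]; simpl in A, B; f_equal; lra.
Qed.

Lemma bpar_eq (s : C) (w x : R) : (bpar s w + RtoC x = 0)%C -> s = (- 2 * x, w).
Proof.
  intros H; unfold bpar in H; assert (A := f_equal Re H); assert (B := f_equal Im H).
  destruct s as [u v]; simpl in A, B; f_equal; lra.
Qed.

Lemma not_in_pole_set_qfactor (eps : R) (s : C) (m j : nat) : 1 < eps ->
  ~ in_pole_set eps s -> qfactor (freq (ln eps)) m j s <> 0.
Proof.
  intros He Hs; assert (HL : 0 < ln eps) by (rewrite <- ln_1; apply ln_increasing; lra).
  apply qfactor_neq0; intros E; apply Hs; exists j.
  - exists (- Z.of_nat m)%Z; rewrite (apar_eq _ _ _ E), opp_IZR, <- INR_IZR_INZ.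
    f_equal; unfold freq; field; lra.
  - exists (Z.of_nat m)%Z; rewrite (bpar_eq _ _ _ E), <- INR_IZR_INZ.
    f_equal; unfold freq; field; lra.
Qed.

Lemma exists_shift (s : C) : exists N : nat, (1 <= N)%nat /\ 0 < Re s + 2 * INR N.
Proof.
  destruct (nfloor_ex (Rabs (Re s)) (Rabs_pos _)) as [n [_ Hn]].
  exists (S n); split; [lia|]; rewrite S_INR.
  assert (P := pos_INR n); apply Rabs_def2 in Hn; lra.
Qed.

(** Differentiability needs one formula, with one N, on a whole disc. Only the centre is assumed off
    the pole set; the radius also keeps Re s + 2N positive. *)
Lemma Zodd_RHS_local (D : Z) (eps : R) (s0 : C) (N : nat) : 1 < eps -> (1 <= N)%nat ->
  0 < Re s0 + 2 * INR N -> ~ in_pole_set eps s0 ->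
  UF (fun _ => act_sum (ln eps) act_all N) s0 /\
  exists delta, 0 < delta /\ forall h : C, Cmod h < delta ->
    let s := (s0 + h)%C in
    CIs (fun m => RtoC (mode_weight m) * cont_term (ln eps) N m s)%C
      (act_sum (ln eps) act_all N s) /\
    is_zsum (Zterm eps s) (zsum (Zterm eps s)) /\
    Zodd_RHS D eps s = (cpow_pos (IZR (qD D)) (s / 2) / RtoC (2 * ln eps)
      * (rf s (2 * N) * act_sum (ln eps) act_all N s))%C.
Proof.
  intros He HN Hs Hp.
  assert (HL : 0 < ln eps) by (rewrite <- ln_1; apply ln_increasing; lra).
  destruct (act_sum_UF (ln eps) act_all N s0 HL HN Hs) as [H1 (delta & Hd & H2)].
  { intros; now apply not_in_pole_set_qfactor. }
  split; auto; exists (Rmin delta (Re s0 + 2 * INR N)); split; [now apply Rmin_pos|].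
  intros h Hh s.
  assert (Hh1 : Cmod h < delta) by (eapply Rlt_le_trans; [apply Hh|apply Rmin_l]).
  assert (Hh2 : Cmod h < Re s0 + 2 * INR N) by (eapply Rlt_le_trans; [apply Hh|apply Rmin_r]).
  assert (I := H2 h Hh1); unfold act_all in I at 1; cbv iota in I; split; auto.
  apply Zodd_RHS_cont; auto.
  assert (R := re_le_Cmod h); apply Rabs_le_between in R.
  change (0 < Re s0 + Re h + 2 * INR N); lra.
Qed.

Lemma Zterm_summable (eps : R) (s : C) : 1 < eps -> ~ in_pole_set eps s ->
  is_zsum (Zterm eps s) (zsum (Zterm eps s)).
Proof.
  intros He Hs; destruct (exists_shift s) as (N & HN & Hr).
  (* Only the convergence of the sum is extracted, and it does not involve the discriminant; 0 is a
     placeholder. *)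
  destruct (Zodd_RHS_local 0 eps s N He HN Hr Hs) as [_ (delta & Hd & H)].
  specialize (H 0%C); rewrite Cmod_0 in H; specialize (H Hd); cbv zeta in H.
  rewrite Cplus_0_r in H; apply H.
Qed.

Lemma UF_prefactor (D : Z) (L : R) (s0 : C) :
  UF (fun _ s => cpow_pos (IZR (qD D)) (s / 2) / RtoC (2 * L))%C s0.
Proof.
  apply (UF_mult (fun _ s => cpow_pos (IZR (qD D)) (s / 2)) (fun _ _ => / RtoC (2 * L))%C);
    [apply UF_cpow_half|apply UF_cst].
Qed.

Lemma Zodd_RHS_holomorphic (D : Z) (eps : R) (s0 : C) : 1 < eps -> ~ in_pole_set eps s0 ->
  ex_derive (K := C_AbsRing) (V := C_NormedModule) (Zodd_RHS D eps) s0.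
Proof.
  intros He Hs; destruct (exists_shift s0) as (N & HN & Hr).
  destruct (Zodd_RHS_local D eps s0 N He HN Hr Hs) as [HU (delta & Hd & H)].
  apply (UF_ex_derive_loc _ (fun s => cpow_pos (IZR (qD D)) (s / 2) / RtoC (2 * ln eps)
    * (rf s (2 * N) * act_sum (ln eps) act_all N s))%C s0 delta Hd).
  { intros h Hh; apply (H h Hh). }
  apply (UF_mult (fun _ s => cpow_pos (IZR (qD D)) (s / 2) / RtoC (2 * ln eps))%C
    (fun _ s => rf s (2 * N) * act_sum (ln eps) act_all N s)%C); [apply UF_prefactor|].
  apply (UF_mult (fun _ s => rf s (2 * N)) (fun _ => act_sum (ln eps) act_all N)); auto.
  apply UF_rf, UF_id.
Qed.

Lemma not_in_pole_set_pos (eps : R) (s : C) : 0 < Re s -> ~ in_pole_set eps s.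
Proof.
  intros H (k & m & E); rewrite E in H; simpl in H; assert (P := pos_INR k); lra.
Qed.

(** N = 1 suffices: one step of the recurrence gives the modes the decay 1/m^2 that Poisson
    summation asks for. The continued terms are converted back to the original integrals, as the
    rising factorials do not vanish for Re s > 0. *)
Lemma Zodd_RHS_dirichlet (D : Z) (eps : R) (s : C) : 1 < eps -> 0 < Re s ->
  CIs (fun n => cpow_pos (IZR (qD D)) (s / 2) * chpow s ((2 * INR n + 1) * ln eps))%C
    (Zodd_RHS D eps s).
Proof.
  intros He Hs; assert (HL : 0 < ln eps) by (rewrite <- ln_1; apply ln_increasing; lra).
  assert (Hp := not_in_pole_set_pos eps s Hs).
  destruct (Zodd_RHS_local D eps s 1 He (le_n 1) ltac:(simpl; lra) Hp) as [_ (delta & Hd & H)].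
  specialize (H 0%C); rewrite Cmod_0 in H; specialize (H Hd); cbv zeta in H.
  rewrite Cplus_0_r in H; destruct H as (I & _ & E).
  rewrite E; set (S0 := act_sum (ln eps) act_all 1 s) in *.
  assert (M : CIs (mode (ln eps) s) (rf s (2 * 1) * S0)%C).
  { eapply CIs_ext; [|apply CIs_scal, I]; intros m; unfold mode, cont_term.
    set (w := INR m * freq (ln eps)).
    assert (R := chcos_int_rf (2 * ln eps) s w 1 ltac:(lra) Hs).
    assert (Na : rf (apar s w) 1 <> 0).
    { apply rf_neq0; intros k _; apply nonpole_pos; unfold apar; simpl; unfold Re in Hs; lra. }
    assert (Nb : rf (bpar s w) 1 <> 0).
    { apply rf_neq0; intros k _; apply nonpole_pos; unfold bpar; simpl; unfold Re in Hs; lra. }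
    transitivity (RtoC (mode_weight m) * (rf s (2 * 1) * chcos_int (2 * ln eps) (s + RtoC (2 * INR 1)) w
      * / (rf (apar s w) 1 * rf (bpar s w) 1)))%C; [ring|].
    rewrite <- R; field; auto. }
  assert (P := CIs_scal (cpow_pos (IZR (qD D)) (s / 2)) _ _ (poisson_chpow (ln eps) s _ HL Hs M)).
  match type of P with CIs _ ?x => replace (cpow_pos (IZR (qD D)) (s / 2) / RtoC (2 * ln eps) *
    (rf s (2 * 1) * S0))%C with x end; [exact P|].
  unfold Cdiv; ring.
Qed.

(* If y = 0, the zero of the Pochhammer symbol at p (that is, of 1/Gamma) compensates one of the
   two factors of the double pole of Gamma(s/2)^2; if y <> 0, then p' <> p and nothing vanishes. *)
Lemma rf_odd_factor (p p' : C) (k : nat) (y : R) :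
  p = (- 2 * INR k, y) -> p' = (- 2 * INR k, - y) ->
  exists V : C -> C, UF (fun _ => V) p /\ V p <> 0 /\
  exists delta, 0 < delta /\ forall h : C, h <> 0 -> Cmod h < delta ->
    (p + h <> p')%C /\ (rf (p + h) (2 * S k) = (p + h - p') * V (p + h))%C.
Proof.
  intros Ep Ep'; destruct (Req_dec y 0) as [Hy|Hy].
  - assert (E : p' = p) by (rewrite Ep, Ep', Hy; f_equal; ring).
    (* Among the 2k + 2 factors of the rising factorial only s + 2k vanishes at p = -2k; V is the
       product of the others. *)
    exists (fun s => rf s (2 * k) * (s + RtoC (INR (S (2 * k)))))%C; split; [|split].
    + apply (UF_mult (fun _ s => rf s (2 * k)) (fun _ s => s + RtoC (INR (S (2 * k))))%C);
        [apply UF_rf, UF_id|].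
      apply (UF_plus (fun _ s => s) (fun _ _ => RtoC (INR (S (2 * k))))); [apply UF_id|apply UF_cst].
    + apply Cmult_neq_0.
      * apply rf_neq0; intros j Hj H; apply lt_INR in Hj; rewrite mult_INR in Hj.
        apply (f_equal Re) in H; rewrite Ep in H; simpl in H, Hj; lra.
      * intros H; apply (f_equal Re) in H; rewrite Ep, S_INR, mult_INR in H; simpl in H; lra.
    + exists 1; split; [lra|]; intros h Hh _; rewrite E; split.
      * intros H; apply Hh; replace h with (p + h - p)%C by ring; rewrite H; ring.
      * replace (2 * S k)%nat with (S (S (2 * k))) by lia.
        change (rf (p + h) (S (S (2 * k)))) with
          (rf (p + h) (2 * k) * (p + h + RtoC (INR (2 * k))) * (p + h + RtoC (INR (S (2 * k)))))%C.
        assert (E2 : (RtoC (INR (2 * k)) = - p)%C).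
        { rewrite Ep, mult_INR, Hy; apply C_ext; simpl; ring. }
        rewrite E2; ring.
  - assert (Hpp : (p - p' <> 0)%C).
    { intros H; apply (f_equal Im) in H; rewrite Ep, Ep' in H; simpl in H; lra. }
    (* Here p' differs from p, so division by s - p' is harmless inside the radius |p - p'|; the
       rising factorial has only real zeros and p is not real. *)
    exists (fun s => rf s (2 * S k) * / (s - p'))%C; split; [|split].
    + apply (UF_mult (fun _ s => rf s (2 * S k)) (fun _ s => / (s - p'))%C); [apply UF_rf, UF_id|].
      apply UF_inv_fun; auto.
      apply (UF_plus (fun _ s => s) (fun _ _ => - p')%C); [apply UF_id|apply UF_cst].
    + apply Cmult_neq_0.
      * apply rf_neq0; intros j _ H; apply (f_equal Im) in H; rewrite Ep in H; simpl in H; lra.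
      * apply Cmod_gt_0; rewrite Cmod_inv by auto; now apply Rinv_0_lt_compat, Cmod_gt_0.
    + exists (Cmod (p - p')%C); split; [now apply Cmod_gt_0|]; intros h _ Hh.
      assert (N : (p + h - p' <> 0)%C).
      { intros H; replace (p - p')%C with (- h)%C in Hh.
        - rewrite Cmod_opp in Hh; lra.
        - replace h with (p + h - p' - (p - p'))%C by ring; rewrite H; ring. }
      split; [|field; auto].
      intros H; apply N; rewrite H; ring.
Qed.

(** The integrand oscillates, so nonvanishing is read off the Gamma formula: 1/Gamma(s) is not zero
    there. It makes the residues nonzero. *)
Lemma chcos_int_neq0 (T : R) (s : C) (w : R) : 0 < T -> 0 < Re s -> chcos_int T s w <> 0.
Proof.
  intros HT Hs E; assert (G := chcos_int_gamma T s w HT Hs); unfold gamma_formula in G.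
  rewrite E, Cmult_0_l in G.
  assert (N : rGamma s <> 0) by now apply gauss_limit, nonpole_pos.
  apply N; replace (rGamma s) with (rGamma s / 4 * 4)%C by (field; apply RtoC_neq0; lra).
  rewrite <- G; ring.
Qed.

Definition act_except (m0 m : nat) : bool := negb (Nat.eqb m m0).

Lemma Zodd_RHS_simple_pole (D : Z) (eps : R) (k : nat) (mz : Z) : 1 < eps ->
  let p : C := (- 2 * INR k, PI * IZR mz / ln eps)%R in
  exists r : C, r <> RtoC 0 /\
    filterlim (fun s : C => ((s - p) * Zodd_RHS D eps s)%C)
      (locally' (T := C_UniformSpace) p) (locally (T := C_UniformSpace) r).
Proof.
  intros He p; assert (HL : 0 < ln eps) by (rewrite <- ln_1; apply ln_increasing; lra).
  set (L := ln eps) in *; set (f := freq L); assert (Hf : 0 < f) by now apply freq_pos.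
  (* After folding, the indices mz and -mz form the single mode m0, responsible for both p and its
     conjugate p'. *)
  set (m0 := Z.abs_nat mz); set (w := INR m0 * f); set (y := PI * IZR mz / L) in *.
  set (p' := (- 2 * INR k, - y) : C).
  assert (Pk := pos_INR k).
  assert (HN : (1 <= S k)%nat) by lia.
  assert (Hp : 0 < Re p + 2 * INR (S k)) by (rewrite S_INR; simpl; lra).
  assert (Hy : w = y \/ w = - y).
  { unfold w, y, m0, f, freq; rewrite INR_IZR_INZ, Zabs2Nat.id_abs.
    destruct (Z.abs_eq_or_opp mz) as [-> | ->]; [left|right]; try rewrite opp_IZR; field; lra. }
  (* The imaginary part of p determines the frequency up to sign, so no other mode has a vanishing
     quadratic factor at p. *)
  assert (Hmy : forall m, INR m * f = y \/ INR m * f = - y -> m = m0).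
  { intros m Hm; assert (Q := pos_INR m); assert (Q0 := pos_INR m0); fold w in Hy.
    apply INR_eq; apply Rmult_eq_reg_r with f; [|lra]; fold w.
    assert (0 <= INR m * f) by nra; assert (0 <= w) by (unfold w; nra). lra. }
  destruct (act_sum_UF L (act_except m0) (S k) p HL HN Hp) as [HU (d1 & Hd1 & HS)].
  { intros m j _ Hm; unfold act_except in Hm; destruct (Nat.eqb_spec m m0) as [|Hne]; [discriminate|].
    apply qfactor_neq0; intros E; [apply apar_eq in E|apply bpar_eq in E];
      injection E as _ E2; apply Hne, Hmy; fold f in E2; lra. }
  destruct (rf_odd_factor p p' k y eq_refl eq_refl) as (V & HV & HV0 & d2 & Hd2 & HVf).
  (* The quadratic factors of mode m0 with index j < k, which do not vanish at p; the one with j = k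
     is (s - p)(s - p')/4. *)
  set (X := fun s => (rf (apar s w) k * rf (bpar s w) k)%C).
  assert (HX0 : X p <> 0).
  { apply Cmult_neq_0; apply rf_neq0; intros j Hj E; [apply apar_eq in E|apply bpar_eq in E];
      injection E as E1 _; apply lt_INR in Hj; lra. }
  assert (UFX : UF (fun _ => X) p).
  { apply (UF_mult (fun _ s => rf (apar s w) k) (fun _ s => rf (bpar s w) k)); apply UF_rf.
    - apply (UF_plus (fun _ s => s / 2)%C (fun _ _ => Ci * RtoC (w / 2))%C); [|apply UF_cst].
      apply (UF_mult (fun _ s => s) (fun _ _ => / 2)%C); [apply UF_id|apply UF_cst].
    - apply (UF_plus (fun _ s => s / 2)%C (fun _ _ => - (Ci * RtoC (w / 2)))%C); [|apply UF_cst].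
      apply (UF_mult (fun _ s => s) (fun _ _ => / 2)%C); [apply UF_id|apply UF_cst]. }
  set (E0 := fun s => chcos_int (2 * L) (s + RtoC (2 * INR (S k))) w).
  assert (UFE : UF (fun _ => E0) p).
  { apply (UF_chcos_int (2 * L) (RtoC (2 * INR (S k))) p (fun _ => w)); [lra|].
    rewrite Re_plus_INR; auto. }
  (* The 4 comes from the denominator of (s - p)(s - p')/4. *)
  set (c0 := (RtoC (mode_weight m0) * 4)%C).
  assert (Hc0 : c0 <> 0).
  { apply Cmult_neq_0; apply RtoC_neq0; [|lra].
    unfold mode_weight; destruct m0; [lra|].
    apply Rmult_integral_contrapositive; split; [lra|apply pow_nonzero; lra]. }
  set (pre := fun s => (cpow_pos (IZR (qD D)) (s / 2) / RtoC (2 * L))%C).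
  assert (Hpre : pre p <> 0).
  { apply Cmult_neq_0; [apply cpow_pos_neq0|].
    rewrite <- RtoC_inv by lra; apply RtoC_neq0, Rinv_neq_0_compat; lra. }
  (* The regular extension of (s - p) times the continued function: (s - p)(s - p') has been
     cancelled in mode m0, and the other modes keep their factor s - p. Its value at p, the residue,
     comes from mode m0 alone. *)
  set (g := fun s => (pre s * (c0 * E0 s * V s * / X s
    + (s - p) * (rf s (2 * S k) * act_sum L (act_except m0) (S k) s)))%C).
  exists (g p); split.
  - unfold g; replace (p - p)%C with (RtoC 0) by ring; rewrite Cmult_0_l, Cplus_0_r.
    apply Cmult_neq_0; [exact Hpre|].
    apply Cmult_neq_0; [apply Cmult_neq_0; [apply Cmult_neq_0; [exact Hc0|]|exact HV0]|].
    + refine (chcos_int_neq0 (2 * L) (p + RtoC (2 * INR (S k)))%C w _ _); [lra|exact Hp].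
    + apply Cmod_gt_0; rewrite Cmod_inv by auto; now apply Rinv_0_lt_compat, Cmod_gt_0.
  - apply UF_filterlim_loc with (delta := Rmin (Rmin d1 d2) (Re p + 2 * INR (S k))).
    + repeat apply Rmin_pos; auto.
    + intros h Hh0 Hh.
      assert (L1 : Cmod h < Rmin d1 d2) by (eapply Rlt_le_trans; [apply Hh|apply Rmin_l]).
      assert (L2 : Cmod h < Re p + 2 * INR (S k))
        by (eapply Rlt_le_trans; [apply Hh|apply Rmin_r]).
      assert (I := HS h ltac:(eapply Rlt_le_trans; [apply L1|apply Rmin_l])).
      destruct (HVf h Hh0 ltac:(eapply Rlt_le_trans; [apply L1|apply Rmin_r])) as [Np' Erf].
      (* Puts the dropped mode m0 back, giving the full series at a point s different from p. *)
      assert (I2 := CIs_plus _ _ _ _ I (CIs_single m0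
        (RtoC (mode_weight m0) * cont_term L (S k) m0 (p + h)%C)%C)).
      assert (Np : (p + h - p <> 0)%C) by (replace (p + h - p)%C with h by ring; exact Hh0).
      set (s := (p + h)%C) in *.
      assert (Hs : 0 < Re s + 2 * INR (S k)).
      { assert (R := re_le_Cmod h); apply Rabs_le_between in R.
        change (0 < Re p + Re h + 2 * INR (S k)); lra. }
      edestruct (Zodd_RHS_cont D eps (S k) s) as [_ EZ]; [exact He|exact Hs| |].
      { eapply CIs_ext; [|exact I2]; intros m; unfold act_except; cbv beta.
        destruct (Nat.eqb_spec m m0) as [->|]; simpl negb; cbv iota; fold L; ring. }
      rewrite EZ; fold L; unfold g; fold (pre s).
      unfold cont_term; fold f w; fold (E0 s).
      change (rf (apar s w) (S k)) with (rf (apar s w) k * (apar s w + RtoC (INR k)))%C.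
      change (rf (bpar s w) (S k)) with (rf (bpar s w) k * (bpar s w + RtoC (INR k)))%C.
      assert (Nsp' : (s - p' <> 0)%C).
      { intros H; apply Np'; replace s with (s - p' + p')%C by ring; rewrite H; ring. }
      assert (Q : ((apar s w + RtoC (INR k)) * (bpar s w + RtoC (INR k))
        = (s - p) * (s - p') / 4)%C).
      { rewrite apar_bpar_mult; f_equal.
        assert (E1 : (RtoC w * RtoC w = RtoC y * RtoC y)%C)
          by (rewrite <- !RtoC_mult; f_equal; destruct Hy as [-> | ->]; ring).
        rewrite E1; unfold p, p'; apply C_ext; destruct s; simpl; ring. }
      transitivity (pre s * (RtoC (mode_weight m0) * E0 s * / X s
          * ((s - p) * rf s (2 * S k)
             * / ((apar s w + RtoC (INR k)) * (bpar s w + RtoC (INR k))))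
        + (s - p) * (rf s (2 * S k) * act_sum L (act_except m0) (S k) s)))%C.
      { unfold X; rewrite !Cinv_mult_total; unfold pre; ring. }
      do 2 f_equal; rewrite Q, Erf; unfold c0.
      set (iX := (/ X s)%C); field.
      repeat split; auto; apply RtoC_neq0; lra.
    + apply (UF_mult (fun _ => pre)
        (fun _ s => c0 * E0 s * V s * / X s
          + (s - p) * (rf s (2 * S k) * act_sum L (act_except m0) (S k) s))%C).
      { apply UF_prefactor. }
      apply (UF_plus (fun _ s => c0 * E0 s * V s * / X s)%C
        (fun _ s => (s - p) * (rf s (2 * S k) * act_sum L (act_except m0) (S k) s))%C).
      * apply (UF_mult (fun _ s => c0 * E0 s * V s)%C (fun _ s => / X s)%C);
          [|now apply UF_inv_fun].
        apply (UF_mult (fun _ s => c0 * E0 s)%C (fun _ => V)); auto.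
        apply (UF_mult (fun _ _ => c0) (fun _ => E0)); auto; apply UF_cst.
      * apply (UF_mult (fun _ s => s - p)%C
          (fun _ s => rf s (2 * S k) * act_sum L (act_except m0) (S k) s)%C).
        { apply (UF_plus (fun _ s => s) (fun _ _ => - p)%C); [apply UF_id|apply UF_cst]. }
        apply (UF_mult (fun _ s => rf s (2 * S k)) (fun _ => act_sum L (act_except m0) (S k))); auto.
        apply UF_rf, UF_id.
Qed.

(** * The odd-indexed terms as hyperbolic cosines *)

Lemma FD_odd (D : Z) (eps epsbar : R) (n : nat) : 1 < eps -> eps * epsbar = -1 ->
  FD D eps epsbar (2 * n + 1)
  = (exp ((2 * INR n + 1) * ln eps) + exp (- ((2 * INR n + 1) * ln eps))) / sqrt (IZR (qD D)).
Proof.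
  intros He Hb; unfold FD; f_equal.
  assert (E : eps ^ (2 * n + 1) = exp ((2 * INR n + 1) * ln eps)).
  { rewrite <- Rpower_pow by lra; unfold Rpower; f_equal; f_equal.
    rewrite plus_INR, mult_INR; simpl; ring. }
  (* Norm -1 makes the conjugate - 1/eps, and the odd exponent lets the sign out: the difference of
     powers becomes a sum, hence cosh and not sinh. *)
  replace epsbar with (- / eps) by (apply Rmult_eq_reg_l with eps; [field_simplify|]; lra).
  rewrite E, exp_Ropp, <- E.
  replace ((- / eps) ^ (2 * n + 1)) with (- (/ eps) ^ (2 * n + 1)).
  - rewrite pow_inv; ring.
  - rewrite (Nat.add_comm _ 1), !pow_add, !pow_mult.
    replace ((- / eps) ^ 2) with ((/ eps) ^ 2) by (simpl; ring); simpl; ring.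
Qed.

Lemma cpow_FD_odd (D : Z) (eps epsbar : R) (s : C) (n : nat) :
  (0 < qD D)%Z -> 1 < eps -> eps * epsbar = -1 ->
  cpow_pos (FD D eps epsbar (2 * n + 1)) (- s)%C
  = (cpow_pos (IZR (qD D)) (s / 2) * chpow s ((2 * INR n + 1) * ln eps))%C.
Proof.
  intros Hq He Hb; apply IZR_lt in Hq.
  rewrite FD_odd by auto; unfold cpow_pos, chpow, lch; rewrite <- Cexp_plus; f_equal.
  set (x := (2 * INR n + 1) * ln eps); assert (Hx := ch2_pos x).
  assert (Hs := sqrt_lt_R0 _ Hq).
  unfold Rdiv; rewrite ln_mult, ln_Rinv by (auto; now apply Rinv_0_lt_compat).
  replace (ln (sqrt (IZR (qD D)))) with (ln (IZR (qD D)) * / 2).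
  - rewrite RtoC_plus, RtoC_opp, RtoC_mult, RtoC_inv by lra; unfold Cdiv; ring.
  - rewrite <- (sqrt_sqrt (IZR (qD D))) at 1 by lra; rewrite ln_mult by auto; field.
Qed.

Lemma qD_pos (D : Z) : (0 < D)%Z -> (0 < qD D)%Z.
Proof. intros H; unfold qD; destruct (Z.eqb (D mod 4) 1); lia. Qed.

Theorem mainTheorem6 (D : Z) (eps : R) (a b : Z)
  (HDpos : (0 < D)%Z) (HDsf : squarefree D)
  (Hrep : OD_rep D a b) (Heps : eps = OD_val D a b)
  (Hfund : fundamental_unit D eps)
  (Hnorm : OD_norm D a b = (-1)%R) :
  let epsbar := OD_conj D a b in
  (* the series over m converges away from the poles of the summands *)
  (forall s : C, ~ in_pole_set eps s -> is_zsum (Zterm eps s) (zsum (Zterm eps s))) /\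
  (* it agrees with the Dirichlet series for Re s > 0 *)
  (forall s : C, (0 < Re s)%R ->
     is_series (K := C_AbsRing) (V := C_NormedModule)
       (fun n : nat => cpow_pos (FD D eps epsbar (2 * n + 1)) (- s)%C)
       (Zodd_RHS D eps s)) /\
  (* meromorphic continuation: holomorphic off the pole set ... *)
  (forall s : C, ~ in_pole_set eps s ->
     ex_derive (K := C_AbsRing) (V := C_NormedModule) (Zodd_RHS D eps) s) /\
  (* ... with a simple pole at each point of the pole set *)
  (forall (k : nat) (m : Z),
     let p : C := (- 2 * INR k, PI * IZR m / ln eps)%R in
     exists r : C, r <> RtoC 0 /\
       filterlim (fun s : C => ((s - p) * Zodd_RHS D eps s)%C) (locally' p) (locally r)).
Proof.
  intros epsbar.
  assert (He : 1 < eps) by apply Hfund.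
  assert (Hb : eps * epsbar = -1) by (rewrite Heps; exact Hnorm).
  split; [|split; [|split]].
  - intros s Hs; now apply Zterm_summable.
  - intros s Hs; eapply CIs_ext; [|now apply Zodd_RHS_dirichlet].
    intros n; symmetry; apply cpow_FD_odd; auto using qD_pos.
  - intros s Hs; now apply Zodd_RHS_holomorphic.
  - intros k m p; exact (Zodd_RHS_simple_pole D eps k m He).
Qed.
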